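(* Let $\nu\ge0$ and $m\ge1$ be integers. The reproducing kernel $\hat S^m_\nu$ of the space $\hat{\mathcal S}^m_\nu$ of symmetric polynomials of degree $<m$ in $L^2([0,1]^r,d\hat\rho_{b,\nu,a})$ is given at the origin by $$\hat S^m_\nu(t,0)=\sum_{|\mathbf m|<m}\frac{2^{d+r\nu}\,P^{(b,\nu,a/2)}_{\mathbf m}(1,\dots,1)}{\|P^{(b,\nu,a/2)}_{\mathbf m}\|^2}\;P^{(b,\nu,a/2)}_{\mathbf m}(1-2t_1,\dots,1-2t_r),$$ where the sum is over signatures $\mathbf m$ and the norm-square is understood on $[-1,+1]^r$, i.e. with respect to the measure $\prod_j(1-t_j)^b(1+t_j)^\nu\prod_{i<j}|t_i-t_j|^a\,dt$ on $[-1,1]^r$.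
   Context: $r,a,b$ are the rank and characteristic multiplicities of an irreducible bounded symmetric domain $\Omega$ (equivalently of its compact dual), $d=\frac{r(r-1)}2a+rb+r$ its dimension. $c_\Omega=\dfrac{\pi^d\,\Gamma(\frac a2+1)^r}{\Gamma_\Omega(\frac{ra}2+1)\Gamma_\Omega(\frac dr)}$ with $\Gamma_\Omega(s)=\prod_{j=1}^r\Gamma(s-\frac{j-1}2a)$. On $[0,1]^r$ let $$d\hat\rho_{b,\nu,a}(t)=c_\Omega\prod_jt_j^b(1-t_j)^\nu\prod_{1\le i<j\le r}|t_i-t_j|^a\,dt .$$ $\hat{\mathcal S}^m_\nu$ is the space of symmetric polynomials of degree $<m$ in $r$ variables with the inner product of $L^2([0,1]^r,d\hat\rho_{b,\nu,a})$; its reproducing kernel $\hat S^m_\nu(x,y)$ satisfies $f(y)=\langle f,\hat S^m_\nu(\cdot,y)\rangle$. A signature is $\mathbf m=(m_1,\dots,m_r)\in\mathbf Z^r$ with $m_1\ge\dots\ge m_r\ge0$; $|\mathbf m|=\sum m_j$. The multivariable Jacobi (Heckman–Opdam) polynomials $P^{(\alpha,\beta,a/2)}_{\mathbf m}(t)$ are the symmetric polynomials on $\mathbf R^r$ such that (i) $P^{(\alpha,\beta,a/2)}_{\mathbf m}$ is the symmetrization of $t^{\mathbf m}+\sum_{\mathbf n<\mathbf m}c_{\mathbf m\mathbf n}t^{\mathbf n}$, the sum being over (some) signatures $\mathbf n$ smaller than $\mathbf m$ in the lexicographic order; (ii) they are mutually orthogonal on $[-1,1]^r$ with respect to $\pr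od_j(1-t_j)^\alpha(1+t_j)^\beta\prod_{i<j}|t_i-t_j|^a\,dt$.
   Formalization: The printed right-hand side is multiplied by 1/c_Ω, since the measure dρ̂ contains c_Ω while the norms do not; as printed it fails for r=1, b=ν=0, m=1 (kernel 1/π, printed value 1). Polynomials are taken with real coefficients. *)

(* Defs.v *)
From HB Require Import structures.
From mathcomp Require Import all_boot all_order all_algebra all_fingroup.
From mathcomp Require Import all_classical all_reals all_analysis.
(* The notations of mpoly clash with those of mathcomp-analysis. *)
From mathcomp Require Import -(notations) mpoly.
From mathcomp Require Import complex.

Set Implicit Arguments.
Unset Strict Implicit.
Unset Printing Implicit Defensive.

Import Order.TTheory GRing.Theory Num.Theory.

Local Open Scope classical_set_scope.
Local Open Scope ring_scope.

(* Irreducible bounded symmetric domains are, up to biholomorphic maps, the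
   spectral unit balls of the simple positive Hermitian Jordan triple systems.
   Their rank and characteristic multiplicities are defined by the joint Peirce
   decomposition of the triple system with respect to a frame. *)

(* T x y z is the triple product {x y z}, with D(x, y) z = {x y z}. *)
Definition hermitian_jts (R : realType) (n : nat)
    (T : 'rV[R[i]]_n -> 'rV[R[i]]_n -> 'rV[R[i]]_n -> 'rV[R[i]]_n) : Prop :=
  [/\ forall (c : R[i]) x x' y z,
        T (c *: x + x') y z = c *: T x y z + T x' y z,
      forall (c : R[i]) x y y' z,
        T x (c *: y + y') z = (c^*)%C *: T x y z + T x y' z,
      forall x y z, T x y z = T z y x
    & forall x y u v z,
        T x y (T u v z) - T u v (T x y z)
        = T (T x y u) v z - T u (T v x y) z].

(* The trace form (x, y) |-> tr D(x, y) is positive definite; on R[i], 0 < w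
   means that w is real and positive. *)
Definition positive_jts (R : realType) (n : nat)
    (T : 'rV[R[i]]_n -> 'rV[R[i]]_n -> 'rV[R[i]]_n -> 'rV[R[i]]_n) : Prop :=
  forall x, x != 0 -> 0 < \tr (lin1_mx (T x x)).

Definition simple_jts (R : realType) (n : nat)
    (T : 'rV[R[i]]_n -> 'rV[R[i]]_n -> 'rV[R[i]]_n -> 'rV[R[i]]_n) : Prop :=
  (0 < n)%N /\
  forall U : {vspace 'rV[R[i]]_n},
    (forall u x y, u \in U -> T u x y \in U /\ T x u y \in U) ->
    U = 0%VS \/ U = fullv.

(* A tripotent e <> 0 is minimal if the 1-eigenspace of D(e, e) is C e. *)
Definition minimal_tripotent (R : realType) (n : nat)
    (T : 'rV[R[i]]_n -> 'rV[R[i]]_n -> 'rV[R[i]]_n -> 'rV[R[i]]_n)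
    (e : 'rV[R[i]]_n) : Prop :=
  [/\ e != 0, T e e e = e
    & forall v, T e e v = v -> exists c : R[i], v = c *: e].

Definition orthogonal_tripotents (R : realType) (n : nat)
    (T : 'rV[R[i]]_n -> 'rV[R[i]]_n -> 'rV[R[i]]_n -> 'rV[R[i]]_n)
    (e f : 'rV[R[i]]_n) : Prop :=
  forall v, T e f v = 0.

Definition frame (R : realType) (n r : nat)
    (T : 'rV[R[i]]_n -> 'rV[R[i]]_n -> 'rV[R[i]]_n -> 'rV[R[i]]_n)
    (e : 'I_r -> 'rV[R[i]]_n) : Prop :=
  [/\ forall k, minimal_tripotent T (e k),
      forall k l, k != l -> orthogonal_tripotents T (e k) (e l)
    & forall f, minimal_tripotent T f ->
        exists k, ~ orthogonal_tripotents T (e k) f].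

Definition joint_eigenspace_dim (R : realType) (n r : nat)
    (T : 'rV[R[i]]_n -> 'rV[R[i]]_n -> 'rV[R[i]]_n -> 'rV[R[i]]_n)
    (e : 'I_r -> 'rV[R[i]]_n) (lambda : 'I_r -> R[i]) (q : nat) : Prop :=
  exists U : {vspace 'rV[R[i]]_n},
    (forall v, v \in U <-> forall k, T (e k) (e k) v = lambda k *: v)
    /\ \dim U = q.

(* r is the rank, a = dim Z_ij for 1 <= i < j <= r, and b = dim Z_i0, where
   D(e_k, e_k) acts on the Peirce space Z_ij as (delta_ik + delta_jk) / 2.  When
   r = 1 there is no pair i < j and a is arbitrary. *)
Definition characteristic_multiplicities (R : realType) (r a b : nat) : Prop :=
  (0 < r)%N /\
  exists (n : nat)
    (T : 'rV[R[i]]_n -> 'rV[R[i]]_n -> 'rV[R[i]]_n -> 'rV[R[i]]_n)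
    (e : 'I_r -> 'rV[R[i]]_n),
    [/\ hermitian_jts T /\ positive_jts T, simple_jts T, frame T e,
        forall i j : 'I_r, (i < j)%N ->
          joint_eigenspace_dim T e
            (fun k => ((k == i)%:R + (k == j)%:R) / 2) a
      & forall i : 'I_r,
          joint_eigenspace_dim T e (fun k => (k == i)%:R / 2) b].

Definition dim_Omega (r a b : nat) : nat := ('C(r, 2) * a + r * b + r)%N.

Definition Gamma (R : realType) (s : R) : R :=
  \int[lebesgue_measure]_(x in `]0, +oo[) (x `^ (s - 1) * expR (- x)).

Definition Gamma_Omega (R : realType) (r a : nat) (s : R) : R :=
  \prod_(j < r) Gamma (s - j%:R / 2 * a%:R).

Definition c_Omega (R : realType) (r a b : nat) : R :=
  let d := dim_Omega r a b in
  pi ^+ d * Gamma (a%:R / 2 + 1) ^+ r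
  / (Gamma_Omega r a ((r * a)%:R / 2 + 1) * Gamma_Omega r a (d%:R / r%:R)).

Definition vcons (R : realType) (n : nat) (x : R) (t : 'I_n -> R) :
    'I_n.+1 -> R :=
  fun i => oapp t x (unlift ord0 i).

(* The integral of f over the cube [l, u]^n, as an iterated Lebesgue integral;
   it is only used for continuous f. *)
Fixpoint cube_integral (R : realType) (l u : R) (n : nat) :
    (('I_n -> R) -> R) -> R :=
  match n with
  | 0 => fun f => f (fun=> 0)
  | n'.+1 => fun f => \int[lebesgue_measure]_(x in `[l, u])
                        cube_integral l u (fun t => f (vcons x t))
  end.

Definition vandermonde_weight (R : realType) (r a : nat) (t : 'I_r -> R) : R :=
  \prod_(i < r) \prod_(j < r | (i < j)%N) `|t i - t j| ^+ a.

Definition rho_inner (R : realType) (r b nu a : nat)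
    (f g : ('I_r -> R) -> R) : R :=
  cube_integral 0 1 (fun t => f t * g t *
    (c_Omega R r a b * \prod_(j < r) (t j ^+ b * (1 - t j) ^+ nu)
     * vandermonde_weight a t)).

Definition jacobi_inner (R : realType) (r al be a : nat)
    (f g : ('I_r -> R) -> R) : R :=
  cube_integral (-1) 1 (fun t => f t * g t *
    (\prod_(j < r) ((1 - t j) ^+ al * (1 + t j) ^+ be)
     * vandermonde_weight a t)).

Definition polyfun (R : realType) (r : nat) (p : mpoly r R) (t : 'I_r -> R) : R :=
  meval t p.

(* msize p is 1 + deg p, and 0 if p = 0. *)
Definition sym_polys (R : realType) (r m : nat) : set (('I_r -> R) -> R) :=
  [set f | exists p : mpoly r R,
     [/\ p \is @symmetric r R, (msize p <= m)%N & f = polyfun p]].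

Definition reproducing_kernel (R : realType) (X : Type)
    (H : set (X -> R)) (inner : (X -> R) -> (X -> R) -> R)
    (K : X -> X -> R) : Prop :=
  forall y, H (fun x => K x y) /\
    forall f, H f -> f y = inner f (fun x => K x y).

Definition signature (r : nat) (m : multinom r) : bool :=
  [forall i : 'I_r, forall j : 'I_r, (i <= j)%N ==> (m j <= m i)%N].

Definition lex_lt (r : nat) (n m : multinom r) : bool :=
  [exists i : 'I_r, (n i < m i)%N &&
     [forall j : 'I_r, (j < i)%N ==> (n j == m j)]].

Definition symmetrization (R : realType) (r : nat) (p : mpoly r R) : mpoly r R :=
  (r`!%:R^-1 : R) *: \sum_(s : 'S_r) msym s p.

(* P m, for m a signature, is the Jacobi polynomial with parameters
   (al, be, a/2). *)
Definition jacobi_polynomials (R : realType) (r al be a : nat)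
    (P : multinom r -> mpoly r R) : Prop :=
  (forall m, signature m ->
     exists q : mpoly r R,
       (forall n, n \in msupp q -> signature n /\ lex_lt n m) /\
       P m = symmetrization (mpolyX R m + q)) /\
  (forall m n, signature m -> signature n -> m <> n ->
     jacobi_inner al be a (polyfun (P m)) (polyfun (P n)) = 0).

(* Main.v *)
(* The [P m] arise from the symmetrized monomials [e m] by the Gram-Schmidt process
   in lexicographic order, so [P m] could a priori contain monomials of degree
   larger than [|m|]. It does not; hence the [P k] with [|k| < m] form an
   orthogonal basis of the symmetric polynomials of degree less than [m], and the
   kernel at the origin is read off after the substitution [t -> 1 - 2t].

   To bound the degree, let the exponent of [1 + t] be an arbitrary natural number
   [N]. Integration by parts in the Dirichlet form
   [sum_i int (1 - t_i^2) (d_i f) (d_i g)] gives a self-adjoint second-order operator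
   which is triangular on the [e n], for the lexicographic order and for the degree
   simultaneously, with eigenvalues [- (N |n| + mu_n)]. Let [x_N] be the projection
   of [e m] orthogonal to all [e n] with [n < m] and [|n| <= |m|]. It is an
   eigenvector, hence is orthogonal to [e n] also when [n < m] and [|n| > |m|],
   unless the two eigenvalues coincide, which happens for at most one [N]. But the
   inner products, normalised by the total mass, are rational functions of [N]
   without natural poles, so this orthogonality persists for every [N]. For [N = nu]
   it shows that [P m = x_nu], which has degree [|m|]. *)

Require Import Defs.
From HB Require Import structures.
From mathcomp Require Import all_boot all_order all_algebra all_fingroup.
From mathcomp Require Import all_classical all_reals all_analysis.
From mathcomp Require Import -(notations) mpoly.
From mathcomp Require Import ring lra zify.

Set Implicit Arguments.
Unset Strict Implicit.
Unset Printing Implicit Defensive.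

Import Order.TTheory GRing.Theory Num.Theory.
Import numFieldNormedType.Exports.
Local Open Scope ring_scope.

(** * Integration over the cube *)

(** Rationality in [N] needs no closed form of any integral. Testing the Dirichlet form against the
    constant 1 kills the gradient, so the image of [e k] under the operator has integral 0; by
    triangularity the mean of [e k] is a combination of means of lower terms divided by
    [N |k| + mu_k]. The bound [mu_k >= |k|] makes this denominator positive at every natural [N]
    when [k] is nonzero. Gram-Schmidt then divides only by square norms, which are positive at every
    [N], so no natural pole is ever created. The lexicographic order is not compatible with
    permuting exponents; a permutation-invariant numerical weight replaces it, so that lower terms
    remain lower after symmetrization. On the analytic side, polynomial divided differences absorb
    the poles of the logarithmic derivative of the Vandermonde factor. All integrands are Lipschitz
    on the cube, a class stable under integrating out a variable; exchange of integrals and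
    substitution are both derived from increments that are quadratically small. *)

Lemma constant_of_quadratic (R : realType) (l u C : R) (A : R -> R) :
  l <= u ->
  (forall z z', l <= z -> z <= z' -> z' <= u ->
     `|A z' - A z| <= C * (z' - z) ^+ 2) ->
  A u = A l.
Proof.
move=> lu hA.
(* With [N.+1] equal steps, each of quadratically small increment, the total increment is
   [O(1/N)]. *)
have hN (N : nat) : `|A u - A l| <= C * (u - l) ^+ 2 / N.+1%:R.
  pose h := (u - l) / N.+1%:R.
  have h0 : 0 <= h by rewrite divr_ge0// subr_ge0.
  have hE : h * N.+1%:R = u - l by rewrite /h divfK.
  have step k : (k <= N.+1)%N -> `|A (l + h * k%:R) - A l| <= C * h ^+ 2 * k%:R.
    elim: k => [|k IH] kN; first by rewrite !mulr0 addr0 subrr normr0.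
    have := hA (l + h * k%:R) (l + h * k.+1%:R).
    have kh : h * k%:R <= h * k.+1%:R by rewrite ler_wpM2l// ler_nat.
    have kh' : h * k.+1%:R <= u - l by rewrite -hE ler_wpM2l// ler_nat.
    have k0 : 0 <= h * k%:R by rewrite mulr_ge0.
    move=> /(_ _ _ _)/wrap[]; [lra|lra|lra|].
    have -> : l + h * k.+1%:R - (l + h * k%:R) = h by rewrite -natr1; ring.
    move=> h1; have h2 := IH (ltnW kN).
    have -> : C * h ^+ 2 * k.+1%:R = C * h ^+ 2 + C * h ^+ 2 * k%:R.
      by rewrite -natr1; ring.
    rewrite -(subrK (A (l + h * k%:R)) (A (l + h * k.+1%:R))) -addrA.
    by rewrite (le_trans (ler_normD _ _))// lerD.
  have := step N.+1 (leqnn _); rewrite hE subrKC => /le_trans; apply.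
  rewrite le_eqVlt; apply/orP; left; apply/eqP.
  have n0 : N.+1%:R != 0 :> R by rewrite pnatr_eq0.
  by rewrite /h; move: n0; set n := N.+1%:R => n0; field.
apply/eqP; rewrite -subr_eq0 -normr_eq0 eq_le normr_ge0 andbT leNgt.
apply/negP => h0.
pose e := `|A u - A l|; pose M := C * (u - l) ^+ 2.
have Me : 0 <= M / e.
  have := hN 0%N; rewrite divr1 => hM.
  by rewrite divr_ge0// ltW// (lt_le_trans h0).
have [N MN] : exists N : nat, M / e < N.+1%:R.
  exists (Num.truncn (M / e)); exact: truncnS_gt.
have := hN N; rewrite leNgt => /negP; apply.
by rewrite ltr_pdivrMr// [ltRHS]mulrC -ltr_pdivrMr.
Qed.

(** * Integrals of Lipschitz functions of one variable *)

Section OneVariable.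
Variables (R : realType) (l u : R).
Hypothesis lu : l <= u.
Local Notation mu := (@lebesgue_measure R).
Implicit Types (f g : R -> R) (K : R).

(** The constant is explicit because, when a variable is integrated out, the constant of the result
    is computed from it; this yields integrability at each level of an iterated integral. *)
Definition lips K f := 0 <= K /\ forall x y, l <= x <= u -> l <= y <= u ->
  `|f x - f y| <= K * `|x - y|.

Lemma lips_continuous K f : lips K f -> ({within `[l, u], continuous f})%classic.
Proof.
move=> [K0 Kf]; apply/subspace_continuousP => x /=; rewrite in_itv/= => xlu.
apply/cvgrPdist_le => /= e e0.
have d0 : 0 < e / (K + 1) by rewrite divr_gt0// ltr_wpDl.
near=> y.
have ylu : l <= y <= u.
  have : (`[l, u]%classic : set R) y by near: y; exact: withinT.
  by rewrite /= in_itv.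
apply: (le_trans (Kf _ _ xlu ylu)).
have : `|x - y| <= e / (K + 1).
  near: y; apply: cvg_within; apply: filterS (nbhsx_ballx x _ d0) => z.
  by rewrite /ball/= => /ltW.
rewrite ler_pdivlMr ?ltr_wpDl// => h.
by apply: le_trans h; rewrite mulrC ler_wpM2l// lerDl.
Unshelve. all: by end_near. Qed.

Lemma lips_integrable K f : lips K f ->
  mu.-integrable `[l, u]%classic (EFin \o f).
Proof.
move=> Kf; apply: continuous_compact_integrable; first exact: segment_compact.
exact: lips_continuous Kf.
Qed.

Lemma lips_integrableS K f z z' : lips K f -> l <= z -> z' <= u ->
  mu.-integrable `[z, z']%classic (EFin \o f).
Proof.
move=> Kf lz zu; apply: integrableS (lips_integrable Kf) => //.
by move=> x /=; rewrite !in_itv/= => /andP[zx xz]; rewrite (le_trans lz)//= (le_trans xz).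
Qed.

Lemma lips_integrable_oc K f z z' : lips K f -> l <= z -> z' <= u ->
  mu.-integrable `]z, z']%classic (EFin \o f).
Proof.
move=> Kf lz zu; apply: integrableS (lips_integrableS Kf lz zu) => //.
exact: subset_itv_oc_cc.
Qed.

Lemma Rintegral_segment_cst z z' (c : R) : z <= z' ->
  \int[mu]_(x in `[z, z']) c = c * (z' - z).
Proof.
move=> zz; rewrite Rintegral_cst//= lebesgue_measure_itv/= lte_fin.
have [//|zz'] := ltP z z'.
by have -> : z' = z by [apply/eqP; rewrite eq_le zz zz']; rewrite subrr.
Qed.

Lemma lips_cst c : lips 0 (fun=> c).
Proof. by split=> // x y _ _; rewrite subrr normr0 mul0r. Qed.

Lemma Rintegral_segment_le z z' K f M : lips K f -> l <= z -> z <= z' -> z' <= u ->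
  (forall x, z <= x <= z' -> `|f x| <= M) ->
  `|\int[mu]_(x in `[z, z']) f x| <= M * (z' - z).
Proof.
move=> Kf lz zz zu fM; have fi := lips_integrableS Kf lz zu.
apply: le_trans (le_normr_Rintegral _ fi) _ => //.
rewrite -Rintegral_segment_cst//; apply: le_Rintegral => //.
- exact: integrable_norm fi.
- exact: lips_integrableS (lips_cst M) lz zu.
Qed.

Lemma lips_add K K' f g : lips K f -> lips K' g -> lips (K + K') (fun x => f x + g x).
Proof.
move=> [K0 Kf] [K0' Kg]; split=> [|x y xlu ylu]; first exact: addr_ge0.
rewrite opprD addrACA mulrDl.
by rewrite (le_trans (ler_normD _ _))// lerD// (Kf, Kg).
Qed.

Lemma lips_sub K K' f g : lips K f -> lips K' g -> lips (K + K') (fun x => f x - g x).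
Proof.
move=> [K0 Kf] [K0' Kg]; split=> [|x y xlu ylu]; first exact: addr_ge0.
rewrite opprD addrACA mulrDl (le_trans (ler_normD _ _))// lerD ?Kf//.
by rewrite opprK addrC distrC Kg.
Qed.

Lemma lips_scale K f c : lips K f -> lips (`|c| * K) (fun x => c * f x).
Proof.
move=> [K0 Kf]; split=> [|x y xlu ylu]; first exact: mulr_ge0.
rewrite -mulrBr normrM -mulrA ler_wpM2l//.
exact: Kf.
Qed.

Lemma Rintegral_segment_linear K K' f g c z z' : lips K f -> lips K' g ->
  l <= z -> z' <= u ->
  \int[mu]_(x in `[z, z']) (f x + c * g x) =
  \int[mu]_(x in `[z, z']) f x + c * \int[mu]_(x in `[z, z']) g x.
Proof.
move=> Kf Kg lz zu.
rewrite RintegralD//; last 2 first.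
- exact: lips_integrableS Kf lz zu.
- exact: lips_integrableS (lips_scale c Kg) lz zu.
by rewrite RintegralZl//; exact: lips_integrableS Kg lz zu.
Qed.

(** A quantitative derivative of the primitive of [f]: this is what supplies the quadratic
    increments for [constant_of_quadratic]. *)
Lemma Rintegral_segment_step K f z z' : lips K f -> l <= z -> z <= z' -> z' <= u ->
  `|\int[mu]_(x in `[l, z']) f x - \int[mu]_(x in `[l, z]) f x
    - f z * (z' - z)| <= K * (z' - z) ^+ 2.
Proof.
move=> Kf lz zz zu.
have fi := lips_integrableS Kf (lexx l) zu.
rewrite Rintegral_itvB ?bnd_simp//.
rewrite Rintegral_itv_obnd_cbnd; last first.
  exact: lips_integrable_oc Kf _ _.
have -> : f z * (z' - z) = \int[mu]_(x in `[z, z']) f z.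
  by rewrite Rintegral_segment_cst.
rewrite -RintegralB//; last 2 first.
- exact: lips_integrableS Kf lz zu.
- exact: lips_integrableS (lips_cst (f z)) lz zu.
rewrite expr2 mulrA.
apply: (Rintegral_segment_le (lips_add Kf (lips_cst (- f z)))) => //.
move=> x /andP[zx xz]; case: Kf => K0 Kf.
apply: le_trans (Kf _ _ _ _) _.
- by rewrite (le_trans lz)//= (le_trans xz).
- by rewrite lz (le_trans zz).
by rewrite ler_wpM2l// ger0_norm ?subr_ge0// lerD2r.
Qed.

(** If the integral were 0, all primitives from [l] would vanish, and a short step to the right of
    [z < u] would force [f z = 0]. The endpoint [u] has no room to its right; there the Lipschitz
    bound compares [f u] with values just before it. *)
Lemma Rintegral_gt0 K f x0 : l < u -> lips K f ->
  (forall x, l <= x <= u -> 0 <= f x) -> l <= x0 <= u -> 0 < f x0 ->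
  0 < \int[mu]_(x in `[l, u]) f x.
Proof.
move=> lu' Kf f0 x0lu fx0.
have J0 z z' : l <= z -> z <= z' -> z' <= u ->
    0 <= \int[mu]_(x in `[z, z']) f x.
  move=> lz zz zu; apply: Rintegral_ge0 => x /=; rewrite in_itv/= => /andP[zx xz].
  by apply: f0; rewrite (le_trans lz)//= (le_trans xz).
rewrite lt_def J0// andbT; apply/negP => /eqP I0.
have Jz z : l <= z <= u -> \int[mu]_(x in `[l, z]) f x = 0.
  move=> /andP[lz zu]; have fi := lips_integrableS Kf (lexx l) (lexx u).
  have := @Rintegral_itvB _ _ _ _ z fi; rewrite !bnd_simp => /(_ lz zu).
  rewrite I0 sub0r Rintegral_itv_obnd_cbnd; last first.
    exact: lips_integrable_oc Kf _ _.
  move=> h; have := J0 z u lz zu (lexx u); rewrite -h oppr_ge0 => h1.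
  by apply/eqP; rewrite eq_le h1 J0.
have fz z : l <= z < u -> f z = 0.
  move=> /andP[lz zu]; apply/eqP; rewrite eq_le (f0 z) ?andbT; last by rewrite lz ltW.
  apply/ler_addgt0Pr => e e0; rewrite add0r.
  have [K0 _] := Kf.
  (* [K + 1] avoids a division by 0; the step estimate divided by [h] gives [f z <= K * h <= e]. *)
  pose h := Num.min (u - z) (e / (K + 1)).
  have K1 : 0 < K + 1 by rewrite ltr_wpDl.
  have h0 : 0 < h by rewrite lt_min subr_gt0 zu divr_gt0.
  have hu : h <= u - z by rewrite ge_min lexx.
  have he : h * (K + 1) <= e by rewrite -ler_pdivlMr// ge_min lexx orbT.
  have := @Rintegral_segment_step K f z (z + h) Kf lz.
  rewrite !Jz; [|lra|lra]; rewrite subrr sub0r normrN addrAC subrr add0r.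
  move=> /(_ _ _)/wrap[]; [lra|lra|].
  rewrite normrM (ger0_norm (ltW h0)) (ger0_norm (f0 _ _)); last lra.
  rewrite expr2 mulrA ler_pM2r// => /le_trans; apply.
  by apply: le_trans he; rewrite mulrC ler_pM2l// lerDl.
have [x0u|x0u] := ltP x0 u.
  by move: fx0; rewrite fz ?ltxx//; case/andP: x0lu => ->.
have {x0u} E : x0 = u by apply/eqP; rewrite eq_le x0u; case/andP: x0lu => _ ->.
subst x0; case: Kf => K0 Kf.
(* The factor 1/2 gives [f u <= K * h <= f u / 2], a contradiction. *)
pose h := Num.min (u - l) (f u / (K + 1) / 2).
have K1 : 0 < K + 1 by rewrite ltr_wpDl.
have h0 : 0 < h by rewrite lt_min subr_gt0 lu' !divr_gt0.
have hu : h <= u - l by rewrite ge_min lexx.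
have he : h <= f u / (K + 1) / 2 by rewrite ge_min lexx orbT.
have := Kf u (u - h); rewrite (fz (u - h)); last lra.
move=> /(_ _ _)/wrap[]; [lra|lra|]; rewrite subr0 opprB addrC subrK.
rewrite (ger0_norm (ltW fx0)) (ger0_norm (ltW h0)) => h1.
have : (K + 1) * h <= (K + 1) * (f u / (K + 1) / 2) by rewrite ler_pM2l.
have -> : (K + 1) * (f u / (K + 1) / 2) = f u / 2 by field; rewrite gt_eqF.
lra.
Qed.

End OneVariable.

Lemma vcons0 (R : realType) n (x : R) (t : 'I_n -> R) : vcons x t ord0 = x.
Proof. by rewrite /vcons unlift_none. Qed.

Lemma vcons_lift (R : realType) n (x : R) (t : 'I_n -> R) j :
  vcons x t (lift ord0 j) = t j.
Proof. by rewrite /vcons liftK. Qed.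

(** * Iterated integrals of Lipschitz functions over a cube *)

Section Cube.
Variables (R : realType) (l u : R).
Hypothesis lu : l <= u.
Local Notation mu := (@lebesgue_measure R).
Local Notation C := (cube_integral l u).

Definition box n (t : 'I_n -> R) := forall i, l <= t i <= u.

(** The l1 distance splits additively when a coordinate is prepended ([sum_vcons]), which suits the
    recursion of [cube_integral]. *)
Definition lipbox K n (f : ('I_n -> R) -> R) := 0 <= K /\
  forall s t, box s -> box t -> `|f s - f t| <= K * \sum_i `|s i - t i|.

Definition lipschitz_cube n (f : ('I_n -> R) -> R) := exists K, lipbox K f.

Lemma box_vcons n x (t : 'I_n -> R) : l <= x <= u -> box t -> box (vcons x t).
Proof. by move=> xlu bt i; case: (unliftP ord0 i) => [j|] ->; rewrite ?vcons_lift ?vcons0. Qed.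

Lemma sum_vcons n x y (s t : 'I_n -> R) :
  \sum_i `|vcons x s i - vcons y t i| = `|x - y| + \sum_i `|s i - t i|.
Proof.
rewrite big_ord_recl !vcons0; congr (_ + _).
by apply: eq_bigr => i _; rewrite !vcons_lift.
Qed.

Lemma lipbox_vconsl K n (f : ('I_n.+1 -> R) -> R) x :
  lipbox K f -> l <= x <= u -> lipbox K (fun t => f (vcons x t)).
Proof.
move=> [K0 Kf] xlu; split=> // s t bs bt.
apply: le_trans (Kf _ _ (box_vcons xlu bs) (box_vcons xlu bt)) _.
by rewrite sum_vcons subrr normr0 add0r.
Qed.

Lemma lipbox_vconsr K n (f : ('I_n.+1 -> R) -> R) t :
  lipbox K f -> box t -> lips l u K (fun x => f (vcons x t)).
Proof.
move=> [K0 Kf] bt; split=> // x y xlu ylu.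
apply: le_trans (Kf _ _ (box_vcons xlu bt) (box_vcons ylu bt)) _.
rewrite sum_vcons [X in _ + X]big1 ?addr0// => i _.
by rewrite subrr normr0.
Qed.

Lemma lipbox_add n K K' (f g : ('I_n -> R) -> R) : lipbox K f -> lipbox K' g ->
  lipbox (K + K') (fun t => f t + g t).
Proof.
move=> [K0 Kf] [K0' Kg]; split=> [|s t bs bt]; first exact: addr_ge0.
rewrite opprD addrACA mulrDl (le_trans (ler_normD _ _))// lerD//.
  exact: Kf. exact: Kg.
Qed.

Lemma lipbox_scale n K c (f : ('I_n -> R) -> R) : lipbox K f ->
  lipbox (`|c| * K) (fun t => c * f t).
Proof.
move=> [K0 Kf]; split=> [|s t bs bt]; first exact: mulr_ge0.
by rewrite -mulrBr normrM -mulrA ler_wpM2l// Kf.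
Qed.

Lemma eq_cube_integral n (f g : ('I_n -> R) -> R) :
  (forall t, box t -> f t = g t) -> C f = C g.
Proof.
elim: n f g => [|n IH] f g fg /=; first by apply: fg => -[].
apply: eq_Rintegral => x; rewrite inE/= in_itv/= => xlu.
by apply: IH => t bt; apply: fg; exact: box_vcons.
Qed.

(** Both claims go through one induction: linearity in dimension [n.+1] needs the inner integral to
    be Lipschitz in the outer variable, and this follows from linearity together with the bound in
    dimension [n]. *)
Lemma cube_integral_linear_bounded n :
  (forall (f g : ('I_n -> R) -> R) c, lipschitz_cube f -> lipschitz_cube g ->
    C (fun t => f t + c * g t) = C f + c * C g) /\
  (forall (f : ('I_n -> R) -> R) M, lipschitz_cube f ->
    (forall t, box t -> `|f t| <= M) -> `|C f| <= M * (u - l) ^+ n).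
Proof.
elim: n => [|n [IHl IHb]].
  split=> [//|f M _ fM /=]; rewrite expr0 mulr1.
  by apply: fM => -[].
have inner K (f : ('I_n.+1 -> R) -> R) : lipbox K f ->
    lips l u (K * (u - l) ^+ n) (fun x => C (fun t => f (vcons x t))).
  move=> Kf; split=> [|x y xlu ylu].
    by rewrite mulr_ge0 ?exprn_ge0 ?subr_ge0//; case: Kf.
  have hx : lipschitz_cube (fun t => f (vcons x t)).
    by exists K; exact: lipbox_vconsl.
  have hy : lipschitz_cube (fun t => f (vcons y t)).
    by exists K; exact: lipbox_vconsl.
  have := IHl _ _ (-1) hx hy; rewrite mulN1r => <-.
  rewrite mulrAC; apply: IHb => [|t bt].
    by exists (K + `|-1| * K); apply: lipbox_add (lipbox_scale _ _);
      exact: lipbox_vconsl.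
  rewrite mulN1r; exact: (lipbox_vconsr Kf bt).2.
split=> [f g c [K Kf] [K' Kg]|f M [K Kf] fM] /=.
  rewrite -(Rintegral_segment_linear c (inner _ _ Kf) (inner _ _ Kg))//.
  apply: eq_Rintegral => x; rewrite inE/= in_itv/= => xlu.
  apply: IHl; first by exists K; exact: lipbox_vconsl.
  by exists K'; exact: lipbox_vconsl.
rewrite exprSr mulrA; apply: (Rintegral_segment_le (inner _ _ Kf)) => // x xlu.
apply: IHb; first by exists K; exact: lipbox_vconsl.
by move=> t bt; apply: fM; exact: box_vcons.
Qed.

Lemma cube_integral_linear n (f g : ('I_n -> R) -> R) c :
  lipschitz_cube f -> lipschitz_cube g ->
  C (fun t => f t + c * g t) = C f + c * C g.
Proof. exact: (cube_integral_linear_bounded n).1. Qed.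

Lemma cube_integral_le n (f : ('I_n -> R) -> R) M : lipschitz_cube f ->
  (forall t, box t -> `|f t| <= M) -> `|C f| <= M * (u - l) ^+ n.
Proof. exact: (cube_integral_linear_bounded n).2. Qed.

Lemma cube_integral0 n : C (fun _ : 'I_n -> R => 0) = 0.
Proof.
have /(_ _ _)/wrap[] := @cube_integral_le n (fun=> 0) 0.
- by exists 0; split=> // s t _ _; rewrite subrr normr0 mul0r.
- by move=> t _; rewrite normr0.
by rewrite mul0r normr_le0 => /eqP.
Qed.

Lemma lips_cube_integral n K (F : R -> ('I_n -> R) -> R) :
  (forall x, l <= x <= u -> lipschitz_cube (F x)) ->
  0 <= K ->
  (forall x y t, l <= x <= u -> l <= y <= u -> box t ->
     `|F x t - F y t| <= K * `|x - y|) ->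
  lips l u (K * (u - l) ^+ n) (fun x => C (F x)).
Proof.
move=> F1 K0 F2; split=> [|x y xlu ylu].
  by rewrite mulr_ge0 ?exprn_ge0 ?subr_ge0.
have := cube_integral_linear (-1) (F1 _ xlu) (F1 _ ylu); rewrite mulN1r => <-.
rewrite mulrAC; apply: cube_integral_le => [|t bt].
  have [Kx hx] := F1 _ xlu; have [Ky hy] := F1 _ ylu.
  by exists (Kx + `|-1| * Ky); exact: lipbox_add (lipbox_scale _ _).
by rewrite mulN1r; exact: F2.
Qed.

(** Truncate the [x]-integration at [z] on both sides. The two truncated integrals agree at [z = l],
    and both grow by [g z * (z' - z)] up to a quadratic error, so their difference [A] is
    constant. *)
Lemma Rintegral_swap K (F : R -> R -> R) : 0 <= K ->
  (forall x x' y y', l <= x <= u -> l <= x' <= u -> l <= y <= u -> l <= y' <= u ->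
     `|F x y - F x' y'| <= K * (`|x - x'| + `|y - y'|)) ->
  \int[mu]_(x in `[l, u]) \int[mu]_(y in `[l, u]) F x y =
  \int[mu]_(y in `[l, u]) \int[mu]_(x in `[l, u]) F x y.
Proof.
move=> K0 KF.
have KFx x : l <= x <= u -> lips l u K (F x).
  move=> xlu; split=> // y y' ylu ylu'.
  by rewrite (le_trans (KF _ _ _ _ xlu xlu ylu ylu'))// subrr normr0 add0r.
have KFy y : l <= y <= u -> lips l u K (F^~ y).
  move=> ylu; split=> // x x' xlu xlu'.
  by rewrite (le_trans (KF _ _ _ _ xlu xlu' ylu ylu))// subrr normr0 addr0.
have ul0 : 0 <= u - l by rewrite subr_ge0.
pose g x := \int[mu]_(y in `[l, u]) F x y.
have Kg : lips l u (K * (u - l)) g.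
  split=> [|x x' xlu xlu']; first exact: mulr_ge0.
  rewrite /g -RintegralB//; [|exact: lips_integrable (KFx _ _)..].
  rewrite mulrAC; apply: (Rintegral_segment_le
    (lips_sub (KFx _ xlu) (KFx _ xlu'))) => // y ylu.
  by rewrite (le_trans (KF _ _ _ _ xlu xlu' ylu ylu))// subrr normr0 addr0.
have Kh z : l <= z <= u -> lips l u (K * (u - l))
    (fun y => \int[mu]_(x in `[l, z]) F x y).
  move=> /andP[lz zu]; split=> [|y y' ylu ylu']; first exact: mulr_ge0.
  rewrite -RintegralB//; [|exact: lips_integrableS (KFy _ _) _ _..].
  rewrite mulrAC; apply: (@le_trans _ _ (K * `|y - y'| * (z - l))); last first.
    by rewrite ler_wpM2l ?mulr_ge0// lerD2r.
  apply: (Rintegral_segment_le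
    (lips_sub (KFy _ ylu) (KFy _ ylu'))) => // x /andP[lx xz].
  have xlu : l <= x <= u by rewrite lx (le_trans xz).
  by rewrite (le_trans (KF _ _ _ _ xlu xlu ylu ylu'))// subrr normr0 add0r.
pose A z := \int[mu]_(x in `[l, z]) g x -
  \int[mu]_(y in `[l, u]) \int[mu]_(x in `[l, z]) F x y.
have Al : A l = 0.
  rewrite /A set_itv1 Rintegral_set1 sub0r; apply/eqP; rewrite oppr_eq0; apply/eqP.
  under eq_Rintegral do rewrite Rintegral_set1.
  by rewrite Rintegral_segment_cst// mul0r.
apply/eqP; rewrite -subr_eq0; apply/eqP; rewrite -[LHS]/(A u) -Al.
apply: (@constant_of_quadratic _ _ _ (K * (u - l) + K * (u - l))) => //.
move=> z z' lz zz zu.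
have zlu : l <= z <= u by rewrite lz (le_trans zz).
have zlu' : l <= z' <= u by rewrite zu (le_trans lz).
have h1 := Rintegral_segment_step Kg lz zz zu.
have h2 : `|\int[mu]_(y in `[l, u]) \int[mu]_(x in `[l, z']) F x y
   - \int[mu]_(y in `[l, u]) \int[mu]_(x in `[l, z]) F x y
   - g z * (z' - z)| <= K * (z' - z) ^+ 2 * (u - l).
  have L1 := lips_sub (Kh _ zlu') (Kh _ zlu).
  have L2 := lips_scale (z' - z) (KFx _ zlu).
  rewrite /g mulrC -RintegralZl//; last exact: lips_integrable (KFx _ _).
  rewrite -RintegralB//; [|exact: lips_integrable (Kh _ _)..].
  rewrite -RintegralB//; last exact: lips_integrable L2; last first.
    exact: lips_integrable L1.
  apply: (Rintegral_segment_le
     (lips_sub L1 L2)) => // y ylu.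
  by rewrite mulrC; apply: Rintegral_segment_step (KFy _ ylu) _ _ _.
rewrite [_ * _ ^+ 2]mulrDl.
rewrite /A.
set a' := Rintegral _ _ _ in h1 *; set a := Rintegral _ _ _ in h1 *.
set b' := Rintegral _ _ _ in h2 *; set b := Rintegral _ _ _ in h2 *.
have -> : a' - b' - (a - b) =
  (a' - a - g z * (z' - z)) - (b' - b - g z * (z' - z)) by ring.
by rewrite (le_trans (ler_normB _ _))// lerD// mulrAC.
Qed.

Lemma cube_integral_swap n K (F : R -> ('I_n -> R) -> R) : 0 <= K ->
  (forall x x' s t, l <= x <= u -> l <= x' <= u -> box s -> box t ->
     `|F x s - F x' t| <= K * (`|x - x'| + \sum_i `|s i - t i|)) ->
  \int[mu]_(x in `[l, u]) C (F x) =
  C (fun t => \int[mu]_(x in `[l, u]) F x t).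
Proof.
have ul0 : 0 <= u - l by rewrite subr_ge0.
elim: n F K => [|n IH] F K K0 KF //=.
have Fv x y : l <= x <= u -> l <= y <= u -> lipbox K (fun t => F x (vcons y t)).
  move=> xlu ylu; split=> // s t bs bt.
  apply: le_trans (KF _ _ _ _ xlu xlu (box_vcons ylu bs) (box_vcons ylu bt)) _.
  by rewrite sum_vcons !subrr normr0 !add0r.
rewrite (@Rintegral_swap (K * (u - l) ^+ n)) ?mulr_ge0 ?exprn_ge0//; last first.
  move=> x x' y y' xlu xlu' ylu ylu'.
  have h1 : lipschitz_cube (fun t => F x (vcons y t)) by exists K; exact: Fv.
  have h2 : lipschitz_cube (fun t => F x' (vcons y' t)) by exists K; exact: Fv.
  have := cube_integral_linear (-1) h1 h2; rewrite mulN1r => <-.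
  rewrite mulrAC; apply: cube_integral_le => [|t bt].
    exists (K + `|-1| * K); apply: lipbox_add (lipbox_scale _ _); exact: Fv.
  rewrite mulN1r.
  apply: le_trans (KF _ _ _ _ xlu xlu' (box_vcons ylu bt) (box_vcons ylu' bt)) _.
  rewrite sum_vcons [X in _ + (_ + X)]big1 ?addr0// => i _.
  by rewrite subrr normr0.
apply: eq_Rintegral => y; rewrite inE/= in_itv/= => ylu.
apply: (IH _ K) => // x x' s t xlu xlu' bs bt.
apply: le_trans (KF _ _ _ _ xlu xlu' (box_vcons ylu bs) (box_vcons ylu bt)) _.
by rewrite sum_vcons subrr normr0 add0r.
Qed.

Definition upd n (t : 'I_n -> R) (i : 'I_n) (x : R) : 'I_n -> R :=
  fun j => if j == i then x else t j.

(** Coordinate [i] is moved to the innermost integral, where the hypothesis applies. It serves for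
    integrands that are partial derivatives in direction [i]. *)
Lemma cube_integral_eq0 n (f : ('I_n -> R) -> R) i : lipschitz_cube f ->
  (forall t, box t -> \int[mu]_(x in `[l, u]) f (upd t i x) = 0) -> C f = 0.
Proof.
elim: n f i => [|n IH] f i; first by case: i.
move=> [K Kf] fi /=; case: (unliftP ord0 i) => [j|] ij; subst i.
  rewrite (@eq_Rintegral _ _ _ _ _ (fun=> 0)) ?Rintegral_segment_cst ?mul0r//.
  move=> x; rewrite inE/= in_itv/= => xlu.
  apply: (IH _ j) => [|t bt]; first by exists K; exact: lipbox_vconsl.
  rewrite -[RHS](fi _ (box_vcons xlu bt)).
  apply: eq_Rintegral => y _; congr f; apply/funext => k; rewrite /upd.
  by case: (unliftP ord0 k) => [k'|] ->; rewrite ?vcons_lift ?vcons0 ?(inj_eq lift_inj).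
rewrite (@cube_integral_swap _ K); first last.
- move=> x x' s t xlu xlu' bs bt; rewrite -sum_vcons.
  by apply: Kf.2; exact: box_vcons.
- by case: Kf.
rewrite (@eq_cube_integral _ _ (fun=> 0)); last first.
  (* The value [l] is a placeholder, overwritten by [upd]. *)
  move=> t bt; rewrite -[RHS](fi (vcons l t)); last first.
    by apply: box_vcons => //; rewrite lexx.
  apply: eq_Rintegral => y _; congr f; apply/funext => k; rewrite /upd.
  by case: (unliftP ord0 k) => [k'|] ->; rewrite ?vcons_lift ?vcons0 ?eqxx.
exact: cube_integral0.
Qed.

Lemma cube_integral_ge0 n (f : ('I_n -> R) -> R) :
  (forall t, box t -> 0 <= f t) -> 0 <= C f.
Proof.
elim: n f => [|n IH] f f0 /=; first by apply: f0 => -[].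
apply: Rintegral_ge0 => x /=; rewrite in_itv/= => xlu.
by apply: IH => t bt; apply: f0; exact: box_vcons.
Qed.

Lemma cube_integral_gt0 n (f : ('I_n -> R) -> R) t0 : l < u ->
  lipschitz_cube f -> (forall t, box t -> 0 <= f t) -> box t0 -> 0 < f t0 ->
  0 < C f.
Proof.
move=> lu'; elim: n f t0 => [|n IH] f t0 [K Kf] f0 bt0 ft0 /=.
  suff <- : t0 = fun=> 0 by [].
  by apply/funext => -[].
have bt1 : box (fun i => t0 (lift ord0 i)) by move=> i; exact: bt0.
have E : vcons (t0 ord0) (fun i => t0 (lift ord0 i)) = t0.
  by apply/funext => k; case: (unliftP ord0 k) => [k'|] ->; rewrite ?vcons_lift ?vcons0.
apply: (@Rintegral_gt0 _ _ _ lu (K * (u - l) ^+ n) _ (t0 ord0)) => //.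
- apply: lips_cube_integral; first by move=> x xlu; exists K; exact: lipbox_vconsl.
    by case: Kf.
  by move=> x y t xlu ylu bt; exact: (lipbox_vconsr Kf bt).2.
- by move=> x xlu; apply: cube_integral_ge0 => t bt; apply: f0; exact: box_vcons.
- apply: (IH _ (fun i => t0 (lift ord0 i))) => //; last by rewrite E.
    by exists K; exact: lipbox_vconsl.
  by move=> t bt; apply: f0; exact: box_vcons.
Qed.

End Cube.

(** * Lipschitz functions and partial derivatives on the cube *)

Section LipschitzCube.
Variables (R : realType) (l u : R) (n : nat).
Hypothesis lu : l <= u.
Local Notation lipc := (@lipschitz_cube R l u n).
Local Notation bx := (@box R l u n).
Implicit Types f g : ('I_n -> R) -> R.

Lemma lipschitz_cube_bounded f : lipc f ->
  exists2 M, 0 <= M & forall t, bx t -> `|f t| <= M.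
Proof.
move=> [K [K0 Kf]].
exists (K * \sum_(i < n) (u - l) + `|f (fun=> l)|).
  by rewrite addr_ge0// mulr_ge0// sumr_ge0// => i _; rewrite subr_ge0.
move=> t bt; rewrite -[f t](subrK (f (fun=> l))).
rewrite (le_trans (ler_normD _ _))// lerD2r.
apply: le_trans (Kf _ _ bt _) _; first by move=> i; rewrite lexx.
rewrite ler_wpM2l//; apply: ler_sum => i _.
by have /andP[? ?] := bt i; rewrite ger0_norm ?subr_ge0// lerD2r.
Qed.

Lemma lipschitz_cube_cst c : lipc (fun=> c).
Proof. by exists 0; split=> // s t _ _; rewrite subrr normr0 mul0r. Qed.

Lemma lipschitz_cube_coord i : lipc (fun t => t i).
Proof.
exists 1; split=> // s t _ _; rewrite mul1r (bigD1 i)//= lerDl.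
exact: sumr_ge0.
Qed.

Lemma lipschitz_cubeD f g : lipc f -> lipc g -> lipc (fun t => f t + g t).
Proof. by move=> [K Kf] [K' Kg]; exists (K + K'); exact: lipbox_add. Qed.

Lemma lipschitz_cubeZ c f : lipc f -> lipc (fun t => c * f t).
Proof. by move=> [K Kf]; exists (`|c| * K); exact: lipbox_scale. Qed.

Lemma lipschitz_cubeN f : lipc f -> lipc (fun t => - f t).
Proof.
by move=> /(lipschitz_cubeZ (-1)) h; under eq_fun do rewrite -mulN1r.
Qed.

Lemma lipschitz_cubeB f g : lipc f -> lipc g -> lipc (fun t => f t - g t).
Proof. by move=> lf lg; apply: lipschitz_cubeD => //; exact: lipschitz_cubeN. Qed.

Lemma lipschitz_cubeM f g : lipc f -> lipc g -> lipc (fun t => f t * g t).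
Proof.
move=> lf lg; have [M M0 fM] := lipschitz_cube_bounded lf.
have [M' M'0 gM'] := lipschitz_cube_bounded lg.
case: lf lg => [K [K0 Kf]] [K' [K0' Kg]].
exists (M * K' + M' * K); split=> [|s t bs bt]; first by rewrite addr_ge0// mulr_ge0.
have -> : f s * g s - f t * g t = f s * (g s - g t) + (f s - f t) * g t by ring.
rewrite (le_trans (ler_normD _ _))// [leRHS]mulrDl !normrM lerD//.
  by rewrite -mulrA ler_pM// ?fM// Kg.
by rewrite mulrC -mulrA ler_pM// ?gM'// Kf.
Qed.

Lemma lipschitz_cube_sum (I : Type) (r : seq I) (P : pred I) (F : I -> ('I_n -> R) -> R) :
  (forall i, P i -> lipc (F i)) -> lipc (fun t => \sum_(i <- r | P i) F i t).
Proof.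
move=> h; elim: r => [|i r IH].
  by under eq_fun do rewrite big_nil; exact: lipschitz_cube_cst.
case Pi : (P i); under eq_fun do rewrite big_cons Pi; last by [].
by apply: lipschitz_cubeD => //; exact: h.
Qed.

Lemma lipschitz_cube_prod (I : Type) (r : seq I) (P : pred I) (F : I -> ('I_n -> R) -> R) :
  (forall i, P i -> lipc (F i)) -> lipc (fun t => \prod_(i <- r | P i) F i t).
Proof.
move=> h; elim: r => [|i r IH].
  by under eq_fun do rewrite big_nil; exact: lipschitz_cube_cst.
case Pi : (P i); under eq_fun do rewrite big_cons Pi; last by [].
by apply: lipschitz_cubeM => //; exact: h.
Qed.

Lemma lipschitz_cubeX f k : lipc f -> lipc (fun t => f t ^+ k).
Proof.
move=> lf; elim: k => [|k IH]; first exact: lipschitz_cube_cst.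
by under eq_fun do rewrite exprS; exact: lipschitz_cubeM.
Qed.

Lemma lipschitz_cube_comp K (h : R -> R) f :
  0 <= K -> (forall x y, `|h x - h y| <= K * `|x - y|) -> lipc f ->
  lipc (fun t => h (f t)).
Proof.
move=> K0 Kh [K' [K0' Kf]]; exists (K * K'); split=> [|s t bs bt]; first exact: mulr_ge0.
by rewrite (le_trans (Kh _ _))// -mulrA ler_wpM2l// Kf.
Qed.

Lemma lipschitz_cube_polyfun (p : mpoly n R) : lipc (polyfun p).
Proof.
apply: lipschitz_cube_sum => m _; apply: lipschitz_cubeZ.
by apply: lipschitz_cube_prod => i _; apply: lipschitz_cubeX; exact: lipschitz_cube_coord.
Qed.

Lemma cube_integral_sum (I : Type) (s : seq I) (F : I -> ('I_n -> R) -> R) :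
  (forall i, lipc (F i)) ->
  cube_integral l u (fun t => \sum_(i <- s) F i t) =
  \sum_(i <- s) cube_integral l u (F i).
Proof.
move=> lF; elim: s => [|i s IH].
  by rewrite big_nil -[RHS](cube_integral0 lu n); congr cube_integral;
    apply/funext => t; rewrite big_nil.
under eq_fun do rewrite big_cons -[X in _ + X]mul1r.
rewrite cube_integral_linear//; last exact: lipschitz_cube_sum.
by rewrite IH big_cons mul1r.
Qed.

(** * Partial and logarithmic derivatives; integrals of partial derivatives *)

Definition pderiv (i : 'I_n) f f' := forall (t : 'I_n -> R) (x : R),
  is_derive x (1 : R) (fun y : R => f (upd t i y)) (f' (upd t i x)).

Lemma pderiv_eq i f f' g g' : pderiv i f f' -> f =1 g -> f' =1 g' -> pderiv i g g'.
Proof. by move=> h /funext <- /funext <-. Qed.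

Lemma pderiv_cst i c : pderiv i (fun=> c) (fun=> 0).
Proof. by move=> t x; exact: is_derive_cst. Qed.

Lemma pderiv_coord i j : pderiv i (fun t => t j) (fun=> (j == i)%:R).
Proof.
move=> t x; rewrite /upd; case: eqP => _; first exact: is_derive_id.
exact: is_derive_cst.
Qed.

Lemma pderivD i f f' g g' : pderiv i f f' -> pderiv i g g' ->
  pderiv i (fun t => f t + g t) (fun t => f' t + g' t).
Proof. by move=> hf hg t x; exact: is_deriveD. Qed.

Lemma pderivM i f f' g g' : pderiv i f f' -> pderiv i g g' ->
  pderiv i (fun t => f t * g t) (fun t => f t * g' t + f' t * g t).
Proof.
move=> hf hg t x; apply: (is_derive_eq (is_deriveM (hf t x) (hg t x))).
by rewrite /GRing.scale/= [X in _ + X]mulrC.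
Qed.

Lemma pderivZ i c f f' : pderiv i f f' ->
  pderiv i (fun t => c * f t) (fun t => c * f' t).
Proof. by move=> hf t x; exact: (is_deriveZ c (hf t x)). Qed.

Lemma pderivX i k f f' : pderiv i f f' ->
  pderiv i (fun t => f t ^+ k) (fun t => k%:R * f t ^+ k.-1 * f' t).
Proof.
move=> hf; elim: k => [|k IH].
  by apply: (pderiv_eq (pderiv_cst i 1)) => t //; rewrite !mul0r.
apply: (pderiv_eq (pderivM hf IH)) => t; first by rewrite exprS.
case: k {IH} => [|k]; first by rewrite !mul0r mulr0 add0r expr0 !mulr1 mul1r.
by rewrite /= -[k.+2%:R]natr1 exprS; ring.
Qed.

(** [L] stands for the quotient of the derivative by [f], stated without division, so zeros of [f]
    are harmless and products still turn into sums. *)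
Definition logderiv i f L := pderiv i f (fun t => f t * L t).

Lemma logderivX i k f L : logderiv i f L ->
  logderiv i (fun t => f t ^+ k) (fun t => k%:R * L t).
Proof.
move=> hf; apply: (pderiv_eq (pderivX k hf)) => t //.
case: k => [|k]; first by rewrite !mul0r mulr0.
by rewrite /= exprS; ring.
Qed.

Lemma logderiv_prod i (I : Type) (r : seq I) (P : pred I)
    (F L : I -> ('I_n -> R) -> R) :
  (forall j, P j -> logderiv i (F j) (L j)) ->
  logderiv i (fun t => \prod_(j <- r | P j) F j t)
    (fun t => \sum_(j <- r | P j) L j t).
Proof.
move=> h; elim: r => [|j r IH].
  by apply: (pderiv_eq (pderiv_cst i 1)) => t; rewrite ?big_nil ?mulr0.
case Pj : (P j); last first.
  by apply: (pderiv_eq IH) => t; rewrite !big_cons Pj.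
apply: (pderiv_eq (pderivM (h j Pj) IH)) => t; rewrite !big_cons Pj//.
by ring.
Qed.

Lemma pderiv_indep i f : (forall t x, f (upd t i x) = f t) -> pderiv i f (fun=> 0).
Proof.
move=> h t x; rewrite (_ : (fun y => _) = fun=> f t); first exact: is_derive_cst.
exact/funext.
Qed.

Lemma pderiv_polyfun i (p : mpoly n R) :
  pderiv i (polyfun p) (polyfun (mderiv i p)).
Proof.
rewrite /polyfun; elim/mpolyind: p => [|c m p _ _ IH].
  by apply: (pderiv_eq (pderiv_cst i 0)) => t; rewrite ?mderiv0 meval0.
have h : pderiv i (fun t : 'I_n -> R => \prod_(j < n | j != i) t j ^+ m j) (fun=> 0).
  apply: pderiv_indep => t x; apply: eq_bigr => j /negPf ji.
  by rewrite /upd ji.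
apply: (pderiv_eq (pderivD (pderivZ c
  (pderivM (pderivX (m i) (pderiv_coord i i)) h)) IH)) => t.
  by rewrite mevalD mevalZ mevalX [in RHS](bigD1 i).
rewrite mderivD mderivZ mderivX mevalD !mevalZ mevalX; congr (_ + _).
rewrite mulr0 add0r eqxx mulr1 [X in _ = _ * (_ * X)](bigD1 i)//= mulrA.
rewrite !mulrA; congr (_ * _); last first.
  apply: eq_bigr => j ji; rewrite mnmBE mnm1E eq_sym (negPf ji).
  by rewrite subn0.
by rewrite mnmBE mnm1E eqxx subn1.
Qed.

(** The fundamental theorem of calculus in the variable [t i] alone: the inner integral is a
    difference of two boundary values, both 0. *)
Lemma cube_integral_pderiv i f f' : l < u -> lipc f' -> pderiv i f f' ->
  (forall t, t i = l \/ t i = u -> f t = 0) -> cube_integral l u f' = 0.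
Proof.
move=> lu' lf' ff' f0; apply: (cube_integral_eq0 lu (i := i) lf') => t bt.
have bu x : l <= x <= u -> bx (upd t i x).
  by move=> xlu j; rewrite /upd; case: eqP.
have [K [K0 Kf']] := lf'.
have cont : ({within `[l, u], continuous (fun x => f' (upd t i x))})%classic.
  apply: (@lips_continuous _ _ _ K); split=> // x y xlu ylu.
  apply: le_trans (Kf' _ _ (bu _ xlu) (bu _ ylu)) _.
  rewrite ler_wpM2l// (bigD1 i)//= big1; last first.
    by move=> j /negPf ji; rewrite /upd ji subrr normr0.
  by rewrite /upd eqxx addr0.
have dF x : derivable (fun y => f (upd t i y)) x 1 by case: (ff' t x).
have := @continuous_FTC2 R (fun x => f' (upd t i x)) (fun y => f (upd t i y)) l u lu' cont.
have cF x : {for x, continuous (fun y => f (upd t i y))}.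
  by apply/differentiable_continuous/derivable1_diffP; exact: dF.
rewrite /Rintegral => -> //.
- by rewrite (f0 (upd t i u)) ?(f0 (upd t i l)) ?subee// /upd eqxx; [left|right].
- split; first by move=> x _; exact: dF.
    exact: cvg_at_right_filter (cF l).
  exact: cvg_at_left_filter (cF u).
- by move=> x _; rewrite derive1E; case: (ff' t x).
Qed.

End LipschitzCube.

(** * Integration by parts against the Jacobi weight *)

Section RegularizedWeight.
Variables (R : realType) (r a b N : nat).
Local Notation lipc := (@lipschitz_cube R (-1) 1 r).
Local Notation bx := (@box R (-1) 1 r).
Local Notation CI := (cube_integral (-1) 1).
Local Notation Xv i := (mpolyX R (mnm1 i)).
Implicit Types (t : 'I_r -> R) (dlt x : R) (i j k : 'I_r).

Let lu : -1 <= 1 :> R. Proof. by lra. Qed.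

(* For [a = 1] the weight is not differentiable on the diagonals; integration by
   parts is done with [sqrt (x ^ 2 + dlt ^ 2)] in place of [|x|], and [dlt -> 0]. *)
Definition reg_abs dlt x : R := Num.sqrt (x ^+ 2 + dlt ^+ 2).

(** The logarithmic derivative of [reg_abs dlt], a regularization of [1 / x]. *)
Definition reg_quot dlt x : R := x / (x ^+ 2 + dlt ^+ 2).

Definition reg_vandermonde dlt t : R :=
  \prod_(i < r) \prod_(j < r | (i < j)%N) reg_abs dlt (t i - t j) ^+ a.

Definition jacobi_weight t : R := \prod_(j < r) ((1 - t j) ^+ b * (1 + t j) ^+ N).

Lemma reg_abs0 x : reg_abs 0 x = `|x|.
Proof. by rewrite /reg_abs expr0n addr0 sqrtr_sqr. Qed.

Lemma reg_vandermonde0 t : reg_vandermonde 0 t = vandermonde_weight a t.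
Proof.
by apply: eq_bigr => i _; apply: eq_bigr => j _; rewrite reg_abs0.
Qed.

Lemma reg_abs_ge dlt x : 0 <= dlt -> dlt <= reg_abs dlt x.
Proof.
move=> d0; rewrite -[leLHS]ger0_norm// -sqrtr_sqr ler_wsqrtr//.
by rewrite lerDr sqr_ge0.
Qed.

Lemma reg_abs_ge_norm dlt x : `|x| <= reg_abs dlt x.
Proof. by rewrite -sqrtr_sqr ler_wsqrtr// lerDl sqr_ge0. Qed.

Lemma reg_abs_sqr dlt x : reg_abs dlt x ^+ 2 = x ^+ 2 + dlt ^+ 2.
Proof. by rewrite sqr_sqrtr// addr_ge0// sqr_ge0. Qed.

(** The difference of the squares does not involve [dlt], and [|x + y|] is at most the sum of the
    two regularized values. The case [dlt = 0] is used for the true weight. *)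
Lemma reg_abs_lipschitz dlt x y :
  `|reg_abs dlt x - reg_abs dlt y| <= 1 * `|x - y|.
Proof.
rewrite mul1r; have [->|xy] := eqVneq x y; first by rewrite !subrr.
have h : (reg_abs dlt x - reg_abs dlt y) * (reg_abs dlt x + reg_abs dlt y) =
   (x - y) * (x + y).
  by rewrite -!subr_sqr !reg_abs_sqr; ring.
have p : 0 < reg_abs dlt x + reg_abs dlt y.
  rewrite lt_def addr_ge0 ?sqrtr_ge0// andbT; apply/eqP => e.
  have h1 := reg_abs_ge_norm dlt x; have h2 := reg_abs_ge_norm dlt y.
  have n1 := normr_ge0 x; have n2 := normr_ge0 y.
  have /eqP : `|x| = 0 by lra.
  have /eqP : `|y| = 0 by lra.
  by rewrite !normr_eq0 => /eqP y0 /eqP x0; rewrite x0 y0 eqxx in xy.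
rewrite -(ler_pM2r p) -[in leLHS](ger0_norm (ltW p)) -normrM h normrM.
rewrite ler_wpM2l// (le_trans (ler_normD _ _))// lerD ?reg_abs_ge_norm//.
Qed.

Lemma reg_abs_dist dlt x : 0 <= dlt -> `|reg_abs dlt x - `|x| | <= dlt.
Proof.
move=> d0; rewrite ger0_norm ?subr_ge0 ?reg_abs_ge_norm// lerBlDr.
rewrite -[leRHS]ger0_norm ?addr_ge0// -sqrtr_sqr ler_wsqrtr//.
have h : 0 <= `|x| * dlt by rewrite mulr_ge0.
by rewrite sqrrD real_normK ?num_real//; lra.
Qed.

(** By itself [x * reg_quot dlt x] does not tend to 1 uniformly, as it is 0 at [x = 0]. One factor
    [reg_abs] repairs this: the product is [|x|^2 / s], and [|x| - |x|^2 / s = (|x| / s) (s - |x|)]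
    with [|x| / s <= 1]. *)
Lemma reg_absM_dist dlt x : 0 < dlt ->
  `|reg_abs dlt x * (x * reg_quot dlt x) - `|x| | <= dlt.
Proof.
move=> d0; set s := reg_abs dlt x.
have sd := reg_abs_ge x (ltW d0).
have s0 : 0 < s by exact: lt_le_trans sd.
have sx := reg_abs_ge_norm dlt x.
have -> : s * (x * reg_quot dlt x) = `|x| ^+ 2 / s.
  rewrite /reg_quot -reg_abs_sqr real_normK ?num_real// -/s.
  by field; rewrite gt_eqF.
have -> : `|x| ^+ 2 / s - `|x| = - (`|x| / s * (s - `|x|)).
  by field; rewrite gt_eqF.
rewrite normrN ger0_norm; last first.
  by rewrite mulr_ge0 ?subr_ge0// divr_ge0// ltW.
have h := reg_abs_dist x (ltW d0).
rewrite ger0_norm ?subr_ge0// -/s in h.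
apply: le_trans h; rewrite -[leRHS]mul1r ler_wpM2r ?subr_ge0//.
by rewrite ler_pdivrMr// mul1r.
Qed.

Lemma reg_sqr_gt0 dlt x : 0 < dlt -> 0 < x ^+ 2 + dlt ^+ 2.
Proof. by move=> d0; rewrite ltr_wpDl ?sqr_ge0// exprn_gt0. Qed.

Lemma lipschitz_reg_abs dlt i j : lipc (fun t => reg_abs dlt (t i - t j)).
Proof.
apply: (lipschitz_cube_comp (K := 1)) => //; first exact: reg_abs_lipschitz.
by apply: lipschitz_cubeB => //; exact: lipschitz_cube_coord.
Qed.

Lemma lipschitz_reg_quot dlt i j : 0 < dlt ->
  lipc (fun t => reg_quot dlt (t i - t j)).
Proof.
move=> d0.
have lx : lipc (fun t => t i - t j).
  by apply: lipschitz_cubeB => //; exact: lipschitz_cube_coord.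
have li : lipc (fun t => (reg_abs dlt (t i - t j))^-1).
  apply: (lipschitz_cube_comp (K := (dlt ^+ 2)^-1)
    (h := fun x => (reg_abs dlt x)^-1)) => // [|x y].
    by rewrite invr_ge0 sqr_ge0.
  set p := reg_abs dlt x; set q := reg_abs dlt y.
  have p0 : dlt <= p by apply: reg_abs_ge; exact: ltW.
  have q0 : dlt <= q by apply: reg_abs_ge; exact: ltW.
  have pp : 0 < p by exact: lt_le_trans p0.
  have qq : 0 < q by exact: lt_le_trans q0.
  have -> : p^-1 - q^-1 = (p * q)^-1 * (q - p) by field; rewrite !gt_eqF.
  rewrite normrM ler_pM//; last first.
    by rewrite distrC -[leRHS]mul1r; exact: reg_abs_lipschitz.
  have pq : 0 < p * q by rewrite mulr_gt0.
  rewrite normfV (gtr0_norm pq) lef_pV2 ?posrE ?exprn_gt0// expr2.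
  by apply: ler_pM => //; exact: ltW.
rewrite (_ : (fun t => _) = fun t => (t i - t j) *
  ((reg_abs dlt (t i - t j))^-1 * (reg_abs dlt (t i - t j))^-1)).
  by do 2 apply: lipschitz_cubeM => //.
by apply/funext => t; rewrite /reg_quot -reg_abs_sqr expr2 invfM.
Qed.

Lemma logderiv_reg_abs dlt i j k : 0 < dlt ->
  logderiv i (fun t => reg_abs dlt (t j - t k))
    (fun t => ((j == i)%:R - (k == i)%:R) * reg_quot dlt (t j - t k)).
Proof.
move=> d0 t x.
have h : pderiv i (fun t : 'I_r -> R => (t j - t k) ^+ 2 + dlt ^+ 2)
    (fun t => 2 * (t j - t k) * ((j == i)%:R - (k == i)%:R)).
  apply: (pderiv_eq (pderivD (pderivX 2 (pderivD (pderiv_coord i j)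
    (pderivZ (-1) (pderiv_coord i k)))) (pderiv_cst i (dlt ^+ 2)))) => t'.
    by rewrite mulN1r.
  by rewrite !mulN1r addr0 expr1.
have h1 := h t x.
have h2 := is_derive1_sqrt (reg_sqr_gt0 (upd t i x j - upd t i x k) d0).
have h3 : is_derive x (1 : R) (fun y => reg_abs dlt (upd t i y j - upd t i y k)) _ :=
  @is_derive1_comp R Num.sqrt (fun y => (upd t i y j - upd t i y k) ^+ 2 + dlt ^+ 2)
    x _ _ h2 h1.
apply: (is_derive_eq h3).
rewrite /GRing.scale/= /reg_quot -reg_abs_sqr.
set s := reg_abs _ _; have s0 : 0 < s.
  by rewrite (lt_le_trans d0)// reg_abs_ge// ltW.
by rewrite sqrtr_sqr (gtr0_norm s0); field; rewrite gt_eqF.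
Qed.

Definition reg_log dlt i t : R := \sum_(j < r) \sum_(k < r | (j < k)%N)
  a%:R * (((j == i)%:R - (k == i)%:R) * reg_quot dlt (t j - t k)).

Lemma logderiv_reg_vandermonde dlt i : 0 < dlt ->
  logderiv i (reg_vandermonde dlt) (reg_log dlt i).
Proof.
move=> d0; apply: logderiv_prod => j _; apply: logderiv_prod => k _.
by apply: logderivX; exact: logderiv_reg_abs.
Qed.

Lemma lipschitz_reg_vandermonde dlt : lipc (reg_vandermonde dlt).
Proof.
by do 2 (apply: lipschitz_cube_prod => // ? _); apply: lipschitz_cubeX => //;
  exact: lipschitz_reg_abs.
Qed.

Lemma lipschitz_reg_log dlt i : 0 < dlt -> lipc (reg_log dlt i).
Proof.
move=> d0; do 2 (apply: lipschitz_cube_sum => // ? _).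
by do 2 apply: lipschitz_cubeZ; exact: lipschitz_reg_quot.
Qed.

Lemma lipschitz_jacobi_weight : lipc jacobi_weight.
Proof.
apply: lipschitz_cube_prod => // j _; apply: lipschitz_cubeM => //;
  apply: lipschitz_cubeX => //; [apply: lipschitz_cubeB|apply: lipschitz_cubeD] => //;
  by [exact: lipschitz_cube_cst|exact: lipschitz_cube_coord].
Qed.

(** The derivative of [(1 - t_i)^(b+1) (1 + t_i)^(N+1)] divided by [(1 - t_i)^b (1 + t_i)^N]; the
    successors come from the extra factor [1 - t_i^2]. *)
Definition jacobi_drift i t : R := N.+1%:R * (1 - t i) - b.+1%:R * (1 + t i).

Lemma pderiv_jacobi_weight i :
  pderiv i (fun t => (1 - t i ^+ 2) * jacobi_weight t)
    (fun t => jacobi_drift i t * jacobi_weight t).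
Proof.
pose rest t : R := \prod_(j < r | j != i) ((1 - t j) ^+ b * (1 + t j) ^+ N).
have wE t : jacobi_weight t = (1 - t i) ^+ b * (1 + t i) ^+ N * rest t.
  by rewrite /jacobi_weight (bigD1 i).
have hrest : pderiv i rest (fun=> 0).
  apply: pderiv_indep => t x; apply: eq_bigr => j /negPf ji.
  by rewrite /upd ji.
have hm : pderiv i (fun t => 1 + (-1) * t i) (fun=> -1).
  apply: (pderiv_eq (pderivD (pderiv_cst i 1) (pderivZ (-1) (pderiv_coord i i)))) => // t.
  by rewrite eqxx add0r mulr1.
have hp : pderiv i (fun t => 1 + t i) (fun=> 1).
  apply: (pderiv_eq (pderivD (pderiv_cst i 1) (pderiv_coord i i))) => // t.
  by rewrite eqxx add0r.
apply: (pderiv_eq (pderivM (pderivM (pderivX b.+1 hm) (pderivX N.+1 hp)) hrest)) => t.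
  by rewrite wE mulN1r !exprS; ring.
by rewrite wE /jacobi_drift mulN1r /= !exprS; ring.
Qed.

Lemma jacobi_weight_boundary i t : t i = -1 \/ t i = 1 ->
  (1 - t i ^+ 2) * jacobi_weight t = 0.
Proof. by move=> [->|->]; rewrite ?sqrrN expr1n subrr mul0r. Qed.

(** * The regularized divergence identity and its limit *)

Section DirichletForm.
Variables (f g : mpoly r R) (H : 'I_r -> 'I_r -> mpoly r R).
Local Notation th i := ((1 - Xv i ^+ 2) * mderiv i f).
(* [H j k] is the divided difference that cancels the singularity of the
   logarithmic derivative of the Vandermonde factor on [t j = t k]. *)
Hypothesis HP : forall j k, (Xv j - Xv k) * H j k = th j - th k.

(** The sum of the one-variable Jacobi operators, without the interaction between variables. *)
Definition drift_op : mpoly r R := \sum_(i < r)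
  ((1 - Xv i ^+ 2) * mderiv i (mderiv i f)
   + (N.+1%:R *: (1 - Xv i) - b.+1%:R *: (1 + Xv i)) * mderiv i f).

Definition grad_form : mpoly r R := \sum_(i < r) th i * mderiv i g.

Lemma polyfun_drift i t :
  polyfun (N.+1%:R *: (1 - Xv i) - b.+1%:R *: (1 + Xv i)) t = jacobi_drift i t.
Proof.
by rewrite /polyfun mevalB !mevalZ mevalB mevalD meval1 mevalXU.
Qed.

Definition reg_integrand dlt t : R := jacobi_weight t *
  ((polyfun grad_form t + polyfun g t * polyfun drift_op t) * reg_vandermonde dlt t
  + polyfun g t * \sum_(j < r) \sum_(k < r | (j < k)%N) polyfun (H j k) t *
      (a%:R * ((t j - t k) * reg_quot dlt (t j - t k) * reg_vandermonde dlt t))).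

(** The right-hand side is the divergence of the field with components [V (1 - t_i^2) w (d_i f) g],
    [V] being the regularized Vandermonde factor and [w] the Jacobi weight. Its terms in [reg_log]
    are regrouped by pairs [j < k]; each pair contributes [reg_quot] times a difference of two [th],
    which [HP] turns into [(t_j - t_k) H j k]. *)
Lemma reg_integrandE dlt t : 0 < dlt ->
  reg_integrand dlt t = \sum_(i < r)
   (reg_vandermonde dlt t *
     (polyfun (mderiv i f * g) t * (jacobi_drift i t * jacobi_weight t)
      + polyfun (mderiv i (mderiv i f * g)) t * ((1 - t i ^+ 2) * jacobi_weight t))
   + reg_vandermonde dlt t * reg_log dlt i t *
      (polyfun (mderiv i f * g) t * ((1 - t i ^+ 2) * jacobi_weight t))).
Proof.
move=> d0; rewrite big_split/= /reg_integrand.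
have thE i : polyfun (th i) t = (1 - t i ^+ 2) * polyfun (mderiv i f) t.
  by rewrite /polyfun mevalM mevalB meval1 expr2 mevalM mevalXU -expr2.
have thB j k : polyfun (th j) t - polyfun (th k) t = (t j - t k) * polyfun (H j k) t.
  by rewrite /polyfun -mevalB -HP mevalM mevalB !mevalXU.
have gen (V J G c : R) (q d Hv : 'I_r -> 'I_r -> R) :
    (\sum_(j < r) \sum_(k < r | (j < k)%N) c * (q j k * (d j k * Hv j k))) * (V * J * G) =
    J * (G * \sum_(j < r) \sum_(k < r | (j < k)%N) Hv j k * (c * (d j k * q j k * V))).
  rewrite !mulr_suml !mulr_sumr; apply: eq_bigr => j _.
  by rewrite !mulr_suml !mulr_sumr; apply: eq_bigr => k _; ring.
have e1 : \sum_(i < r) reg_vandermonde dlt t * reg_log dlt i t *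
      (polyfun (mderiv i f * g) t * ((1 - t i ^+ 2) * jacobi_weight t)) =
  jacobi_weight t * (polyfun g t * \sum_(j < r) \sum_(k < r | (j < k)%N) polyfun (H j k) t *
      (a%:R * ((t j - t k) * reg_quot dlt (t j - t k) * reg_vandermonde dlt t))).
  transitivity (\sum_(i < r) reg_log dlt i t * polyfun (th i) t *
    (reg_vandermonde dlt t * jacobi_weight t * polyfun g t)).
    by apply: eq_bigr => i _; rewrite thE {1}/polyfun mevalM -!/(polyfun _ _); ring.
  rewrite -mulr_suml.
  have -> : \sum_(i < r) reg_log dlt i t * polyfun (th i) t =
    \sum_(j < r) \sum_(k < r | (j < k)%N) a%:R *
      (reg_quot dlt (t j - t k) * (polyfun (th j) t - polyfun (th k) t)).
    transitivity (\sum_(i < r) \sum_(j < r) \sum_(k < r | (j < k)%N)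
      a%:R * (((j == i)%:R - (k == i)%:R) * reg_quot dlt (t j - t k)) * polyfun (th i) t).
      by apply: eq_bigr => i _; rewrite mulr_suml; apply: eq_bigr => j _; rewrite mulr_suml.
    rewrite exchange_big; apply: eq_bigr => j _; rewrite exchange_big; apply: eq_bigr => k _.
    have dl (p : 'I_r) (F : 'I_r -> R) : \sum_(i < r) (p == i)%:R * F i = F p.
      rewrite (bigD1 p)//= eqxx mul1r big1 ?addr0// => i ip.
      by rewrite eq_sym (negPf ip) mul0r.
    rewrite -(dl j (fun i => polyfun (th i) t)) -(dl k (fun i => polyfun (th i) t)).
    rewrite -sumrB !mulr_sumr; apply: eq_bigr => i _; ring.
  under eq_bigr do under eq_bigr do rewrite thB.
  exact: gen.
rewrite e1 mulrDr; congr (_ + _).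
rewrite [polyfun grad_form t]/polyfun [polyfun drift_op t]/polyfun.
rewrite !raddf_sum/= mulr_sumr -big_split/= mulr_suml mulr_sumr.
apply: eq_bigr => i _; rewrite mevalM -[meval t (th i)]/(polyfun (th i) t) thE.
rewrite mevalD !mevalM -![meval t _]/(polyfun _ t) polyfun_drift.
rewrite mderivM /polyfun !(mevalD, mevalM) meval1 mevalN rmorphXn /= mevalXU.
by ring.
Qed.

Lemma lipschitz_reg_integrand dlt : 0 < dlt -> lipc (reg_integrand dlt).
Proof.
move=> d0; apply: lipschitz_cubeM => //; first exact: lipschitz_jacobi_weight.
have lp (p : mpoly r R) : lipc (polyfun p) by exact: lipschitz_cube_polyfun.
have lv := lipschitz_reg_vandermonde dlt.
apply: lipschitz_cubeD => //.
  by do ?[apply: lipschitz_cubeM => //|apply: lipschitz_cubeD => //].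
apply: lipschitz_cubeM => //; do 2 (apply: lipschitz_cube_sum => // ? _).
apply: lipschitz_cubeM => //; apply: lipschitz_cubeZ.
apply: lipschitz_cubeM => //; apply: lipschitz_cubeM => //; last exact: lipschitz_reg_quot.
by apply: lipschitz_cubeB => //; exact: lipschitz_cube_coord.
Qed.

(** No boundary term survives for any exponents, 0 included, because the factor [1 - t_i^2] vanishes
    on the faces [t_i = -1] and [t_i = 1]. *)
Lemma cube_integral_reg_integrand dlt : 0 < dlt -> CI (reg_integrand dlt) = 0.
Proof.
move=> d0.
have lp (p : mpoly r R) : lipc (polyfun p) by exact: lipschitz_cube_polyfun.
have lj := lipschitz_jacobi_weight.
have lv := lipschitz_reg_vandermonde dlt.
have ld i : lipc (jacobi_drift i).
  by apply: lipschitz_cubeB => //; apply: lipschitz_cubeZ;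
    [apply: lipschitz_cubeB|apply: lipschitz_cubeD] => //;
    by [exact: lipschitz_cube_cst|exact: lipschitz_cube_coord].
have lt1 i : lipc (fun t => 1 - t i ^+ 2).
  apply: lipschitz_cubeB => //; first exact: lipschitz_cube_cst.
  by apply: lipschitz_cubeX => //; exact: lipschitz_cube_coord.
have ll i := lipschitz_reg_log i d0.
pose Ft i t := reg_vandermonde dlt t *
     (polyfun (mderiv i f * g) t * (jacobi_drift i t * jacobi_weight t)
      + polyfun (mderiv i (mderiv i f * g)) t * ((1 - t i ^+ 2) * jacobi_weight t))
   + reg_vandermonde dlt t * reg_log dlt i t *
      (polyfun (mderiv i f * g) t * ((1 - t i ^+ 2) * jacobi_weight t)).
have termP i : lipc (Ft i).
  by do ?[exact: lp|exact: lv|exact: ll|exact: lt1|exact: lj|exact: ld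
    |apply: lipschitz_cubeD => //|apply: lipschitz_cubeM => //].
rewrite (_ : reg_integrand dlt = fun t => \sum_(i < r) Ft i t); last first.
  by apply/funext => t; exact: reg_integrandE.
suff F0 i : CI (Ft i) = 0 by rewrite cube_integral_sum// big1.
apply: (@cube_integral_pderiv _ _ _ _ lu i (fun t => reg_vandermonde dlt t *
  (polyfun (mderiv i f * g) t * ((1 - t i ^+ 2) * jacobi_weight t)))) => //.
- exact: (pderivM (logderiv_reg_vandermonde i d0)
    (pderivM (pderiv_polyfun i _) (pderiv_jacobi_weight i))).
- by move=> t /jacobi_weight_boundary ->; rewrite !mulr0.
Qed.

(* Uniform [O(dlt)] approximation, with a bounded limit. *)
Definition dlt_close (F : R -> ('I_r -> R) -> R) (F0 : ('I_r -> R) -> R) :=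
  (exists2 M, 0 <= M & forall t, bx t -> `|F0 t| <= M) /\
  exists2 K, 0 <= K & forall dlt t, 0 < dlt -> dlt <= 1 -> bx t ->
    `|F dlt t - F0 t| <= K * dlt.

Lemma dlt_close_cst F0 : lipc F0 -> dlt_close (fun=> F0) F0.
Proof.
move=> /(lipschitz_cube_bounded lu) h; split=> //; exists 0 => // dlt t _ _ _.
by rewrite subrr normr0 mul0r.
Qed.

Lemma dlt_closeD F F0 G G0 : dlt_close F F0 -> dlt_close G G0 ->
  dlt_close (fun dlt t => F dlt t + G dlt t) (fun t => F0 t + G0 t).
Proof.
move=> [[M M0 hM] [K K0 hK]] [[M' M0' hM'] [K' K0' hK']]; split.
  exists (M + M'); first exact: addr_ge0.
  by move=> t bt; rewrite (le_trans (ler_normD _ _))// lerD ?hM ?hM'.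
exists (K + K'); first exact: addr_ge0.
move=> dlt t d0 d1 bt; rewrite opprD addrACA mulrDl.
by rewrite (le_trans (ler_normD _ _))// lerD ?hK ?hK'.
Qed.

Lemma dlt_closeM F F0 G G0 : dlt_close F F0 -> dlt_close G G0 ->
  dlt_close (fun dlt t => F dlt t * G dlt t) (fun t => F0 t * G0 t).
Proof.
move=> [[M M0 hM] [K K0 hK]] [[M' M0' hM'] [K' K0' hK']]; split.
  exists (M * M'); first exact: mulr_ge0.
  by move=> t bt; rewrite normrM ler_pM ?hM ?hM'.
(* As [dlt <= 1], the approximant [F dlt] is bounded by [M + K]. *)
exists ((M + K) * K' + K * M').
  by rewrite addr_ge0 ?mulr_ge0// addr_ge0.
move=> dlt t d0 d1 bt.
have -> : F dlt t * G dlt t - F0 t * G0 t =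
  (F0 t + (F dlt t - F0 t)) * (G dlt t - G0 t) + (F dlt t - F0 t) * G0 t by ring.
rewrite [leRHS]mulrDl (le_trans (ler_normD _ _))// normrM lerD//.
  rewrite -mulrA ler_pM ?hK'// (le_trans (ler_normD _ _))// lerD ?hM//.
  by rewrite (le_trans (hK _ _ d0 d1 bt))// ler_piMr.
by rewrite normrM mulrAC ler_pM ?hK ?hM'.
Qed.

Lemma dlt_close_sum (I : Type) (s : seq I) (P : pred I)
    (F : I -> R -> ('I_r -> R) -> R) (F0 : I -> ('I_r -> R) -> R) :
  (forall p, P p -> dlt_close (F p) (F0 p)) ->
  dlt_close (fun dlt t => \sum_(p <- s | P p) F p dlt t)
            (fun t => \sum_(p <- s | P p) F0 p t).
Proof.
move=> h; elim: s => [|i s IH].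
  have := dlt_close_cst (lipschitz_cube_cst (-1) 1 r 0).
  by congr dlt_close; [apply/funext => dlt|]; apply/funext => t; rewrite big_nil.
case Pi : (P i); [have := dlt_closeD (h i Pi) IH|move: IH];
  by congr dlt_close; [apply/funext => dlt|]; apply/funext => t; rewrite big_cons Pi.
Qed.

Lemma dlt_close_prod (I : Type) (s : seq I) (P : pred I)
    (F : I -> R -> ('I_r -> R) -> R) (F0 : I -> ('I_r -> R) -> R) :
  (forall p, P p -> dlt_close (F p) (F0 p)) ->
  dlt_close (fun dlt t => \prod_(p <- s | P p) F p dlt t)
            (fun t => \prod_(p <- s | P p) F0 p t).
Proof.
move=> h; elim: s => [|i s IH].
  have := dlt_close_cst (lipschitz_cube_cst (-1) 1 r 1).
  by congr dlt_close; [apply/funext => dlt|]; apply/funext => t; rewrite big_nil.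
case Pi : (P i); [have := dlt_closeM (h i Pi) IH|move: IH];
  by congr dlt_close; [apply/funext => dlt|]; apply/funext => t; rewrite big_cons Pi.
Qed.

Lemma dlt_closeX n F F0 : dlt_close F F0 ->
  dlt_close (fun dlt t => F dlt t ^+ n) (fun t => F0 t ^+ n).
Proof.
move=> h; have := @dlt_close_prod _ (iota 0 n) xpredT (fun=> F) (fun=> F0) (fun _ _ => h).
by congr dlt_close; [apply/funext => dlt|]; apply/funext => t;
  rewrite big_const_seq count_predT size_iota -Monoid.iteropE.
Qed.



Lemma dlt_close_reg_abs j k :
  dlt_close (fun dlt t => reg_abs dlt (t j - t k)) (fun t => `|t j - t k|).
Proof.
split.
  have [M M0 hM] := lipschitz_cube_bounded lu (lipschitz_reg_abs 0 j k).
  by exists M => // t bt; rewrite -(reg_abs0 (t j - t k)) hM.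
by exists 1 => // dlt t d0 d1 bt; rewrite mul1r reg_abs_dist// ltW.
Qed.

Lemma dlt_close_reg_quot j k :
  dlt_close (fun dlt t => reg_abs dlt (t j - t k) *
      ((t j - t k) * reg_quot dlt (t j - t k))) (fun t => `|t j - t k|).
Proof.
split; first exact: (dlt_close_reg_abs j k).1.
by exists 1 => // dlt t d0 d1 bt; rewrite mul1r reg_absM_dist.
Qed.

Lemma dlt_close_reg_vandermonde :
  dlt_close reg_vandermonde (vandermonde_weight a).
Proof.
apply: dlt_close_prod => j _; apply: dlt_close_prod => k _.
exact: (dlt_closeX a (dlt_close_reg_abs j k)).
Qed.

(** For [a = 0] the coefficient kills the term. For [a > 0] one of the [a] factors [reg_abs] of the
    pair [(j, k)] is spent on [dlt_close_reg_quot]. *)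
Lemma dlt_close_reg_quot_vandermonde j k : (j < k)%N ->
  dlt_close (fun dlt t => a%:R * ((t j - t k) * reg_quot dlt (t j - t k) *
      reg_vandermonde dlt t)) (fun t => a%:R * vandermonde_weight a t).
Proof.
move=> jk.
have [a0|[a' a'E]] : a = 0%N \/ exists a', a = a'.+1.
  by case: (a) => [|a']; [left|right; exists a'].
  have := dlt_close_cst (lipschitz_cube_cst (-1) 1 r 0).
  by congr dlt_close; [apply/funext => dlt|]; apply/funext => t; rewrite a0 mul0r.
pose rest dlt t := \prod_(p : 'I_r * 'I_r | (p.1 < p.2)%N && (p != (j, k)))
  reg_abs dlt (t p.1 - t p.2) ^+ a.
pose rest0 t := \prod_(p : 'I_r * 'I_r | (p.1 < p.2)%N && (p != (j, k)))
  `|t p.1 - t p.2| ^+ a.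
have hrest : dlt_close rest rest0.
  by apply: dlt_close_prod => p _; exact: (dlt_closeX a (dlt_close_reg_abs p.1 p.2)).
have vE dlt t : reg_vandermonde dlt t = reg_abs dlt (t j - t k) ^+ a * rest dlt t.
  rewrite /reg_vandermonde pair_big_dep/= (bigD1 (j, k))//=.
have v0E t : vandermonde_weight a t = `|t j - t k| ^+ a * rest0 t.
  rewrite /vandermonde_weight pair_big_dep/= (bigD1 (j, k))//=.
have pw x : x ^+ a = x ^+ a' * x by rewrite a'E exprSr.
have := dlt_closeM (dlt_close_cst (lipschitz_cube_cst (-1) 1 r a%:R))
  (dlt_closeM (dlt_close_reg_quot j k)
    (dlt_closeM (dlt_closeX a' (dlt_close_reg_abs j k)) hrest)).
congr dlt_close; [apply/funext => dlt|]; apply/funext => t.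
  by rewrite vE pw; ring.
by rewrite v0E pw; ring.
Qed.

Definition limit_integrand t : R := jacobi_weight t *
  ((polyfun grad_form t + polyfun g t * polyfun drift_op t) * vandermonde_weight a t
  + polyfun g t * \sum_(j < r) \sum_(k < r | (j < k)%N) polyfun (H j k) t *
      (a%:R * vandermonde_weight a t)).

Lemma dlt_close_reg_integrand : dlt_close reg_integrand limit_integrand.
Proof.
have lp (p : mpoly r R) : dlt_close (fun=> polyfun p) (polyfun p).
  by apply: dlt_close_cst; exact: lipschitz_cube_polyfun.
apply: dlt_closeM; first exact: dlt_close_cst lipschitz_jacobi_weight.
apply: dlt_closeD.
  apply: dlt_closeM dlt_close_reg_vandermonde.
  by apply: dlt_closeD => //; exact: dlt_closeM.
apply: dlt_closeM => //; apply: dlt_close_sum => j _; apply: dlt_close_sum => k jk.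
by apply: dlt_closeM => //; exact: dlt_close_reg_quot_vandermonde.
Qed.

Lemma lipschitz_vandermonde_weight : lipc (vandermonde_weight a).
Proof.
have := lipschitz_reg_vandermonde 0.
by congr lipschitz_cube; apply/funext => t; rewrite reg_vandermonde0.
Qed.

(** The regularized integrals vanish and approximate this one within [M * dlt], for every [dlt] in
    ]0, 1]. *)
Lemma cube_integral_limit_integrand : CI limit_integrand = 0.
Proof.
have lp (p : mpoly r R) : lipc (polyfun p) by exact: lipschitz_cube_polyfun.
have lV := lipschitz_vandermonde_weight.
have lX : lipc limit_integrand.
  apply: lipschitz_cubeM => //; first exact: lipschitz_jacobi_weight.
  apply: lipschitz_cubeD => //.
    by do ?[apply: lipschitz_cubeM => //|apply: lipschitz_cubeD => //].
  apply: lipschitz_cubeM => //; do 2 (apply: lipschitz_cube_sum => // ? _).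
  by apply: lipschitz_cubeM => //; exact: lipschitz_cubeZ.
have [_ [K K0 hK]] := dlt_close_reg_integrand.
pose M := K * (1 - -1) ^+ r.
have M0 : 0 <= M by rewrite mulr_ge0// exprn_ge0// subr_ge0.
have hd dlt : 0 < dlt -> dlt <= 1 -> `|CI limit_integrand| <= M * dlt.
  move=> d0 d1; have lXd := lipschitz_reg_integrand d0.
  have := cube_integral_linear lu (-1) lXd lX.
  rewrite cube_integral_reg_integrand// add0r mulN1r => /(congr1 Num.norm).
  rewrite normrN => <-; rewrite mulrAC; apply: cube_integral_le => // [|t bt].
    by apply: lipschitz_cubeD => //; exact: lipschitz_cubeZ.
  by rewrite mulN1r hK.
apply/eqP; rewrite -normr_le0; apply/ler_addgt0Pr => e e0; rewrite add0r.
have M1 : 0 < M + 1 by rewrite ltr_wpDl.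
have := hd (Num.min 1 (e / (M + 1))).
rewrite lt_min ltr01 divr_gt0// ge_min lexx => /(_ isT isT) /le_trans; apply.
apply: (@le_trans _ _ ((M + 1) * (e / (M + 1)))).
  by rewrite ler_pM ?lerDl// ?ge_min ?lexx ?orbT// le_min ler01 ltW// divr_gt0.
by rewrite mulrC divfK// gt_eqF.
Qed.

End DirichletForm.

(** * The Jacobi integral of polynomials and its integration by parts formula *)

Definition jacobi_integral (p : mpoly r R) : R :=
  CI (fun t => polyfun p t * (jacobi_weight t * vandermonde_weight a t)).

Lemma jacobi_innerE (p q : mpoly r R) :
  jacobi_inner b N a (polyfun p) (polyfun q) = jacobi_integral (p * q).
Proof. by congr cube_integral; apply/funext => t; rewrite /polyfun mevalM. Qed.

Lemma lipschitz_jacobi_integrand (p : mpoly r R) :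
  lipc (fun t => polyfun p t * (jacobi_weight t * vandermonde_weight a t)).
Proof.
apply: lipschitz_cubeM => //; first exact: lipschitz_cube_polyfun.
apply: lipschitz_cubeM => //; first exact: lipschitz_jacobi_weight.
exact: lipschitz_vandermonde_weight.
Qed.

Lemma jacobi_integral_linear c (p q : mpoly r R) :
  jacobi_integral (p + c *: q) = jacobi_integral p + c * jacobi_integral q.
Proof.
rewrite -cube_integral_linear//; [|exact: lipschitz_jacobi_integrand..].
by congr cube_integral; apply/funext => t; rewrite /polyfun mevalD mevalZ; ring.
Qed.

(** The operator on the right is the second-order Heckman-Opdam operator; its interaction terms [((1
    - t_j^2) d_j f - (1 - t_k^2) d_k f) / (t_j - t_k)] are given as polynomials [H j k]. *)
Lemma jacobi_dirichlet_form (f g : mpoly r R) (H : 'I_r -> 'I_r -> mpoly r R) :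
  (forall j k, (Xv j - Xv k) * H j k =
     (1 - Xv j ^+ 2) * mderiv j f - (1 - Xv k ^+ 2) * mderiv k f) ->
  jacobi_integral (\sum_(i < r) (1 - Xv i ^+ 2) * mderiv i f * mderiv i g) =
  - jacobi_integral (g * (drift_op f + a%:R *: \sum_(j < r) \sum_(k < r | (j < k)%N) H j k)).
Proof.
move=> HP; apply/eqP; rewrite -addr_eq0 -[X in _ + X]mul1r -jacobi_integral_linear.
apply/eqP; rewrite -[RHS](cube_integral_limit_integrand g HP); congr cube_integral.
apply/funext => t; rewrite /limit_integrand scale1r /polyfun mevalD mevalM mevalD mevalZ.
have -> : meval t (\sum_(j < r) \sum_(k < r | (j < k)%N) H j k) =
  \sum_(j < r) \sum_(k < r | (j < k)%N) meval t (H j k).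
  by rewrite raddf_sum; apply: eq_bigr => j _; rewrite raddf_sum.
have -> : \sum_(j < r) \sum_(k < r | (j < k)%N) meval t (H j k) *
    (a%:R * vandermonde_weight a t) =
  (\sum_(j < r) \sum_(k < r | (j < k)%N) meval t (H j k)) *
    (a%:R * vandermonde_weight a t).
  by rewrite mulr_suml; apply: eq_bigr => j _; rewrite mulr_suml.
by rewrite /grad_form; ring.
Qed.

End RegularizedWeight.

(** * The second-order operator on symmetrized monomials *)

Section Symmetrization.
Variables (R : realType) (r : nat).
Local Notation mp := (mpoly r R).
Local Notation Xv i := (mpolyX R (mnm1 i)).
Local Notation Sym := (@symmetrization R r).
Implicit Types (p q : mp) (k n : multinom r) (i j l : 'I_r) (s : 'S_r) (c : R).

Definition mperm n s : multinom r := Multinom (mktuple (fun i => n (s i))).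

Lemma mpermE n s i : mperm n s i = n (s i).
Proof. exact: mnmE. Qed.

Definition msymm n : mp := Sym (mpolyX R n).

Let fact0 : (r`!%:R : R) != 0.
Proof. by rewrite pnatr_eq0 -lt0n fact_gt0. Qed.

Lemma symmetrization_linear c p q : Sym (p + c *: q) = Sym p + c *: Sym q.
Proof.
rewrite /symmetrization scalerA mulrC -scalerA -scalerDr.
rewrite [X in _ = _ *: (_ + X)]scaler_sumr -big_split.
by congr (_ *: _); apply: eq_bigr => s _; rewrite msymD msymZ.
Qed.

Lemma symmetrization0 : Sym 0 = 0.
Proof. by rewrite /symmetrization big1 ?scaler0// => s _; rewrite msym0. Qed.

Lemma symmetrizationD p q : Sym (p + q) = Sym p + Sym q.
Proof. by have := symmetrization_linear 1 p q; rewrite !scale1r. Qed.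

Lemma symmetrizationZ c p : Sym (c *: p) = c *: Sym p.
Proof. by have := symmetrization_linear c 0 p; rewrite symmetrization0 !add0r. Qed.

Lemma symmetrization_sum (I : Type) (t : seq I) (P : pred I) (F : I -> mp) :
  Sym (\sum_(x <- t | P x) F x) = \sum_(x <- t | P x) Sym (F x).
Proof. exact: (big_morph _ symmetrizationD symmetrization0). Qed.

Lemma symmetrization_msym p s : Sym (msym s p) = Sym p.
Proof.
rewrite /symmetrization; congr (_ *: _).
rewrite [RHS](reindex_inj (mulgI s)); apply: eq_bigr => s' _.
by rewrite msymMm.
Qed.

Lemma msym_symmetrization p s : msym s (Sym p) = Sym p.
Proof.
rewrite /symmetrization msymZ; congr (_ *: _); rewrite raddf_sum.
rewrite [RHS](reindex_inj (mulIg s)); apply: eq_bigr => s' _.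
by rewrite msymMm.
Qed.

Lemma symmetrization_symmetric p : Sym p \is @symmetric r R.
Proof. by apply/issymP => s; rewrite msym_symmetrization. Qed.

Lemma symmetrization_id p : p \is @symmetric r R -> Sym p = p.
Proof.
move=> /issymP sp; rewrite /symmetrization.
under eq_bigr do rewrite sp.
rewrite sumr_const card_Sn -[p *+ _]scaler_nat scalerA mulVf ?scale1r//.
Qed.

Lemma symmetrizationE p : Sym p = \sum_(n <- msupp p) mcoeff n p *: msymm n.
Proof.
rewrite {1}[p]mpolyE symmetrization_sum; apply: eq_bigr => n _.
exact: symmetrizationZ.
Qed.

Lemma msym_mpolyX s n : msym s (mpolyX R n) = mpolyX R (mperm n s^-1%g).
Proof. exact: msymX. Qed.

Lemma msymm_mperm n s : msymm (mperm n s) = msymm n.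
Proof. by rewrite /msymm -[in RHS](symmetrization_msym _ s^-1%g) msym_mpolyX invgK. Qed.

Lemma msym_Xv s i : msym s (Xv i) = Xv (s i).
Proof.
rewrite msym_mpolyX; congr mpolyX; apply/mnmP => j.
by rewrite mpermE !mnm1E -(inj_eq (@perm_inj _ s)) permKV.
Qed.

Lemma msym_mderiv s i p : msym s (mderiv i p) = mderiv (s i) (msym s p).
Proof.
elim/mpolyind: p => [|c n p _ _ IH]; first by rewrite mderiv0 msym0 mderiv0.
rewrite mderivD msymD IH msymD mderivD; congr (_ + _).
rewrite msymZ !mderivZ msymZ; congr (_ *: _).
rewrite mderivX msymZ !msym_mpolyX mderivX mpermE permK; congr (_ *: mpolyX _ _).
apply/mnmP => j; rewrite mpermE !mnmBE mpermE !mnm1E.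
by rewrite -(inj_eq (@perm_inj _ s)) permKV.
Qed.

(* A permutation-invariant code of the lexicographic order: on signatures,
   a lexicographically smaller one has a smaller weight ([lex_weight_lex]). *)
Definition lex_weight n : nat := (\sum_(i < r) r.+2 ^ n i)%N.

Lemma lex_weight_mperm n s : lex_weight (mperm n s) = lex_weight n.
Proof.
rewrite /lex_weight [RHS](reindex_inj (@perm_inj _ s)).
by apply: eq_bigr => i _; rewrite mpermE.
Qed.

Lemma mdeg_permuted n s : mdeg (mperm n s) = mdeg n.
Proof. exact: mdeg_mperm. Qed.

Definition low (w d : nat) p :=
  forall n, n \in msupp p -> (lex_weight n < w)%N /\ (mdeg n <= d)%N.

Lemma low0 w d : low w d 0.
Proof. by move=> n; rewrite msupp0. Qed.

Lemma lowD w d p q : low w d p -> low w d q -> low w d (p + q).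
Proof.
by move=> lp lq n /msuppD_le; rewrite mem_cat => /orP[/lp|/lq].
Qed.

Lemma lowZ w d c p : low w d p -> low w d (c *: p).
Proof. by move=> lp n /msuppZ_le /lp. Qed.

Lemma low_sum w d (I : Type) (t : seq I) (P : pred I) (F : I -> mp) :
  (forall x, P x -> low w d (F x)) -> low w d (\sum_(x <- t | P x) F x).
Proof.
move=> h; elim/big_rec: _ => [|x p Px lp]; first exact: low0.
by apply: lowD => //; exact: h.
Qed.

Lemma low_msymm w d n : (lex_weight n < w)%N -> (mdeg n <= d)%N -> low w d (msymm n).
Proof.
move=> nc nd; apply: lowZ; apply: low_sum => s _ k.
rewrite msym_mpolyX msuppX inE => /eqP ->.
by rewrite lex_weight_mperm mdeg_permuted.
Qed.

(* Modulo lower terms, the symmetrization of [p] is [c] times that of [X^k]. *)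
Definition triang k c p := low (lex_weight k) (mdeg k) (Sym p - c *: msymm k).

Lemma triang0 k : triang k 0 0.
Proof. by rewrite /triang symmetrization0 scale0r subr0; exact: low0. Qed.

Lemma triangD k c c' p q : triang k c p -> triang k c' q -> triang k (c + c') (p + q).
Proof.
move=> hp hq; rewrite /triang symmetrizationD scalerDl opprD addrACA.
exact: lowD.
Qed.

Lemma triangZ k x c p : triang k c p -> triang k (x * c) (x *: p).
Proof.
move=> hp; rewrite /triang symmetrizationZ -scalerA -scalerBr.
exact: lowZ.
Qed.

Lemma triang_sum k (I : Type) (t : seq I) (P : pred I) (c : I -> R) (F : I -> mp) :
  (forall x, P x -> triang k (c x) (F x)) ->
  triang k (\sum_(x <- t | P x) c x) (\sum_(x <- t | P x) F x).
Proof.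
move=> h; elim/big_rec2: _ => [|x p y Px lp]; first exact: triang0.
by apply: triangD => //; exact: h.
Qed.

Lemma triang_low k n : (lex_weight n < lex_weight k)%N -> (mdeg n <= mdeg k)%N ->
  triang k 0 (mpolyX R n).
Proof. by move=> ? ?; rewrite /triang scale0r subr0; exact: low_msymm. Qed.

Lemma triang_perm k s : triang k 1 (mpolyX R (mperm k s)).
Proof. by rewrite /triang scale1r -/(msymm _) msymm_mperm subrr; exact: low0. Qed.

Lemma triang_id k : triang k 1 (mpolyX R k).
Proof. by rewrite /triang scale1r subrr; exact: low0. Qed.

Lemma triang_mperm k s c p : triang (mperm k s) c p -> triang k c p.
Proof. by rewrite /triang lex_weight_mperm mdeg_permuted msymm_mperm. Qed.

(** * Changing two exponents of a monomial; divided differences *)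

Definition upd2 n j l (u v : nat) : multinom r :=
  Multinom (mktuple (fun i => if i == j then u else if i == l then v else n i)).

Lemma upd2E n j l u v i : upd2 n j l u v i =
  if i == j then u else if i == l then v else n i.
Proof. exact: mnmE. Qed.

Lemma upd2_id n j l : upd2 n j l (n j) (n l) = n.
Proof. by apply/mnmP => i; rewrite upd2E; do 2 (case: eqP => [->//|_]). Qed.

Lemma upd2_swap n j l : upd2 n j l (n l) (n j) = mperm n (tperm j l).
Proof.
apply/mnmP => i; rewrite upd2E mpermE; case: tpermP => [->|->|/eqP/negPf -> /eqP/negPf ->//].
  by rewrite eqxx.
by rewrite eqxx; case: eqP => [->|].
Qed.

(** Stated without subtraction of naturals. It is used with [F] the identity for the degree, and
    with [F] a power function for [lex_weight]. *)
Lemma upd2_sum n j l u v (F : nat -> nat) : j != l ->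
  (\sum_(i < r) F (upd2 n j l u v i) + F (n j) + F (n l) =
   \sum_(i < r) F (n i) + F u + F v)%N.
Proof.
move=> jl; rewrite (bigD1 j)//= (bigD1 l) 1?eq_sym//=.
rewrite [in RHS](bigD1 j)//= [in RHS](bigD1 l) 1?eq_sym//=.
rewrite !upd2E !eqxx [l == j]eq_sym (negPf jl).
have -> : (\sum_(i < r | (i != j) && (i != l)) F (upd2 n j l u v i) =
   \sum_(i < r | (i != j) && (i != l)) F (n i))%N.
  by apply: eq_bigr => i /andP[/negPf ij /negPf il]; rewrite upd2E ij il.
by move: (F u) (F v) (F (n j)) (F (n l)) (\sum_(i < r | _) _)%N => *; lia.
Qed.

(** If both new exponents are below the larger old one [M], their weights add up to at most
    [2 B^(M-1) <= B^M], where [B] is the base [r.+2]; the other old exponent makes the inequality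
    strict. *)
Lemma triang_upd2 n j l u v : j != l -> (u + v <= n j + n l)%N ->
  (u < maxn (n j) (n l))%N -> (v < maxn (n j) (n l))%N ->
  triang n 0 (mpolyX R (upd2 n j l u v)).
Proof.
move=> jl uv um vm; apply: triang_low; last first.
  have := upd2_sum n u v id jl; rewrite !mdegE /= => h.
  by rewrite -(leq_add2r (n j + n l)) addnA h -addnA leq_add2l.
have := upd2_sum n u v (expn r.+2) jl; rewrite -/(lex_weight _) -/(lex_weight n) => h.
suff : (r.+2 ^ u + r.+2 ^ v < r.+2 ^ n j + r.+2 ^ n l)%N.
  move: h; move: (lex_weight _) (lex_weight n) (_ ^ u)%N (_ ^ v)%N (_ ^ n j)%N (_ ^ n l)%N.
  by move=> *; lia.
set M := maxn _ _ in um vm.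
have M0 : (0 < M)%N by exact: leq_ltn_trans um.
have uM : (r.+2 ^ u <= r.+2 ^ M.-1)%N by rewrite leq_pexp2l// -ltnS prednK.
have vM : (r.+2 ^ v <= r.+2 ^ M.-1)%N by rewrite leq_pexp2l// -ltnS prednK.
have ME : (r.+2 ^ M = r.+2 * r.+2 ^ M.-1)%N by rewrite -expnS prednK.
have p0 : (0 < r.+2 ^ M.-1)%N by rewrite expn_gt0.
have j0 : (0 < r.+2 ^ n j)%N by rewrite expn_gt0.
have l0 : (0 < r.+2 ^ n l)%N by rewrite expn_gt0.
have : (r.+2 ^ M < r.+2 ^ n j + r.+2 ^ n l)%N.
  rewrite /M /maxn; case: ifP => _; last by rewrite -[X in (X < _)%N]addn0 ltn_add2l.
  by rewrite -[X in (X < _)%N]add0n ltn_add2r.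
apply: leq_ltn_trans; rewrite ME; apply: (@leq_trans (2 * r.+2 ^ M.-1)%N).
  by rewrite mul2n -addnn leq_add.
by rewrite leq_mul2r orbC.
Qed.

(** For [lo <= hi], the geometric sum for [(X_j^hi X_l^lo - X_j^lo X_l^hi) / (X_j - X_l)], times the
    other variables of [X^n]. *)
Definition ddseg n j l (lo hi : nat) : mp :=
  \sum_(x < hi - lo) mpolyX R (upd2 n j l (lo + x) (hi - x.+1)).

Lemma ddsegE n j l lo hi : j != l -> (lo <= hi)%N ->
  (Xv j - Xv l) * ddseg n j l lo hi =
  mpolyX R (upd2 n j l hi lo) - mpolyX R (upd2 n j l lo hi).
Proof.
move=> jl lohi; rewrite /ddseg.
rewrite -(big_mkord xpredT (fun x => mpolyX R (upd2 n j l (lo + x) (hi - x.+1)))) mulr_sumr.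
rewrite (eq_big_nat _ _ (F2 := fun x => mpolyX R (upd2 n j l (lo + x.+1) (hi - x.+1))
   - mpolyX R (upd2 n j l (lo + x) (hi - x)))); last first.
  move=> x /andP[_ xhi]; rewrite mulrBl -!mpolyXD; congr (mpolyX _ _ - mpolyX _ _);
    apply/mnmP => i; rewrite mnmDE mnm1E !upd2E.
    case: (eqVneq i j) => [_|ij]; first by rewrite ?eqxx; lia.
    by rewrite add0n.
  case: (eqVneq i j) => [->|ij]; first by rewrite [l == j]eq_sym (negPf jl).
  by case: (eqVneq i l) => [_|il]; [lia|rewrite add0n].
rewrite (telescope_sumr (fun x => mpolyX R (upd2 n j l (lo + x) (hi - x))))//.
by rewrite subnKC// subKn// addn0 subn0.
Qed.

(* The divided difference [(X^n - X^(n o (j l))) / (X_j - X_l)]. *)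
Definition ddX j l n : mp :=
  if (n l <= n j)%N then ddseg n j l (n l) (n j) else - ddseg n j l (n j) (n l).

Lemma ddXE j l n : j != l ->
  (Xv j - Xv l) * ddX j l n = mpolyX R n - mpolyX R (mperm n (tperm j l)).
Proof.
move=> jl; rewrite /ddX; case: leqP => h; rewrite ?mulrN ddsegE ?upd2_id ?upd2_swap//.
  by rewrite opprB.
exact: ltnW.
Qed.


Lemma upd2_ext n n' j l u v : (forall i, i != j -> i != l -> n i = n' i) ->
  upd2 n j l u v = upd2 n' j l u v.
Proof.
move=> h; apply/mnmP => i; rewrite !upd2E.
by case: eqP => // /eqP ij; case: eqP => // /eqP il; exact: h.
Qed.

Lemma ddseg_ext n n' j l lo hi : (forall i, i != j -> i != l -> n i = n' i) ->
  ddseg n j l lo hi = ddseg n' j l lo hi.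
Proof. by move=> h; apply: eq_bigr => x _; rewrite (upd2_ext _ _ h). Qed.

Lemma triang_opp n c p : triang n c p -> triang n (- c) (- p).
Proof. by move=> /(triangZ (x := -1)); rewrite mulN1r scaleN1r. Qed.

Lemma triang_ddseg n j l lo hi : j != l -> (hi <= maxn (n j) (n l))%N ->
  (lo + hi <= (n j + n l).+1)%N -> triang n 0 (ddseg n j l lo hi).
Proof.
move=> jl hm hs.
have -> : 0 = \sum_(x < hi - lo) (0 : R) by rewrite big1.
by apply: triang_sum => x _; have xh := ltn_ord x; apply: triang_upd2 => //; lia.
Qed.

Lemma triang_ddX_sub n j l : j != l -> (0 < n j)%N ->
  triang n 0 (ddX j l (mnm_sub n (mnm1 j))).
Proof.
move=> jl nj; rewrite /ddX !mnmBE !mnm1E eqxx (negPf jl) subn0 [nat_of_bool true]/=.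
have ext i : i != j -> i != l -> mnm_sub n (mnm1 j) i = n i.
  by move=> ij _; rewrite mnmBE mnm1E eq_sym (negPf ij) subn0.
rewrite !(ddseg_ext _ _ ext); case: leqP => h.
  by apply: triang_ddseg => //; lia.
by rewrite -oppr0; apply: triang_opp; apply: triang_ddseg => //; lia.
Qed.

(** When [n l <= n j], the exponent pairs in the segment run from [(n l, n j)] to [(n j, n l)]. The
    two ends are permutations of [n] and contribute the coefficient, the inner terms are lower. The
    sign of [c] matters: it makes the interaction increase [mu]. *)
Lemma triang_ddX_add n j l : j != l ->
  exists2 c, 0 <= c & triang n c (ddX j l (mnm_add n (mnm1 j))).
Proof.
move=> jl; rewrite /ddX !mnmDE !mnm1E eqxx (negPf jl) addn0 [nat_of_bool true]/=.
have ext i : i != j -> i != l -> mnm_add n (mnm1 j) i = n i.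
  by move=> ij _; rewrite mnmDE mnm1E eq_sym (negPf ij) addn0.
rewrite !(ddseg_ext _ _ ext); case: leqP => h; last first.
  exists 0 => //; rewrite -oppr0; apply: triang_opp.
  by apply: triang_ddseg => //; lia.
have [h'|h'] := leqP (n j + 1) (n l).
  by exists 0 => //; apply: triang_ddseg => //; lia.
(* The indicator of the two ends; they coincide, and count once, if [n j = n l]. *)
pose c (x : 'I_(n j + 1 - n l)) : R := ((x == 0%N :> nat) || (x == (n j - n l)%N :> nat))%:R.
exists (\sum_x c x); first by apply: sumr_ge0.
apply: triang_sum => x _; have xh := ltn_ord x; rewrite /c.
have [x0|x0] := eqVneq (x : nat) 0%N.
  have -> : upd2 n j l (n l + x) (n j + 1 - x.+1) = mperm n (tperm j l).
    by rewrite -upd2_swap; congr upd2; lia.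
  exact: triang_perm.
have [x1|x1] := eqVneq (x : nat) (n j - n l)%N.
  have -> : upd2 n j l (n l + x) (n j + 1 - x.+1) = n.
    apply/mnmP => i; rewrite upd2E.
    by case: eqP => [->|_]; [lia|case: eqP => [->|//]; lia].
  exact: triang_id.
by apply: triang_upd2 => //; lia.
Qed.

(** * The differential operator on monomials *)

Lemma lex_weight_sub n i : (0 < n i)%N ->
  (lex_weight (mnm_sub n (mnm1 i)) < lex_weight n)%N.
Proof.
move=> ni; rewrite /lex_weight (bigD1 i)//= [X in (_ < X)%N](bigD1 i)//=.
rewrite -addSn leq_add//.
  by rewrite mnmBE mnm1E eqxx ltn_exp2l//; lia.
by apply: leq_sum => j _; rewrite leq_pexp2l// mnmBE; lia.
Qed.

Lemma mulXv_sub n i : (0 < n i)%N ->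
  Xv i * mpolyX R (mnm_sub n (mnm1 i)) = mpolyX R n.
Proof.
move=> ni; rewrite -mpolyXD; congr mpolyX; apply/mnmP => j.
rewrite mnmDE mnmBE mnm1E; case: (eqVneq i j) => [<-|_]; last by rewrite subn0.
by lia.
Qed.

Lemma triang_mderiv n i : triang n 0 (mderiv i (mpolyX R n)).
Proof.
rewrite mderivX; case: (posnP (n i)) => [->|ni]; first by rewrite scale0r; exact: triang0.
rewrite -(mulr0 (n i)%:R); apply: triangZ; apply: triang_low.
  exact: lex_weight_sub.
exact: mdegB.
Qed.

Lemma triang_Xv_mderiv n i : triang n (n i)%:R (Xv i * mderiv i (mpolyX R n)).
Proof.
rewrite mderivX; case: (posnP (n i)) => [->|ni].
  by rewrite scale0r mulr0; exact: triang0.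
rewrite -scalerAr mulXv_sub// -[X in triang _ X]mulr1; apply: triangZ.
exact: triang_id.
Qed.

Lemma triang_mderiv2 n i : triang n 0 (mderiv i (mderiv i (mpolyX R n))).
Proof.
rewrite mderivX mderivZ mderivX; case: (posnP (n i)) => [->|ni].
  by rewrite scale0r; exact: triang0.
case: (posnP (mnm_sub n (mnm1 i) i)) => [->|ni'].
  by rewrite scale0r scaler0; exact: triang0.
rewrite scalerA -[X in triang _ X](mulr0 ((n i)%:R * (mnm_sub n (mnm1 i) i)%:R)).
apply: triangZ; apply: triang_low.
  by apply: ltn_trans (lex_weight_sub ni') (lex_weight_sub ni).
by apply: leq_trans (mdegB _ _) (mdegB _ _).
Qed.

Lemma triang_Xv_mderiv2 n i :
  triang n ((n i) * (n i).-1)%:R (Xv i ^+ 2 * mderiv i (mderiv i (mpolyX R n))).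
Proof.
rewrite mderivX mderivZ mderivX; case: (posnP (n i)) => [->|ni].
  by rewrite scale0r mulr0; exact: triang0.
have nE : mnm_sub n (mnm1 i) i = (n i).-1 by rewrite mnmBE mnm1E eqxx subn1.
rewrite nE; case: (posnP (n i).-1) => [->|ni'].
  by rewrite scale0r scaler0 mulr0 muln0; exact: triang0.
rewrite scalerA -natrM -scalerAr expr2 -mulrA mulXv_sub ?nE// mulXv_sub//.
rewrite -[X in triang _ X]mulr1; apply: triangZ.
exact: triang_id.
Qed.


Definition drift0 (b : nat) p : mp := \sum_(i < r)
  ((1 - Xv i ^+ 2) * mderiv i (mderiv i p)
   + ((1 - Xv i) - b.+1%:R *: (1 + Xv i)) * mderiv i p).

(** The slope in [N] of [drift_op], which is affine in [N] with value [drift0] at [N = 0]. *)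
Definition drift1 p : mp := \sum_(i < r) (1 - Xv i) * mderiv i p.

Lemma drift_opE b N p : drift_op b N p = drift0 b p + N%:R *: drift1 p.
Proof.
rewrite /drift_op /drift0 /drift1 scaler_sumr -big_split; apply: eq_bigr => i _ /=.
rewrite -addrA; congr (_ + _); rewrite scalerAl -mulrDl; congr (_ * _).
by rewrite -natr1 scalerDl scale1r; ring.
Qed.

Lemma drift0_linear b c p q : drift0 b (p + c *: q) = drift0 b p + c *: drift0 b q.
Proof.
rewrite /drift0 scaler_sumr -big_split; apply: eq_bigr => i _ /=.
rewrite !mderivD !mderivZ !mulrDr -!scalerAr [c *: (_ + _)]scalerDr.
by rewrite addrACA.
Qed.

Lemma drift1_linear c p q : drift1 (p + c *: q) = drift1 p + c *: drift1 q.
Proof.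
rewrite /drift1 scaler_sumr -big_split; apply: eq_bigr => i _ /=.
by rewrite !mderivD !mderivZ !mulrDr -!scalerAr.
Qed.

Lemma msym_drift0 b s p : msym s (drift0 b p) = drift0 b (msym s p).
Proof.
rewrite /drift0 raddf_sum [RHS](reindex_inj (@perm_inj _ s)); apply: eq_bigr => i _ /=.
by rewrite msymD !msymM !msymB msymZ msymD msym1 rmorphXn/= msym_Xv !msym_mderiv.
Qed.

Lemma msym_drift1 s p : msym s (drift1 p) = drift1 (msym s p).
Proof.
rewrite /drift1 raddf_sum [RHS](reindex_inj (@perm_inj _ s)); apply: eq_bigr => i _ /=.
by rewrite msymM msymB msym1 msym_Xv msym_mderiv.
Qed.

Lemma triang_drift0 b n : triang n (- \sum_(i < r) (n i * (n i + b + 1))%:R)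
  (drift0 b (mpolyX R n)).
Proof.
rewrite -sumrN; apply: triang_sum => i _.
(* [n (n - 1)] comes from the second derivative, [n] and [(b + 1) n] from the drift. *)
have -> : - (n i * (n i + b + 1))%:R =
    (0 + - (n i * (n i).-1)%:R) + (0 - (n i)%:R + - (b.+1%:R * (0 + (n i)%:R))) :> R.
  rewrite !add0r -natrM -!opprD -!natrD; congr (- _%:R).
  by case: (n i) => [|m] /=; lia.
rewrite mulrBl mul1r [X in triang _ _ (_ + X)]mulrBl mulrBl mul1r.
rewrite -scalerAl mulrDl mul1r.
apply: triangD.
  apply: triangD; first exact: triang_mderiv2.
  by apply: triang_opp; exact: triang_Xv_mderiv2.
apply: triangD.
  apply: triangD; first exact: triang_mderiv.
  by apply: triang_opp; exact: triang_Xv_mderiv.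
apply: triang_opp; apply: triangZ; apply: triangD; first exact: triang_mderiv.
exact: triang_Xv_mderiv.
Qed.

Lemma triang_drift1 n : triang n (- (mdeg n)%:R) (drift1 (mpolyX R n)).
Proof.
rewrite mdegE natr_sum -sumrN; apply: triang_sum => i _.
rewrite mulrBl mul1r -[X in triang _ X]add0r; apply: triangD; first exact: triang_mderiv.
by apply: triang_opp; exact: triang_Xv_mderiv.
Qed.

(** The divided difference of [theta j (X^n)] and its image under the transposition of [j] and [l].
    The truncated subtraction is harmless because of the factor [n j]. *)
Definition ddop j l n : mp := (n j)%:R *:
  (ddX j l (mnm_sub n (mnm1 j)) - ddX j l (mnm_add n (mnm1 j))).

Lemma triang_ddop j l n : j != l ->
  exists2 c, 0 <= c & triang n (- c) (ddop j l n).
Proof.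
move=> jl; rewrite /ddop; case: (posnP (n j)) => [->|nj].
  by exists 0 => //; rewrite scale0r oppr0; exact: triang0.
have [c c0 hc] := triang_ddX_add n jl.
exists ((n j)%:R * c); first by rewrite mulr_ge0.
rewrite -mulrN -[- c]add0r; apply: triangZ; apply: triangD.
  exact: triang_ddX_sub.
exact: triang_opp.
Qed.

Local Notation theta j p := ((1 - Xv j ^+ 2) * mderiv j p).

Lemma ddopE j l n : j != l -> (Xv j - Xv l) * ddop j l n =
  theta j (mpolyX R n) - msym (tperm j l) (theta j (mpolyX R n)).
Proof.
move=> jl; have -> : theta j (mpolyX R n) = (n j)%:R *:
    (mpolyX R (mnm_sub n (mnm1 j)) - mpolyX R (mnm_add n (mnm1 j))).
  rewrite mderivX -scalerAr; case: (posnP (n j)) => [->|nj]; first by rewrite !scale0r.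
  rewrite mulrBl mul1r expr2 -mulrA mulXv_sub//; congr (_ *: (_ - _)).
  by rewrite -mpolyXD; congr mpolyX; apply/mnmP => i; rewrite !mnmDE addnC.
rewrite /ddop -scalerAr msymZ -scalerBr; congr (_ *: _).
by rewrite mulrBr !ddXE// msymB !msym_mpolyX tpermV; ring.
Qed.

(** [msymm k] is the average of the monomials [X^n] over the permutations [n] of [k]. Averaging thus
    carries to [msymm k] what is only defined on exponents, such as [ddop]. *)
Definition avg (k : multinom r) (F : multinom r -> mp) : mp :=
  (r`!%:R^-1 : R) *: \sum_(s : 'S_r) F (mperm k s^-1%g).

Lemma msymm_avg k : msymm k = avg k (mpolyX R).
Proof. by rewrite /msymm /symmetrization /avg; under eq_bigr do rewrite msym_mpolyX. Qed.

Lemma avg_linear (L : mp -> mp) k F :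
  (forall c p q, L (p + c *: q) = L p + c *: L q) -> L (avg k F) = avg k (fun n => L (F n)).
Proof.
move=> hL.
have LD p q : L (p + q) = L p + L q by have := hL 1 p q; rewrite !scale1r.
have L0 : L 0 = 0 by apply: (addrI (L 0)); rewrite -LD !addr0.
have LZ c p : L (c *: p) = c *: L p by have := hL c 0 p; rewrite L0 !add0r.
by rewrite LZ (big_morph L LD L0).
Qed.

Lemma triang_avg k (c : multinom r -> R) F : (forall n, triang n (c n) (F n)) ->
  triang k (r`!%:R^-1 * \sum_(s : 'S_r) c (mperm k s^-1%g)) (avg k F).
Proof.
move=> h; apply: triangZ; apply: triang_sum => s _.
exact: (triang_mperm (h _)).
Qed.

(** * Triangularity on symmetrized monomials *)

Section Triangularity.
Variables (a b : nat) (k : multinom r).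

Definition ddH j l : mp := avg k (ddop j l).

Lemma msymm_symmetric n : msymm n \is @symmetric r R.
Proof. exact: symmetrization_symmetric. Qed.

Lemma theta_linear j c p q : theta j (p + c *: q) = theta j p + c *: theta j q.
Proof. by rewrite mderivD mderivZ mulrDr -scalerAr. Qed.

(** For a symmetric polynomial, [theta l] is the transpose of [theta j], so the transposed
    differences defining [ddop] average to the required one. *)
Lemma ddHE j l : (Xv j - Xv l) * ddH j l = theta j (msymm k) - theta l (msymm k).
Proof.
have [->|jl] := eqVneq j l; first by rewrite !subrr mul0r.
have -> : theta l (msymm k) = msym (tperm j l) (theta j (msymm k)).
  rewrite msymM msymB msym1 rmorphXn/= msym_Xv msym_mderiv tpermL.
  by have /issymP -> := msymm_symmetric k.
rewrite msymm_avg /ddH.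
rewrite (avg_linear (L := fun p => (Xv j - Xv l) * p)); last first.
  by move=> c p q; rewrite mulrDr -scalerAr.
rewrite (avg_linear _ _ (theta_linear j)).
rewrite (avg_linear (L := msym (tperm j l))); last first.
  by move=> c p q; rewrite msymD msymZ.
rewrite /avg -scalerBr -sumrB; congr (_ *: _).
by apply: eq_bigr => s _; exact: ddopE.
Qed.

Lemma Xv_sub_neq0 j l : j != l -> Xv j - Xv l != 0.
Proof.
move=> jl; rewrite subr_eq0; apply/eqP => /(congr1 (mcoeff (mnm1 j))).
rewrite !mcoeffX eqxx (_ : (mnm1 l == mnm1 j) = false) => [/eqP|].
  by rewrite oner_eq0.
apply/negbTE; apply: contra jl => /eqP/mnmP/(_ j); rewrite !mnm1E eqxx.
by rewrite eq_sym; case: eqP.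
Qed.

Lemma msym_ddH s j l : j != l -> msym s (ddH j l) = ddH (s j) (s l).
Proof.
move=> jl; have sjl : s j != s l by rewrite (inj_eq (@perm_inj _ s)).
apply: (mulfI (Xv_sub_neq0 sjl)); rewrite ddHE.
rewrite -!msym_Xv -msymB -msymM ddHE msymB !msymM !msymB !msym1 !rmorphXn/=.
by rewrite !msym_Xv !msym_mderiv; have /issymP -> := msymm_symmetric k.
Qed.

Lemma ddH_sym j l : j != l -> ddH j l = ddH l j.
Proof.
move=> jl; apply: (mulfI (Xv_sub_neq0 jl)); rewrite ddHE.
by rewrite -[Xv j - Xv l]opprB mulNr ddHE opprB.
Qed.

Definition ddsum : mp := \sum_(j < r) \sum_(l < r | (j < l)%N) ddH j l.

(** A permutation does not respect [j < l]. Since [ddH] is symmetric in its indices, twice the sum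
    runs over all ordered pairs [j != l], which are permuted. *)
Lemma msym_ddsum s : msym s ddsum = ddsum.
Proof.
have E : ddsum *+ 2 = \sum_(j < r) \sum_(l < r | j != l) ddH j l.
  rewrite mulr2n {2}/ddsum (exchange_big_dep xpredT)//= -big_split; apply: eq_bigr => j _ /=.
  rewrite [RHS](bigID (fun l : 'I_r => (j < l)%N))/=; congr (_ + _).
    by apply: eq_bigl => l; rewrite -val_eqE neq_ltn; case: ltngtP.
  apply: eq_big => [l|l lj]; first by rewrite -val_eqE neq_ltn; case: ltngtP.
  apply: ddH_sym.
  by rewrite -val_eqE neq_ltn lj.
have two0 : (2 : mp) != 0.
  by rewrite -[2]/(2%:R) -(mpolyC1 r R) -mpolyCMn mpolyC_eq0 pnatr_eq0.
apply: (mulIf two0); rewrite !mulr_natr -raddfMn E raddf_sum/=.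
rewrite [RHS](reindex_inj (@perm_inj _ s)); apply: eq_bigr => j _ /=.
rewrite raddf_sum [RHS](reindex_inj (@perm_inj _ s))/=.
apply: eq_big => [l|l jl]; first by rewrite (inj_eq (@perm_inj _ s)).
exact: msym_ddH.
Qed.

(** [mu], [A] and [B] do not depend on [N]. The bound on [mu] makes [N |k| + mu] positive for
    nonzero [k], so that it can be divided by at every natural [N]. *)
Lemma jacobi_op_triangular : exists (mu : R) (A B : mp),
  [/\ (mdeg k)%:R <= mu,
      low (lex_weight k) (mdeg k) A /\ low (lex_weight k) (mdeg k) B,
      A \is @symmetric r R /\ B \is @symmetric r R
    & forall N, drift_op b N (msymm k) + a%:R *: ddsum =
        A + N%:R *: B - (N%:R * (mdeg k)%:R + mu) *: msymm k].
Proof.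
have /issymP ek := msymm_symmetric k.
pose S0 := drift0 b (msymm k) + a%:R *: ddsum.
pose S1 := drift1 (msymm k).
have S0s : S0 \is @symmetric r R.
  by apply/issymP => s; rewrite msymD msymZ msym_drift0 ek msym_ddsum.
have S1s : S1 \is @symmetric r R.
  by apply/issymP => s; rewrite msym_drift1 ek.
have c_ex n : exists2 mu, (mdeg n)%:R <= mu &
    triang n (- mu) (drift0 b (mpolyX R n) + a%:R *:
      \sum_(j < r) \sum_(l < r | (j < l)%N) ddop j l n).
  have hc j l : exists c, [/\ 0 <= c & (j < l)%N -> triang n (- c) (ddop j l n)].
    have [jl|] := boolP (j < l)%N; last by exists 0.
    have jl' : j != l by rewrite -val_eqE neq_ltn jl.
    by have [c c0 hc] := triang_ddop n jl'; exists c.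
  pose c j l := projT1 (cid (hc j l)).
  have cP j l : 0 <= c j l /\ ((j < l)%N -> triang n (- c j l) (ddop j l n)).
    by rewrite /c; case: cid.
  exists (\sum_(i < r) (n i * (n i + b + 1))%:R +
    a%:R * \sum_(j < r) \sum_(l < r | (j < l)%N) c j l).
    rewrite -[leLHS]addr0 lerD//; last first.
      rewrite mulr_ge0// sumr_ge0// => j _; apply: sumr_ge0 => l _.
      exact: (cP j l).1.
    rewrite mdegE natr_sum; apply: ler_sum => i _; rewrite ler_nat.
    by rewrite -[X in (X <= _)%N]muln1 leq_mul// addn1.
  rewrite opprD -mulrN; apply: triangD; first exact: triang_drift0.
  apply: triangZ; rewrite -sumrN; apply: triang_sum => j _.
  by rewrite -sumrN; apply: triang_sum => l /(cP j l).2.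
pose mu n := s2val (cid2 (c_ex n)).
have mu_ge n : (mdeg n)%:R <= mu n by rewrite /mu; case: cid2.
have mu_tr n : triang n (- mu n) (drift0 b (mpolyX R n) + a%:R *:
      \sum_(j < r) \sum_(l < r | (j < l)%N) ddop j l n).
  by rewrite /mu; case: cid2.
have S0E : S0 = avg k (fun n => drift0 b (mpolyX R n) + a%:R *:
      \sum_(j < r) \sum_(l < r | (j < l)%N) ddop j l n).
  rewrite /S0 msymm_avg (avg_linear _ _ (drift0_linear b)) /avg big_split/= scalerDr.
  congr (_ + _); rewrite -scaler_sumr scalerA mulrC -scalerA; congr (_ *: _).
  rewrite exchange_big/= scaler_sumr; apply: eq_bigr => j _.
  rewrite exchange_big/= scaler_sumr; apply: eq_bigr => l _.
  by [].
have S1E : S1 = avg k (fun n => drift1 (mpolyX R n)).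
  by rewrite /S1 msymm_avg (avg_linear _ _ drift1_linear).
(* A [mu] was chosen separately for each permutation of [k]; the operator on [msymm k] sees their
   average. *)
pose m := r`!%:R^-1 * \sum_(s : 'S_r) mu (mperm k s^-1%g).
have avgc (c : R) : r`!%:R^-1 * \sum_(s : 'S_r) c = c.
  by rewrite sumr_const card_Sn -[c *+ _]mulr_natl mulrA mulVf ?mul1r.
exists m, (S0 + m *: msymm k), (S1 + (mdeg k)%:R *: msymm k); split.
- rewrite -[leLHS]avgc /m ler_wpM2l ?invr_ge0//; apply: ler_sum => s _.
  by apply: le_trans (mu_ge _); rewrite mdeg_permuted.
- split.
    have := triang_avg (k := k) mu_tr; rewrite -S0E /triang.
    by rewrite sumrN mulrN -/m scaleNr opprK symmetrization_id.
  have := triang_avg (k := k) triang_drift1; rewrite -S1E /triang.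
  under eq_bigr do rewrite mdeg_permuted.
  by rewrite avgc scaleNr opprK symmetrization_id.
- split; [apply: rpredD => //|apply: rpredD => //]; apply: rpredZ; exact: msymm_symmetric.
- move=> N; rewrite drift_opE -/S1 -addrA [_ + a%:R *: _]addrC addrA -/S0.
  rewrite scalerDr scalerA scalerDl opprD; ring.
Qed.

End Triangularity.
End Symmetrization.

(** * Rational sequences, nonvanishing points, signatures *)

Section RationalSequences.
Variable R : realType.
Implicit Types f g : nat -> R.

(** The denominator is nonzero at all naturals, so that vanishing for large [N] propagates to small
    [N]. *)
Definition rational_seq f := exists p q : {poly R},
  forall N : nat, q.[N%:R] != 0 /\ f N = p.[N%:R] / q.[N%:R].

Lemma rational_cst c : rational_seq (fun=> c).
Proof. by exists c%:P, 1 => N; rewrite !hornerE oner_eq0 divr1. Qed.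

Lemma rational_nat : rational_seq (fun N => N%:R).
Proof. by exists 'X, 1 => N; rewrite !hornerE oner_eq0 divr1. Qed.

Lemma rationalD f g : rational_seq f -> rational_seq g ->
  rational_seq (fun N => f N + g N).
Proof.
move=> [p [q h]] [p' [q' h']]; exists (p * q' + p' * q), (q * q') => N.
have [q0 ->] := h N; have [q0' ->] := h' N.
rewrite !(hornerD, hornerM); move: q.[_] q'.[_] p.[_] p'.[_] q0 q0' => x x' y y' x0 x0'.
split; [exact: mulf_neq0|by field; rewrite x0 x0'].
Qed.

Lemma rationalM f g : rational_seq f -> rational_seq g ->
  rational_seq (fun N => f N * g N).
Proof.
move=> [p [q h]] [p' [q' h']]; exists (p * p'), (q * q') => N.
have [q0 ->] := h N; have [q0' ->] := h' N.
rewrite !(hornerD, hornerM); move: q.[_] q'.[_] p.[_] p'.[_] q0 q0' => x x' y y' x0 x0'.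
split; [exact: mulf_neq0|by field; rewrite x0 x0'].
Qed.

Lemma rationalV f : rational_seq f -> (forall N, f N != 0) ->
  rational_seq (fun N => (f N)^-1).
Proof.
move=> [p [q h]] f0; exists q, p => N; have [q0 fE] := h N.
by move: (f0 N); rewrite fE mulf_eq0 negb_or invf_div => /andP[-> _].
Qed.

Lemma rational_sum (I : eqType) (s : seq I) (F : I -> nat -> R) :
  (forall i, i \in s -> rational_seq (F i)) ->
  rational_seq (fun N => \sum_(i <- s) F i N).
Proof.
elim: s => [|i s IH] h.
  by under eq_fun do rewrite big_nil; exact: rational_cst.
under eq_fun do rewrite big_cons; apply: rationalD.
  by apply: h; rewrite mem_head.
by apply: IH => j js; apply: h; rewrite inE js orbT.
Qed.

Lemma rational_eq0 f N0 : rational_seq f ->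
  (forall N, (N0 <= N)%N -> f N = 0) -> forall N, f N = 0.
Proof.
move=> [p [q h]] f0; suff p0 : p = 0.
  by move=> N; have [_ ->] := h N; rewrite p0 horner0 mul0r.
pose rs := [seq (N0 + i)%:R : R | i <- iota 0 (size p)].
apply: (@roots_geq_poly_eq0 _ p rs).
- apply/allP => x /mapP[i _ ->]; apply/rootP.
  have [q0] := h (N0 + i)%N; rewrite f0 ?leq_addr// => /esym/eqP.
  by rewrite mulf_eq0 invr_eq0 (negPf q0) orbF => /eqP.
- rewrite map_inj_uniq ?iota_uniq// => i j /eqP.
  by rewrite eqr_nat eqn_add2l => /eqP.
- by rewrite size_map size_iota.
Qed.

End RationalSequences.

Lemma digits_inj (B n : nat) (f g : nat -> nat) :
  (forall i, f i < B)%N -> (forall i, g i < B)%N ->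
  (\sum_(i < n) f i * B ^ i = \sum_(i < n) g i * B ^ i)%N ->
  forall i, (i < n)%N -> f i = g i.
Proof.
elim: n f g => [//|n IH] f g fB gB.
have B0 : (0 < B)%N by exact: leq_ltn_trans (fB 0%N).
rewrite !big_ord_recl !expn0 !muln1.
have E h : (\sum_(i < n) h (bump 0 i) * B ^ bump 0 i = (\sum_(i < n) h i.+1 * B ^ i) * B)%N.
  by rewrite big_distrl; apply: eq_bigr => i _ /=; rewrite -mulnA -expnSr.
rewrite !E => h.
have h0 : f 0%N = g 0%N.
  by have := congr1 (modn^~ B) h; rewrite /= ![(_ 0%N + _)%N]addnC !modnMDl !modn_small.
move: h; rewrite h0 => /addnI/eqP; rewrite eqn_pmul2r// => /eqP h.
by case=> // i iS; apply: (IH (fun i => f i.+1) (fun i => g i.+1)).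
Qed.

(** * Nonvanishing points of polynomials and positivity of norms *)

Section NonVanishing.
Variables (R : realType) (r : nat).
Local Notation mp := (mpoly r R).
Local Notation Xv i := (mpolyX R (mnm1 i)).

(* Kronecker substitution [t_i = x ^ (B ^ i)], with [B] above the degree. *)
Lemma mpoly_neq0_point (p : mp) : p != 0 ->
  exists t : 'I_r -> R, (forall i, -1 <= t i <= 1) /\ polyfun p t != 0.
Proof.
move=> p0; pose B := (msize p).+1.
pose kappa (m : multinom r) := (\sum_(i < r) m i * B ^ i)%N.
have kinj m m' : m \in msupp p -> m' \in msupp p -> kappa m = kappa m' -> m = m'.
  move=> mp mp' h.
  have small (m0 : multinom r) : m0 \in msupp p -> forall i, (nth 0%N m0 i < B)%N.
    move=> m0p i; have [ir|ir] := ltnP i r; last by rewrite nth_default// size_tuple.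
    have := msize_mdeg_lt m0p; rewrite mdegE (bigD1 (Ordinal ir))//= => h1.
    rewrite -(mnm_nth 0%N m0 (Ordinal ir)).
    by apply: ltnW; apply: leq_ltn_trans h1; exact: leq_addr.
  apply/mnmP => i; rewrite !(mnm_nth 0%N).
  apply: (digits_inj (n := r) (small _ mp) (small _ mp')) => //.
  by under eq_bigr do rewrite -mnm_nth; under [RHS]eq_bigr do rewrite -mnm_nth.
pose P : {poly R} := \sum_(m <- msupp p) mcoeff m p *: 'X^(kappa m).
have PE x : P.[x] = polyfun p (fun i => x ^+ (B ^ i)).
  rewrite /polyfun mevalE horner_sum; apply: eq_bigr => m _.
  rewrite hornerZ hornerXn; congr (_ * _).
  rewrite /kappa (big_morph (fun n => x ^+ n) (exprD x) (expr0 x)).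
  by apply: eq_bigr => i _; rewrite mulnC exprM.
have P0 : P != 0.
  have mp := mlead_supp p0; apply/eqP => /(congr1 (fun q : {poly R} => q`_(kappa (mlead p)))).
  rewrite coef0 coef_sum (bigD1_seq (mlead p)) ?msupp_uniq//= big_seq_cond big1.
    by rewrite addr0 coefZ coefXn eqxx mulr1 => /eqP; rewrite mleadc_eq0 (negPf p0).
  move=> m /andP[mp' mm]; rewrite coefZ coefXn; case: eqP => [h|]; last by rewrite mulr0.
  by rewrite (kinj _ _ mp mp' h) eqxx in mm.
(* As many points of ]0, 1] as the size of [P], so not all are roots; their powers stay in the
   cube. *)
pose rs := [seq (i.+1%:R)^-1 : R | i <- iota 0 (size P)].
have [x xrs Px] : exists2 x, x \in rs & ~~ root P x.
  apply/hasP; rewrite -[has _ _]negbK -all_predC; apply/negP => h.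
  move/eqP: P0; apply; apply: (@roots_geq_poly_eq0 _ P rs).
  - by apply: sub_all h => x /=; rewrite negbK.
  - rewrite map_inj_uniq ?iota_uniq// => i j /invr_inj/eqP.
    by rewrite eqr_nat => /eqP[].
  - by rewrite size_map size_iota.
exists (fun i => x ^+ (B ^ i)); split; last by rewrite -PE.
move: xrs => /mapP[k _ ->] i.
have k0 : 0 <= (k.+1%:R : R)^-1 by rewrite invr_ge0.
apply/andP; split; last by rewrite exprn_ile1// invf_le1 ?ltr0n// ler1n.
by apply: (@le_trans _ _ 0); [rewrite lerN10|exact: exprn_ge0].
Qed.

Lemma polyfun_inj : injective (@polyfun R r).
Proof.
move=> p q pq; apply/eqP; rewrite -subr_eq0; apply/negPn/negP => /mpoly_neq0_point[t [_]].
rewrite /polyfun mevalB -[meval t p]/(polyfun p t) pq subrr eqxx//.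
Qed.

(** Multiplying [p] by the factors [1 - t_i^2] and [t_i - t_j] gives a nonzero polynomial; at a
    point of the cube where it does not vanish, both [p] and the weight are nonzero. *)
Lemma jacobi_integral_gt0 (a b N : nat) (p : mp) : p != 0 ->
  0 < jacobi_integral a b N (p * p).
Proof.
move=> p0.
pose q : mp := p * ((\prod_(i < r) ((1 - Xv i) * (1 + Xv i))) *
  \prod_(i < r) \prod_(j < r | (i < j)%N) (Xv i - Xv j)).
have c1 i : (1 - Xv i) * (1 + Xv i) != 0.
  apply/eqP => /(congr1 (meval (fun=> 0))).
  rewrite mevalM mevalB mevalD meval1 mevalXU subr0 addr0 mulr1 meval0.
  by move=> /eqP; rewrite oner_eq0.
have q0 : q != 0.
  rewrite mulf_neq0// mulf_neq0//; first by apply/prodf_neq0 => i _; exact: c1.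
  apply/prodf_neq0 => i _; apply/prodf_neq0 => j ij.
  by apply: Xv_sub_neq0; rewrite -val_eqE neq_ltn ij.
have [t [bt qt]] := mpoly_neq0_point q0.
have wge0 s : box (-1) 1 s -> 0 <= jacobi_weight b N s * vandermonde_weight a s.
  move=> bs; apply: mulr_ge0; last first.
    by apply: prodr_ge0 => i _; apply: prodr_ge0 => j _; rewrite exprn_ge0.
  apply: prodr_ge0 => i _; have /andP[s1 s2] := bs i.
  by rewrite mulr_ge0// exprn_ge0//; lra.
apply: (@cube_integral_gt0 _ _ _ _ _ _ t).
- by lra.
- by lra.
- exact: lipschitz_jacobi_integrand.
- move=> s bs; rewrite mulr_ge0 ?wge0//.
  by rewrite /polyfun mevalM -expr2 sqr_ge0.
- exact: bt.
have pt : polyfun (p * p) t = polyfun p t ^+ 2 by rewrite /polyfun mevalM.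
move: qt; rewrite {1}/polyfun mevalM mulf_eq0 negb_or => /andP[pt0].
rewrite {1}mevalM mulf_eq0 negb_or => /andP[h1 h2].
rewrite pt mulr_gt0 ?exprn_even_gt0//= lt_def wge0// andbT mulf_neq0//.
  move: h1; rewrite rmorph_prod => /prodf_neq0 h1; apply/prodf_neq0 => i _.
  have := h1 i isT; rewrite /= mevalM mevalB mevalD meval1 mevalXU mulf_eq0 negb_or.
  by move=> /andP[? ?]; rewrite mulf_neq0// expf_neq0.
move: h2; rewrite rmorph_prod => /prodf_neq0 h2; apply/prodf_neq0 => i _.
have := h2 i isT; rewrite /= rmorph_prod => /prodf_neq0 h3; apply/prodf_neq0 => j ij.
have := h3 j ij; rewrite /= mevalB !mevalXU => h4.
by rewrite expf_neq0// normr_eq0.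
Qed.

End NonVanishing.

(** * Signatures and the weight of the lexicographic order *)

Section Signatures.
Variable r : nat.
Implicit Types n m : multinom r.

Lemma signature_mperm n : exists s, signature (mperm n s).
Proof.
pose t := sort_tuple geq (multinom_val n).
have /tuple_permP[s sE] : perm_eq t (multinom_val n) by rewrite perm_sort.
exists s; apply/forallP => i; apply/forallP => j; apply/implyP => ij.
have mE k : mperm n s k = nth 0%N (sort geq (multinom_val n)) k.
  have -> : sort geq (multinom_val n) = tval t by [].
  by rewrite mpermE sE -tnth_nth tnth_mktuple.
rewrite !mE; have sz : size (sort geq (multinom_val n)) = r by rewrite size_sort size_tuple.
apply: (sorted_leq_nth (leT := geq)) => //.
- by move=> x y z /= h1 h2; exact: leq_trans h2 h1.
- by move=> x /=.
- by apply: sort_sorted => x y /=; exact: leq_total.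
- by rewrite inE sz.
- by rewrite inE sz.
Qed.

(** At the first index [i] of disagreement, the entries of [n] from [i] on are at most [n i], so
    they weigh at most [r * r.+2 ^ n i], less than the single term [r.+2 ^ m i]. *)
Lemma lex_weight_lex n m : signature n -> lex_lt n m ->
  (lex_weight n < lex_weight m)%N.
Proof.
move=> /forallP sn /existsP[i /andP[nm /forallP h]].
rewrite /lex_weight (bigID (fun j : 'I_r => (j < i)%N))/=.
rewrite [X in (_ < X)%N](bigID (fun j : 'I_r => (j < i)%N))/=.
rewrite (eq_bigr (fun j => r.+2 ^ m j)%N); last first.
  by move=> j ji; have /implyP/(_ ji)/eqP -> := h j.
rewrite ltn_add2l [X in (_ < X)%N](bigD1 i) ?ltnn//=.
apply: leq_trans (leq_addr _ _).
apply: (@leq_ltn_trans (r * r.+2 ^ n i)).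
  apply: (@leq_trans (\sum_(j < r) r.+2 ^ n i)); last by rewrite sum_nat_const card_ord.
  rewrite [X in (_ <= X)%N](bigID (fun j : 'I_r => (j < i)%N))/=.
  apply: leq_trans (leq_addl _ _); apply: leq_sum => j.
  rewrite -leqNgt => ij; rewrite leq_pexp2l//.
  by have /forallP/(_ j)/implyP/(_ ij) := sn i.
apply: (@leq_trans (r.+2 ^ (n i).+1)); last by rewrite leq_pexp2l.
by rewrite expnS ltn_pmul2r ?expn_gt0.
Qed.

End Signatures.

(** * The degree of the Jacobi polynomials *)

Section JacobiDegree.
Variables (R : realType) (r a b : nat).
Local Notation mp := (mpoly r R).
Local Notation Xv i := (mpolyX R (mnm1 i)).
Local Notation Sym := (@symmetrization R r).
Local Notation e := (@msymm R r).
Local Notation J := (@jacobi_integral R r a b).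
Local Notation sym p := (p \is @symmetric r R).
Local Notation wt := (@lex_weight r).
Implicit Types (p q g : mp) (k n m : multinom r) (N : nat).

Lemma jacobi_integral0 N : J N 0 = 0.
Proof.
have := jacobi_integral_linear a b N (-1) (0 : mp) 0.
by rewrite scaler0 addr0 mulN1r subrr.
Qed.

Lemma jacobi_integralD N p q : J N (p + q) = J N p + J N q.
Proof. by have := jacobi_integral_linear a b N 1 p q; rewrite scale1r mul1r. Qed.

Lemma jacobi_integralZ N c p : J N (c *: p) = c * J N p.
Proof.
by have := jacobi_integral_linear a b N c 0 p; rewrite jacobi_integral0 !add0r.
Qed.

Lemma jacobi_integralMZ N c p q : J N (p * (c *: q)) = c * J N (p * q).
Proof. by rewrite -scalerAr jacobi_integralZ. Qed.

Lemma jacobi_integral_sum N (I : Type) (s : seq I) (F : I -> mp) :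
  J N (\sum_(x <- s) F x) = \sum_(x <- s) J N (F x).
Proof. exact: (big_morph _ (jacobi_integralD N) (jacobi_integral0 N)). Qed.

Lemma jacobi_integral1_gt0 N : 0 < J N 1.
Proof. by have := jacobi_integral_gt0 a b N (oner_neq0 mp); rewrite mulr1. Qed.

Lemma jacobi_integral_sqr_eq0 N p : J N (p * p) = 0 -> p = 0.
Proof.
by move=> h; apply/eqP/negPn/negP => /(jacobi_integral_gt0 a b N); rewrite h ltxx.
Qed.

Lemma sym_expand p : sym p -> p = \sum_(n <- msupp p) mcoeff n p *: e n.
Proof. by move=> /symmetrization_id {1}<-; exact: symmetrizationE. Qed.

(* [q] is the image of [p] under the self-adjoint operator of the Dirichlet form. *)
Definition dirichlet N p q := forall g,
  J N (\sum_(i < r) (1 - Xv i ^+ 2) * mderiv i p * mderiv i g) = - J N (g * q).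

Lemma dirichlet_adjoint N p q p' q' : dirichlet N p q -> dirichlet N p' q' ->
  J N (p' * q) = J N (p * q').
Proof.
move=> h h'; apply: oppr_inj; rewrite -h -h'; congr jacobi_integral.
by apply: eq_bigr => i _; rewrite mulrAC.
Qed.

Lemma dirichlet_linear N c p q p' q' : dirichlet N p q -> dirichlet N p' q' ->
  dirichlet N (p + c *: p') (q + c *: q').
Proof.
move=> h h' g.
have -> : \sum_(i < r) (1 - Xv i ^+ 2) * mderiv i (p + c *: p') * mderiv i g =
  \sum_(i < r) (1 - Xv i ^+ 2) * mderiv i p * mderiv i g +
  c *: \sum_(i < r) (1 - Xv i ^+ 2) * mderiv i p' * mderiv i g.
  rewrite scaler_sumr -big_split; apply: eq_bigr => i _ /=.
  by rewrite mderivD mderivZ mulrDr mulrDl -scalerAr -scalerAl.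
rewrite jacobi_integral_linear h h' mulrDr -scalerAr jacobi_integral_linear.
by rewrite opprD mulrN.
Qed.

Definition jacobi_image (mu : R) (A B : mp) k N : mp :=
  A + N%:R *: B - (N%:R * (mdeg k)%:R + mu) *: e k.

Lemma jacobi_op_exists k : exists (mu : R) (A B : mp),
  [/\ (mdeg k)%:R <= mu,
      low (wt k) (mdeg k) A /\ low (wt k) (mdeg k) B,
      sym A /\ sym B
    & forall N, dirichlet N (e k) (jacobi_image mu A B k N)].
Proof.
have [mu [A [B [h1 h2 h3 h4]]]] := @jacobi_op_triangular R r a b k.
exists mu, A, B; split=> // N g; rewrite /jacobi_image -h4.
apply: (@jacobi_dirichlet_form R r a b N (e k) g (ddH R k)).
exact: ddHE.
Qed.

(** * Normalised integrals as rational functions of [N] *)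

Definition avgJ N p := J N p / J N 1.

Lemma avgJ_sum N (I : Type) (s : seq I) (F : I -> mp) :
  avgJ N (\sum_(x <- s) F x) = \sum_(x <- s) avgJ N (F x).
Proof. by rewrite /avgJ jacobi_integral_sum mulr_suml. Qed.

Lemma avgJZ N c p : avgJ N (c *: p) = c * avgJ N p.
Proof. by rewrite /avgJ jacobi_integralZ mulrA. Qed.

Lemma avgJD N p q : avgJ N (p + q) = avgJ N p + avgJ N q.
Proof. by rewrite /avgJ jacobi_integralD mulrDl. Qed.

Lemma avgJ_eq0 N p : (avgJ N p == 0) = (J N p == 0).
Proof. by rewrite mulf_eq0 invr_eq0 (gt_eqF (jacobi_integral1_gt0 N)) orbF. Qed.

Lemma rational_avgJ_comb p : sym p ->
  (forall n, n \in msupp p -> rational_seq (fun N => avgJ N (e n))) ->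
  rational_seq (fun N => avgJ N p).
Proof.
move=> sp h; rewrite (sym_expand sp); under eq_fun do rewrite avgJ_sum.
apply: rational_sum => n np; under eq_fun do rewrite avgJZ.
by apply: rationalM; [exact: rational_cst|exact: h].
Qed.

(** Induction on the weight, by the Dirichlet form with [g = 1]. Normalisation is essential: for
    [r = 1] the total mass already contains the factor [2^N]. *)
Lemma rational_avgJ_msymm k : rational_seq (fun N => avgJ N (e k)).
Proof.
have [c] := ubnP (wt k); elim: c k => // c IH k kc.
have [k0|k0] := eqVneq k mnm0.
  have -> : e k = 1.
    rewrite k0 /msymm mpolyX0 symmetrization_id//.
    by apply/issymP => s; rewrite msym1.
  under eq_fun do rewrite /avgJ divff ?(gt_eqF (jacobi_integral1_gt0 _))//.
  exact: rational_cst.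
have [mu [A [B [kmu [lA lB] [sA sB] D]]]] := jacobi_op_exists k.
have mu0 : 0 < mu.
  by apply: lt_le_trans kmu; rewrite ltr0n lt0n mdeg_eq0.
have lam0 N : N%:R * (mdeg k)%:R + mu != 0 by rewrite gt_eqF// ltr_wpDl.
have E N : avgJ N (e k) =
    (N%:R * (mdeg k)%:R + mu)^-1 * (avgJ N A + N%:R * avgJ N B).
  have := D N 1; rewrite big1 => [|i _]; last by rewrite -(mpolyC1 r R) mderivC mulr0.
  rewrite jacobi_integral0 mul1r => /esym/eqP; rewrite oppr_eq0 -avgJ_eq0 => /eqP.
  rewrite /jacobi_image -scaleNr !avgJD !avgJZ mulNr => /eqP; rewrite subr_eq0 => /eqP ->.
  by rewrite mulKf.
have rat p : sym p -> low (wt k) (mdeg k) p -> rational_seq (fun N => avgJ N p).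
  move=> sp lp; apply: rational_avgJ_comb => // n np.
  by apply: IH; have [nk _] := lp _ np; exact: leq_trans nk _.
under eq_fun do rewrite E; apply: rationalM.
  apply: rationalV => //; apply: rationalD; last exact: rational_cst.
  by apply: rationalM; [exact: rational_nat|exact: rational_cst].
apply: rationalD; first exact: rat.
by apply: rationalM; [exact: rational_nat|exact: rat].
Qed.

Lemma rational_avgJ p : sym p -> rational_seq (fun N => avgJ N p).
Proof.
by move=> sp; apply: rational_avgJ_comb => // n _;
  exact: rational_avgJ_msymm.
Qed.

(* Linear combinations of elements of [P] with coefficients rational in [N]. *)
Inductive ratcomb (P : mp -> Prop) : (nat -> mp) -> Prop :=
| ratcomb0 : ratcomb P (fun=> 0)
| ratcombS c p F : rational_seq c -> P p -> ratcomb P F ->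
    ratcomb P (fun N => c N *: p + F N).

Lemma ratcombD P F G : ratcomb P F -> ratcomb P G -> ratcomb P (fun N => F N + G N).
Proof.
move=> hF hG; elim: hF => [|c p F' hc hp _ IH].
  by under eq_fun do rewrite add0r.
by under eq_fun do rewrite -addrA; exact: ratcombS.
Qed.

Lemma ratcombZ P c F : rational_seq c -> ratcomb P F -> ratcomb P (fun N => c N *: F N).
Proof.
move=> hc; elim=> [|d p F' hd hp _ IH].
  by under eq_fun do rewrite scaler0; exact: ratcomb0.
under eq_fun do rewrite scalerDr scalerA.
by apply: (ratcombS (c := fun N => c N * d N)) => //; exact: rationalM.
Qed.

Lemma ratcombN P F : ratcomb P F -> ratcomb P (fun N => - F N).
Proof.
move=> /(ratcombZ (rational_cst (-1))); congr ratcomb.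
by apply/funext => N; rewrite scaleN1r.
Qed.

Lemma ratcombW (P Q : mp -> Prop) F : (forall p, P p -> Q p) -> ratcomb P F -> ratcomb Q F.
Proof.
by move=> PQ; elim=> [|c p F' hc hp _ IH]; [exact: ratcomb0|apply: ratcombS => //; exact: PQ].
Qed.

Lemma ratcomb1 (P : mp -> Prop) p : P p -> ratcomb P (fun=> p).
Proof.
move=> hp; have := ratcombS (rational_cst 1) hp (ratcomb0 P).
by congr ratcomb; apply/funext => N; rewrite scale1r addr0.
Qed.

Lemma ratcomb_ind_at (P Q : mp -> Prop) F : ratcomb P F -> Q 0 ->
  (forall c p q, P p -> Q q -> Q (c *: p + q)) -> forall N, Q (F N).
Proof. by move=> hF Q0 QS N; elim: hF => [//|c p F' hc hp _ IH]; exact: QS. Qed.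

Lemma rational_avgJ_ratcomb F G :
  ratcomb (fun p => sym p) F -> ratcomb (fun p => sym p) G ->
  rational_seq (fun N => avgJ N (F N * G N)).
Proof.
have avg0 N : avgJ N 0 = 0 by rewrite /avgJ jacobi_integral0 mul0r.
have h1 p H : sym p -> ratcomb (fun p => sym p) H ->
    rational_seq (fun N => avgJ N (p * H N)).
  move=> sp; elim=> [|c q H' hc hq _ IH].
    by under eq_fun do rewrite mulr0 avg0; exact: rational_cst.
  under eq_fun do rewrite mulrDr avgJD -scalerAr avgJZ.
  apply: rationalD => //; apply: rationalM => //.
  by apply: rational_avgJ; exact: rpredM.
move=> hF hG; elim: hF => [|c p F' hc hp _ IH].
  by under eq_fun do rewrite mul0r avg0; exact: rational_cst.
under eq_fun do rewrite mulrDl avgJD -scalerAl avgJZ.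
apply: rationalD => //; apply: rationalM => //.
exact: h1.
Qed.

(** One family [F], rational in [N], serves all [N] at once. The new vector [q - G N] either
    vanishes for some [N], and then [q] adds nothing to the span for any [N], or has positive norm
    for every [N] and may be divided by. *)
Lemma gram_schmidt (s : seq mp) p : sym p -> (forall q, q \in s -> sym q) ->
  exists F, ratcomb (fun q => q \in s) F /\
    forall N q, q \in s -> J N ((p - F N) * q) = 0.
Proof.
elim: s p => [|q s IH] p sp ss.
  by exists (fun=> 0); split=> //; exact: ratcomb0.
have ss' q' : q' \in s -> sym q' by move=> qs; apply: ss; rewrite inE qs orbT.
have sq : sym q by apply: ss; rewrite mem_head.
have [G [hG Gorth]] := IH q sq ss'.
have [F [hF Forth]] := IH p sp ss'.
have sub q' : q' \in s -> q' \in q :: s by rewrite inE orbC => ->.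
have span N N' : J N ((p - F N) * G N') = 0.
  apply: (ratcomb_ind_at hG (Q := fun g => J N ((p - F N) * g) = 0)).
    by rewrite mulr0 jacobi_integral0.
  move=> c g g' gs h; rewrite mulrDr jacobi_integralD h addr0 -scalerAr.
  by rewrite jacobi_integralZ Forth ?mulr0.
(* If [q - G N0 = 0] for one [N0] then [q] is in the span of [s], for all [N]. *)
have [[N0 h0]|hy] := pselect (exists N0, q - G N0 = 0).
  exists F; split=> [|N q']; first exact: ratcombW hF.
  rewrite inE => /predU1P[->|]; last exact: Forth.
  by move/eqP: h0; rewrite subr_eq0 => /eqP ->; exact: span.
pose c N := avgJ N ((p - F N) * (q - G N)) / avgJ N ((q - G N) * (q - G N)).
have symW H : ratcomb (fun q => q \in s) H -> ratcomb (fun p => sym p) H.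
  by apply: ratcombW.
have sub_rat p' H : sym p' -> ratcomb (fun q => q \in s) H ->
    ratcomb (fun p => sym p) (fun N => p' - H N).
  move=> sp' /symW hH; apply: ratcombD; first exact: ratcomb1.
  exact: ratcombN.
have yy N : 0 < J N ((q - G N) * (q - G N)).
  by apply: jacobi_integral_gt0; apply/eqP => h; apply: hy; exists N.
have hc : rational_seq c.
  apply: rationalM; first by apply: rational_avgJ_ratcomb; exact: sub_rat.
  apply: rationalV; first by apply: rational_avgJ_ratcomb; exact: sub_rat.
  by move=> N; rewrite avgJ_eq0 gt_eqF.
have cE N : c N * J N ((q - G N) * (q - G N)) = J N ((p - F N) * (q - G N)).
  rewrite /c /avgJ; field; rewrite !gt_eqF ?yy//; exact: jacobi_integral1_gt0.
have Gq N q' : q' \in s -> J N ((q - G N) * q') = 0 by exact: Gorth.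
exists (fun N => F N + c N *: (q - G N)); split.
  apply: ratcombD; first exact: ratcombW hF.
  apply: ratcombZ => //; apply: ratcombD; first by apply: ratcomb1; rewrite mem_head.
  by apply: ratcombN; exact: ratcombW hG.
move=> N; set y := q - G N.
have expand q' : J N ((p - (F N + c N *: y)) * q') = J N ((p - F N) * q') - c N * J N (y * q').
  rewrite opprD addrA mulrDl jacobi_integralD; congr (_ + _).
  by rewrite -scaleNr -scalerAl jacobi_integralZ mulNr.
have oy : J N ((p - (F N + c N *: y)) * y) = 0 by rewrite expand cE subrr.
have os q' : q' \in s -> J N ((p - (F N + c N *: y)) * q') = 0.
  by move=> qs; rewrite expand Forth// Gq// mulr0 subrr.
move=> q'; rewrite inE => /predU1P[->|]; last exact: os.
rewrite -(subrK (G N) q) -/y mulrDr jacobi_integralD oy add0r.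
apply: (ratcomb_ind_at hG (Q := fun g => J N ((p - (F N + c N *: y)) * g) = 0)).
  by rewrite mulr0 jacobi_integral0.
move=> d g g' gs h; rewrite mulrDr jacobi_integralD h addr0 -scalerAr.
by rewrite jacobi_integralZ os ?mulr0.
Qed.

(** * Symmetric polynomials bounded in weight and degree; projections *)

Definition below (w d : nat) p := low w d p /\ sym p.

Lemma below_linear w d c p q : below w d p -> below w d q -> below w d (p + c *: q).
Proof.
move=> [lp sp] [lq sq]; split; first by apply: lowD => //; exact: lowZ.
by apply: rpredD => //; exact: rpredZ.
Qed.

Lemma below0 w d : below w d 0.
Proof. by split; [exact: low0|exact: rpred0]. Qed.

Lemma belowW w d w' d' p : (w <= w')%N -> (d <= d')%N -> below w d p -> below w' d' p.
Proof.
move=> ww dd [lp sp]; split=> // n /lp[h1 h2].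
by split; [exact: leq_trans h1 ww|exact: leq_trans h2 dd].
Qed.

Lemma below_ind w d (Q : mp -> Prop) p : below w d p -> Q 0 ->
  (forall c n q, (wt n < w)%N -> (mdeg n <= d)%N -> Q q -> Q (c *: e n + q)) -> Q p.
Proof.
move=> [lp sp] Q0 QS; rewrite (sym_expand sp) big_seq_cond.
elim/big_rec: _ => [//|n q /andP[np _] Qq]; have [h1 h2] := lp _ np.
exact: QS.
Qed.

Lemma below_orth N w d g p : below w d p ->
  (forall n, (wt n < w)%N -> (mdeg n <= d)%N -> J N (g * e n) = 0) -> J N (g * p) = 0.
Proof.
move=> bp h; apply: (below_ind (Q := fun p => J N (g * p) = 0) bp).
  by rewrite mulr0 jacobi_integral0.
move=> c n q nw nd hq; rewrite mulrDr jacobi_integralD hq addr0 -scalerAr.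
by rewrite jacobi_integralZ h ?mulr0.
Qed.

Lemma below_msymm n w d : (wt n < w)%N -> (mdeg n <= d)%N -> below w d (e n).
Proof. by move=> h1 h2; split; [exact: low_msymm|exact: msymm_symmetric]. Qed.

Lemma below_dirichlet N w d p : below w d p ->
  exists2 q, below w d q & dirichlet N p q.
Proof.
move=> bp; apply: (below_ind (Q := fun p => exists2 q, below w d q & dirichlet N p q) bp).
  exists 0; first exact: below0.
  by move=> g; rewrite mulr0 big1 ?jacobi_integral0 ?oppr0// => i _;
    rewrite mderiv0 mulr0 mul0r.
move=> c n q nw nd [q' bq' hq'].
have [mu [A [B [_ [lA lB] [sA sB] D]]]] := jacobi_op_exists n.
exists (q' + c *: jacobi_image mu A B n N); last by rewrite addrC; exact: dirichlet_linear.
apply: below_linear => //; rewrite /jacobi_image -scaleNr.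
apply: below_linear; last exact: below_msymm.
by apply: below_linear; apply: (@belowW (wt n) (mdeg n)) => //; exact: ltnW.
Qed.

Lemma orthogonal_projection m : exists F,
  ratcomb (fun q => below (wt m) (mdeg m) q) F /\
  forall N q, below (wt m) (mdeg m) q -> J N ((e m - F N) * q) = 0.
Proof.
(* Degrees in [bmultinom] are strictly bounded, hence the successor. *)
pose T := bmultinom r (mdeg m).+1.
pose s := [seq e n | n : T <- enum {: T} & (wt n < wt m)%N].
have sP q : q \in s -> below (wt m) (mdeg m) q.
  by move=> /mapP[n]; rewrite mem_filter => /andP[nm _] ->; apply: below_msymm => //;
    rewrite -ltnS; exact: bmdeg.
have ss q : q \in s -> sym q by move=> /sP[].
have [F [hF Forth]] := gram_schmidt (msymm_symmetric R m) ss.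
exists F; split=> [|N q bq]; first exact: ratcombW hF.
apply: (below_orth bq) => n nw nd; apply: Forth.
have nd' : (mdeg n < (mdeg m).+1)%N by [].
apply/mapP; exists (BMultinom nd') => //.
by rewrite mem_filter nw mem_enum.
Qed.

(* [e m - F N] is an eigenvector. The difference of its eigenvalue and the one
   attached to [n] is affine in [N] with slope [|m| - |n|], so that orthogonality
   can only fail, if [|n| > |m|], for a single [N]; rationality in [N] excludes
   that exception. *)
Lemma orthogonal_to_lex_lower m : exists F,
  ratcomb (fun q => below (wt m) (mdeg m) q) F /\
  forall n N, (wt n < wt m)%N -> J N ((e m - F N) * e n) = 0.
Proof.
have [F [hF Forth]] := orthogonal_projection m; exists F; split=> //.
have bF N : below (wt m) (mdeg m) (F N).
  apply: (ratcomb_ind_at hF); first exact: below0.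
  by move=> c p q bp bq; rewrite addrC; exact: below_linear.
have [mum [Am [Bm [_ [lAm lBm] [sAm sBm] Dm]]]] := jacobi_op_exists m.
pose lam N : R := N%:R * (mdeg m)%:R + mum.
have eig N : dirichlet N (e m - F N) (- lam N *: (e m - F N)).
  have [w bw Dw] := below_dirichlet N (bF N).
  pose Dx := jacobi_image mum Am Bm m N + (-1) *: w.
  have hDx : dirichlet N (e m - F N) Dx.
    by rewrite -[- F N]scaleN1r; exact: dirichlet_linear.
  (* The leading terms cancel, so [u] lies in the [below] space. By self-adjointness it is also
     orthogonal to that space, hence [u = 0]. *)
  pose u := Dx + lam N *: (e m - F N).
  have bu : below (wt m) (mdeg m) u.
    have -> : u = (Am + N%:R *: Bm + (-1) *: w) + (- lam N) *: F N.
      by rewrite /u /Dx /jacobi_image -/(lam N) scalerBr !scaleNr; ring.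
    by do 3 apply: below_linear => //.
  have ou q : below (wt m) (mdeg m) q -> J N (q * u) = 0.
    move=> bq; have [q' bq' Dq] := below_dirichlet N bq.
    rewrite mulrDr jacobi_integralD (dirichlet_adjoint hDx Dq) Forth// add0r.
    by rewrite -scalerAr jacobi_integralZ mulrC [q * _]mulrC Forth// mul0r.
  have u0 : u = 0 by apply: (@jacobi_integral_sqr_eq0 N); exact: ou.
  suff <- : Dx = - lam N *: (e m - F N) by [].
  by apply/eqP; rewrite -subr_eq0 scaleNr opprK; apply/eqP.
move=> n; have [c] := ubnP (wt n); elim: c n => // c IH n nc N nm.
have [nd|nd] := leqP (mdeg n) (mdeg m); first exact: Forth (below_msymm _ _).
have [mu [A [B [_ [lA lB] [sA sB] D]]]] := jacobi_op_exists n.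
(* The induction is uniform in [N]: the lower terms of the image of [e n] must be removed at every
   [N'], not just at the given one. *)
have orth p : below (wt n) (mdeg n) p -> forall N', J N' ((e m - F N') * p) = 0.
  move=> bp N'; apply: (below_orth bp) => n' n'n _; apply: IH.
    exact: leq_trans n'n _.
  exact: ltn_trans nm.
suff h : forall N', avgJ N' ((e m - F N') * e n) = 0.
  by apply/eqP; rewrite -avgJ_eq0 h.
have symF : ratcomb (fun q => sym q) (fun N => e m - F N).
  apply: ratcombD; first by apply: ratcomb1; exact: msymm_symmetric.
  by apply: ratcombN; apply: ratcombW hF => q [].
(* Beyond this threshold the eigenvalues differ: [N' (|n| - |m|) >= N'] exceeds the gap between the
   constant parts. *)
apply: (@rational_eq0 _ _ (Num.truncn `|mu - mum|).+1).
  apply: rational_avgJ_ratcomb => //.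
  by apply: ratcomb1; exact: msymm_symmetric.
move=> N' N'0; apply/eqP; rewrite avgJ_eq0.
have := dirichlet_adjoint (eig N') (D N').
rewrite /jacobi_image mulrDr jacobi_integralD orth; last first.
  by apply: below_linear.
rewrite add0r -scaleNr (jacobi_integralMZ _ (- lam N')).
rewrite (jacobi_integralMZ _ (- (_ + mu))) [e n * _]mulrC => /eqP.
rewrite -subr_eq0 -mulrBl mulf_eq0 => /orP[|//]; rewrite opprK addrC subr_eq0 => /eqP h.
exfalso; have : `|mu - mum| < N'%:R.
  by apply: lt_le_trans (truncnS_gt _) _; rewrite ler_nat.
apply/negP; rewrite -leNgt.
have E : mum - mu = N'%:R * ((mdeg n)%:R - (mdeg m)%:R).
  by rewrite mulrBr; move: h; rewrite /lam => h; lra.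
rewrite distrC E normrM ger0_norm// ler_peMr//.
apply: le_trans (ler_norm _); by rewrite lerBrDr addrC natr1 ler_nat.
Qed.

(** * Degree, norm and completeness of the Jacobi polynomials *)

Section JacobiPolynomials.
Variables (nu : nat) (P : multinom r -> mp).
Hypothesis hP : jacobi_polynomials b nu a P.

Lemma jacobi_lead m : signature m ->
  exists q, (forall n, n \in msupp q -> (wt n < wt m)%N) /\ P m = e m + Sym q.
Proof.
case: hP => Plead _ /Plead[q [qlow ->]]; exists q; split.
  by move=> n /qlow[sn]; exact: lex_weight_lex.
by rewrite symmetrizationD.
Qed.

Lemma jacobi_symmetric m : signature m -> sym (P m).
Proof.
move=> /jacobi_lead[q [_ ->]].
by apply: rpredD; [exact: msymm_symmetric|exact: symmetrization_symmetric].
Qed.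

Lemma jacobi_orth m n : signature m -> signature n -> m <> n -> J nu (P m * P n) = 0.
Proof. by case: hP => _ Porth sm sn mn; rewrite -jacobi_innerE; exact: Porth. Qed.

(** Induction on the weight: [e n] is the Jacobi polynomial of the sorted [n] minus terms of smaller
    weight. Degrees are not controlled here. *)
Lemma jacobi_orth_lower m n : signature m -> (wt n < wt m)%N -> J nu (P m * e n) = 0.
Proof.
move=> sm; have [c] := ubnP (wt n); elim: c n => // c IH n nc nm.
have [s sn] := signature_mperm n.
have [q [qlow qE]] := jacobi_lead sn.
have := jacobi_orth sm sn; rewrite qE mulrDr jacobi_integralD msymm_mperm => /(_ _)/wrap[].
  by move=> mn; rewrite mn lex_weight_mperm ltnn in nm.
suff -> : J nu (P m * Sym q) = 0 by rewrite addr0.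
rewrite symmetrizationE mulr_sumr jacobi_integral_sum big_seq_cond big1// => k /andP[kq _].
have := qlow _ kq; rewrite lex_weight_mperm => kn.
rewrite -scalerAr jacobi_integralZ IH ?mulr0//; last exact: ltn_trans nm.
exact: leq_trans kn _.
Qed.

(** [P m] and [e m - F nu] both equal [e m] plus terms of lower weight and are both orthogonal to
    all such terms. Their difference is therefore orthogonal to itself. *)
Lemma jacobi_degree m : signature m -> below (wt m) (mdeg m) (P m - e m).
Proof.
move=> sm; have [F [hF Forth]] := orthogonal_to_lex_lower m.
have [q [qlow qE]] := jacobi_lead sm.
have bF : below (wt m) (mdeg m) (F nu).
  apply: (ratcomb_ind_at hF); first exact: below0.
  by move=> c p p' bp bp'; rewrite addrC; exact: below_linear.
suff d0 : Sym q + F nu = 0.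
  rewrite qE addrAC subrr add0r -[Sym q]addr0 -(subrr (F nu)) addrA d0 add0r.
  by rewrite -scaleN1r -[_ *: _]add0r; apply: below_linear => //; exact: below0.
(* Some degree bound, however large, is needed only to place the difference in a [below] space. *)
have [d bd] : exists d, below (wt m) d (Sym q + F nu).
  exists (maxn (mdeg m) (msize (Sym q))).
  rewrite -[F nu]scale1r; apply: below_linear; last first.
    by apply: belowW bF; rewrite ?leq_maxl.
  split; last exact: symmetrization_symmetric.
  move=> n np; split; last first.
    by rewrite leq_max; apply/orP; right; exact: ltnW (msize_mdeg_lt np).
  suff : low (wt m) (\max_(n <- msupp q) mdeg n) (Sym q) by move=> /(_ _ np)[].
  rewrite symmetrizationE [X in low _ _ X]big_seq_cond; apply: low_sum => k /andP[kq _].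
  apply: lowZ; apply: low_msymm; first exact: qlow.
  exact: leq_bigmax_seq.
apply: (@jacobi_integral_sqr_eq0 nu); apply: (below_orth bd) => n nm _.
have -> : Sym q + F nu = P m - (e m - F nu) by rewrite qE; ring.
rewrite mulrDl jacobi_integralD jacobi_orth_lower// add0r.
by rewrite -mulN1r -mulrA -scaleN1r -scalerAl mul1r jacobi_integralZ Forth// mulr0.
Qed.

Lemma jacobi_msize m d : signature m -> (mdeg m < d)%N -> (msize (P m) <= d)%N.
Proof.
move=> sm md; rewrite msizeE; apply/bigmax_leqP_seq => n + _.
have -> : P m = (P m - e m) + e m by rewrite subrK.
move=> /msuppD_le; rewrite mem_cat => /orP[/(jacobi_degree sm).1[_]|].
  by move=> h; exact: leq_ltn_trans md.
have : low (wt m).+1 (mdeg m) (e m) by exact: low_msymm.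
by move=> h /h[_] h'; exact: leq_ltn_trans md.
Qed.

(** The coefficient of [X^m] in [P m] is positive: in the symmetrization of [X^m] the identity
    contributes and nothing cancels, and terms of lower weight cannot contain [X^m]. *)
Lemma jacobi_norm_gt0 m : signature m -> 0 < J nu (P m * P m).
Proof.
move=> sm; apply: jacobi_integral_gt0; apply/eqP => P0.
have [q [qlow qE]] := jacobi_lead sm.
have : mcoeff m (P m) = 0 by rewrite P0 mcoeff0.
rewrite qE mcoeffD.
have -> : mcoeff m (Sym q) = 0.
  rewrite symmetrizationE raddf_sum big_seq_cond big1// => k /andP[kq _] /=.
  rewrite mcoeffZ (_ : mcoeff m (e k) = 0) ?mulr0//.
  apply/eqP; rewrite mcoeff_eq0; apply/negP => mk.
  have [] := low_msymm (R := R) (qlow _ kq) (leqnn (mdeg k)) mk.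
  by rewrite ltnn.
rewrite addr0 /msymm /symmetrization mcoeffZ raddf_sum => /eqP; rewrite mulf_eq0.
rewrite invr_eq0 pnatr_eq0 gtn_eqF ?fact_gt0//=.
rewrite (bigD1 1%g)//= msym1m mcoeffX eqxx paddr_eq0//; first by rewrite oner_eq0.
by apply: sumr_ge0 => s _; rewrite msym_mpolyX mcoeffX.
Qed.

(** The remainder [d] is orthogonal to each [P k] with [|k| < M]. As [P k - e k] involves only
    degrees up to [|k|], an induction on the weight makes [d] orthogonal to each [e n] of degree
    below [M], hence to itself. *)
Lemma jacobi_expansion (M : nat) p : sym p -> (msize p <= M)%N ->
  p = \sum_(k : bmultinom r M | signature k)
        (J nu (p * P k) / J nu (P k * P k)) *: P k.
Proof.
move=> sp pM; apply/eqP; rewrite -subr_eq0; apply/eqP.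
set d := _ - _.
have dP k : signature k -> (mdeg k < M)%N -> J nu (d * P k) = 0.
  move=> sk kM; rewrite /d mulrBl -scaleN1r jacobi_integral_linear mulN1r.
  rewrite mulr_suml -big_filter jacobi_integral_sum.
  rewrite (big_rem (BMultinom kM)) ?mem_filter ?sk ?mem_index_enum//=.
  rewrite -scalerAl jacobi_integralZ divfK ?gt_eqF ?jacobi_norm_gt0//.
  rewrite big_seq_cond big1 ?addr0 ?subrr// => k' /andP[+ _].
  rewrite mem_rem_uniq ?filter_uniq ?index_enum_uniq// inE mem_filter => /andP[kk /andP[sk' _]].
  rewrite -scalerAl jacobi_integralZ (jacobi_orth sk' sk) ?mulr0//.
  by move=> h; move/eqP: kk; apply; exact: val_inj.
have de n : (mdeg n < M)%N -> J nu (d * e n) = 0.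
  have [c] := ubnP (wt n); elim: c n => // c IH n nc nM.
  have [s sn] := signature_mperm n.
  have nM' : (mdeg (mperm n s) < M)%N by rewrite mdeg_permuted.
  have bn := jacobi_degree sn.
  rewrite -(msymm_mperm R n s) -[e _](subKr (P (mperm n s))).
  rewrite mulrBr -scaleN1r jacobi_integral_linear dP// add0r.
  rewrite (below_orth bn) ?mulr0// => n'; rewrite lex_weight_mperm mdeg_permuted => h1 h2.
  apply: IH; first exact: leq_trans h1 _.
  exact: leq_ltn_trans nM.
apply: (@jacobi_integral_sqr_eq0 nu).
have sd : sym d.
  apply: rpredB => //; apply: rpred_sum => k sk; apply: rpredZ.
  exact: jacobi_symmetric.
have dM n : n \in msupp d -> (mdeg n < M)%N.
  move=> /msuppB_le; rewrite mem_cat => /orP[np|].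
    exact: leq_trans (msize_mdeg_lt np) pM.
  move=> /msupp_sum_le/flattenP[t /mapP[k]]; rewrite mem_filter => /andP[sk _] ->.
  move=> /msuppZ_le np; apply: leq_trans (msize_mdeg_lt np) _.
  by apply: jacobi_msize => //; exact: bmdeg.
rewrite [X in _ * X](sym_expand sd) mulr_sumr jacobi_integral_sum big_seq_cond.
rewrite big1// => n /andP[nd _].
by rewrite -scalerAr jacobi_integralZ de ?mulr0//; exact: dM.
Qed.

End JacobiPolynomials.
End JacobiDegree.

(** * The substitution t -> 1 - 2t and the kernel *)

Section ChangeOfVariables.
Variable R : realType.
Local Notation mu := (@lebesgue_measure R).
Local Notation flip x := ((1 - x) / 2).

Lemma Rintegral_flip K (g : R -> R) : lips 0 1 K g ->
  \int[mu]_(x in `[0, 1]) g x =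
  2^-1 * \int[mu]_(x in `[-1, 1]) g (flip x).
Proof.
move=> Kg.
have Kh : lips (-1) 1 K (fun x => g (flip x)).
  case: Kg => K0 Kg; split=> // x y xI yI.
  apply: (le_trans (Kg _ _ _ _)); [lra|lra|].
  rewrite ler_wpM2l// (_ : flip x - flip y = - (2^-1 * (x - y))); last by field.
  rewrite normrN normrM ger0_norm ?invr_ge0// ler_piMl//; lra.
(* [A 1] is the integral over [-1, 1], [A (-1)] twice the one over [0, 1]. The constant [2 * K]
   below collects the errors [K], [K / 2] and [K / 2]. *)
pose A z := \int[mu]_(x in `[-1, z]) g (flip x) +
  2 * \int[mu]_(x in `[0, flip z]) g x.
have : A 1 = A (-1).
  apply: (@constant_of_quadratic _ _ _ (2 * K)); first lra.
  move=> z z' z1 zz z2.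
  have h1 := Rintegral_segment_step Kh z1 zz z2.
  have w0 : 0 <= flip z' by lra.
  have w1 : flip z' <= flip z by lra.
  have w2 : flip z <= 1 by lra.
  have h2 := Rintegral_segment_step Kg w0 w1 w2.
  have h3 : `|g (flip z) - g (flip z')| <= K * `|flip z - flip z'|.
    by apply: Kg.2; lra.
  have K0 := Kg.1.
  have wz : flip z - flip z' = 2^-1 * (z' - z) by field.
  rewrite wz in h2 h3.
  rewrite (@ger0_norm _ (2^-1 * (z' - z))) in h3; last by lra.
  rewrite /A.
  set a' := Rintegral _ _ _ in h1 *; set a := Rintegral _ _ _ in h1 *.
  set b := Rintegral _ _ _ in h2 *; set b' := Rintegral _ _ _ in h2 *.
  have -> : a' + 2 * b' - (a + 2 * b) =
    (a' - a - g (flip z) * (z' - z)) - 2 * (b - b' - g (flip z') * (2^-1 * (z' - z)))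
     + (g (flip z) - g (flip z')) * (z' - z) by field.
  have zz0 : 0 <= z' - z by lra.
  have h4 : `|(g (flip z) - g (flip z')) * (z' - z)| <= 2^-1 * K * (z' - z) ^+ 2.
    rewrite normrM (ger0_norm zz0).
    by apply: le_trans (ler_wpM2r zz0 h3) _; rewrite le_eqVlt; apply/orP; left; apply/eqP; ring.
  apply: le_trans (ler_normD _ _) _.
  have h5 : `|a' - a - g (flip z) * (z' - z) - 2 * (b - b' - g (flip z') * (2^-1 * (z' - z)))|
     <= K * (z' - z) ^+ 2 + 2 * (K * (2^-1 * (z' - z)) ^+ 2).
    apply: le_trans (ler_normB _ _) _; rewrite lerD// normrM ger0_norm//.
    by rewrite ler_wpM2l.
  by apply: le_trans (lerD h5 h4) _; rewrite le_eqVlt; apply/orP; left; apply/eqP; field.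
have f1 : flip (1 : R) = 0 by field.
have f2 : flip (-1 : R) = 1 by field.
rewrite /A f1 f2.
rewrite !set_itv1 !Rintegral_set1 mulr0 addr0 add0r => ->.
by rewrite mulrA mulVf ?mul1r.
Qed.

Lemma cube_integral_flip n (f : ('I_n -> R) -> R) : lipschitz_cube 0 1 f ->
  cube_integral 0 1 f =
  2^-1 ^+ n * cube_integral (-1) 1 (fun s => f (fun i => flip (s i))).
Proof.
elim: n f => [|n IH] f [K Kf] /=.
  by rewrite expr0 mul1r; congr f; apply/funext => -[].
have inner x : 0 <= x <= 1 -> lipbox 0 1 K (fun t => f (vcons x t)).
  by move=> xI; exact: lipbox_vconsl.
have Fl : lips 0 1 (K * (1 - 0) ^+ n) (fun x => cube_integral 0 1 (fun t => f (vcons x t))).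
  apply: lips_cube_integral; first exact: ler01.
  - by move=> x xI; exists K; exact: inner.
  - by case: Kf.
  - by move=> x y t xI yI bt; exact: (lipbox_vconsr Kf bt).2.
rewrite (Rintegral_flip Fl) exprS -mulrA; congr (_ * _).
pose F x := cube_integral 0 1 (fun t => f (vcons (flip x) t)).
have [K0 Fl'] := Fl.
have Fl2 : lips (-1) 1 (K * (1 - 0) ^+ n) F.
  split=> // x y xI yI; apply: le_trans (Fl' _ _ _ _) _; [lra|lra|].
  rewrite ler_wpM2l// (_ : flip x - flip y = - (2^-1 * (x - y))); last by field.
  rewrite normrN normrM ger0_norm ?invr_ge0// ler_piMl//; lra.
transitivity (2^-1 ^+ n * \int[mu]_(x in `[-1, 1]) (2 ^+ n * F x)); last first.
  congr (_ * _); apply: eq_Rintegral => x; rewrite inE/= in_itv/= => xI; rewrite /F IH; last first.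
    by exists K; apply: inner; lra.
  rewrite mulrA -exprMn mulfV// expr1n mul1r; congr cube_integral.
  apply/funext => s; congr f; apply/funext => i.
  by case: (unliftP ord0 i) => [j|] ->; rewrite ?vcons_lift ?vcons0.
rewrite RintegralZl//; last exact: lips_integrable Fl2.
by rewrite [RHS]mulrA -exprMn mulVf// expr1n mul1r.
Qed.

End ChangeOfVariables.

Section AffineSubstitution.
Variables (R : realType) (r : nat).
Local Notation mp := (mpoly r R).
Local Notation Xv i := (mpolyX R (mnm1 i)).

Definition affine_subst (al be : R) (p : mp) : mp :=
  \sum_(m <- msupp p) mcoeff m p *: \prod_(i < r) (al *: 1 + be *: Xv i) ^+ m i.

Lemma polyfun_affine_subst al be p t :
  polyfun (affine_subst al be p) t = polyfun p (fun i => al + be * t i).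
Proof.
rewrite /polyfun [RHS]mevalE /affine_subst raddf_sum; apply: eq_bigr => m _ /=.
rewrite mevalZ rmorph_prod; congr (_ * _); apply: eq_bigr => i _ /=.
by rewrite rmorphXn /= mevalD !mevalZ meval1 mevalXU mulr1.
Qed.

Lemma msupp_mul_mdeg d d' (p q : mp) :
  (forall m, m \in msupp p -> (mdeg m <= d)%N) ->
  (forall m, m \in msupp q -> (mdeg m <= d')%N) ->
  forall m, m \in msupp (p * q) -> (mdeg m <= d + d')%N.
Proof.
move=> hp hq m /msuppM_le /allpairsP[[m1 m2] /= [m1p m2q ->]].
by rewrite mdegD leq_add ?hp ?hq.
Qed.

Lemma msize_affine_subst al be p : (msize (affine_subst al be p) <= msize p)%N.
Proof.
rewrite [X in (X <= _)%N]msizeE; apply/bigmax_leqP_seq => n + _.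
move=> /msupp_sum_le/flattenP[t /mapP[m]]; rewrite mem_filter => /andP[_ mp'] ->.
move=> /msuppZ_le np; apply: leq_trans (msize_mdeg_lt mp'); rewrite ltnS [X in (_ <= X)%N]mdegE.
have lin i k : k \in msupp (al *: (1 : mp) + be *: Xv i) -> (mdeg k <= 1)%N.
  move=> /msuppD_le; rewrite mem_cat => /orP[/msuppZ_le|/msuppZ_le].
    by rewrite msupp1 inE => /eqP ->; rewrite mdeg0.
  by rewrite msuppX inE => /eqP ->; rewrite mdeg1.
have pow i e k : k \in msupp ((al *: (1 : mp) + be *: Xv i) ^+ e) -> (mdeg k <= e)%N.
  elim: e k => [|e IH] k; first by rewrite expr0 msupp1 inE => /eqP ->; rewrite mdeg0.
  by rewrite exprS; exact: (msupp_mul_mdeg (lin i) IH).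
move: n np; elim: (index_enum _) => [|i s IH] n.
  by rewrite !big_nil msupp1 inE => /eqP ->; rewrite mdeg0.
by rewrite !big_cons; exact: (msupp_mul_mdeg (pow i (m i)) IH).
Qed.

Lemma polyfun_msym s (p : mp) t : polyfun (msym s p) t = polyfun p (fun i => t (s i)).
Proof.
rewrite /polyfun; elim/mpolyind: p => [|c m p _ _ IH]; first by rewrite msym0 !meval0.
rewrite msymD !mevalD IH msymZ !mevalZ msym_mpolyX !mevalX; congr (_ * _ + _).
rewrite [LHS](reindex_inj (@perm_inj _ s)); apply: eq_bigr => i _ /=.
by rewrite mpermE permK.
Qed.

Lemma affine_subst_symmetric al be p : p \is @symmetric r R ->
  affine_subst al be p \is @symmetric r R.
Proof.
move=> /issymP sp; apply/issymP => s; apply: polyfun_inj; apply/funext => t.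
rewrite polyfun_msym !polyfun_affine_subst.
by rewrite -[in RHS](sp s) polyfun_msym.
Qed.

End AffineSubstitution.

Lemma sum_pairs_ord r : (\sum_(i < r) \sum_(j < r | i < j) 1 = 'C(r, 2))%N.
Proof.
rewrite (exchange_big_dep xpredT)//= -bin2_sum big_mkord; apply: eq_bigr => j _.
by rewrite -(big_ord_widen _ (fun=> 1%N) (ltnW (ltn_ord j))) sum1_card card_ord.
Qed.

(** Powers of 1/2: [r] from the change of variables, [r b + r nu] from the Jacobi weight,
    ['C(r, 2) a] from the Vandermonde factor. Together they give [d + r nu]. *)
Lemma rho_inner_affine_subst (R : realType) (r a b nu : nat) (p q : mpoly r R) :
  rho_inner b nu a (polyfun (affine_subst 1 (-2) p)) (polyfun (affine_subst 1 (-2) q)) =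
  c_Omega R r a b * 2^-1 ^+ (dim_Omega r a b + r * nu) * jacobi_integral a b nu (p * q).
Proof.
have l01 : 0 <= 1 :> R by exact: ler01.
have lc i : lipschitz_cube 0 1 (fun t : 'I_r -> R => t i) by exact: lipschitz_cube_coord.
have l1 : lipschitz_cube 0 1 (fun _ : 'I_r -> R => 1) by exact: lipschitz_cube_cst.
rewrite /rho_inner cube_integral_flip; last first.
  apply: lipschitz_cubeM => //.
    by apply: lipschitz_cubeM => //; exact: lipschitz_cube_polyfun.
  apply: lipschitz_cubeM => //.
    apply: lipschitz_cubeZ; apply: lipschitz_cube_prod => // j _.
    apply: lipschitz_cubeM => //; apply: lipschitz_cubeX => //.
    exact: lipschitz_cubeB.
  do 2 (apply: lipschitz_cube_prod => // ? _); apply: lipschitz_cubeX => //.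
  apply: (lipschitz_cube_comp (K := 1) (h := Num.norm)) => //.
    by move=> x y; rewrite mul1r; exact: ler_dist_dist.
  exact: lipschitz_cubeB.
have lj := lipschitz_jacobi_integrand a b nu (p * q).
have lw : -1 <= 1 :> R by lra.
pose kap := c_Omega R r a b * (2^-1 ^+ (r * b + r * nu + 'C(r, 2) * a)).
transitivity (2^-1 ^+ r * (kap * jacobi_integral a b nu (p * q))).
  congr (_ * _).
  have l0 : lipschitz_cube (-1) 1 (fun _ : 'I_r -> R => 0) by exact: lipschitz_cube_cst.
  have := cube_integral_linear lw kap l0 lj.
  rewrite (cube_integral0 lw r) add0r => <-; congr cube_integral; apply/funext => s.
  rewrite add0r !polyfun_affine_subst.
  have -> : (fun i => 1 + -2 * ((1 - s i) / 2)) = s by apply/funext => i; field.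
  have -> : \prod_(j < r) (((1 - s j) / 2) ^+ b * (1 - (1 - s j) / 2) ^+ nu) =
      2^-1 ^+ (r * b + r * nu) * jacobi_weight b nu s.
    have cst k : (2^-1 : R) ^+ (r * k) = \prod_(j < r) 2^-1 ^+ k.
      by rewrite prodr_const card_ord -exprM mulnC.
    rewrite /jacobi_weight -mulnDr cst -big_split; apply: eq_bigr => j _ /=.
    have -> : 1 - (1 - s j) / 2 = (1 + s j) / 2 by field.
    by rewrite !exprMn exprD; ring.
  have -> : vandermonde_weight a (fun i => (1 - s i) / 2) =
      2^-1 ^+ ('C(r, 2) * a) * vandermonde_weight a s.
    have cst x : x ^+ 'C(r, 2) = \prod_(i < r) \prod_(j < r | (i < j)%N) x :> R.
      rewrite -sum_pairs_ord (big_morph (fun n => x ^+ n) (exprD x) (expr0 x)).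
      apply: eq_bigr => i _; rewrite (big_morph (fun n => x ^+ n) (exprD x) (expr0 x)).
      by apply: eq_bigr => j _; rewrite expr1.
    rewrite mulnC exprM cst -big_split; apply: eq_bigr => i _ /=.
    rewrite -big_split; apply: eq_bigr => j _ /=.
    have -> : (1 - s i) / 2 - (1 - s j) / 2 = 2^-1 * (s j - s i) by field.
    by rewrite normrM ger0_norm ?invr_ge0// exprMn distrC.
  rewrite /kap [polyfun (p * q) s]/polyfun mevalM (exprD _ (r * b + r * nu)).
  by rewrite -!/(polyfun _ _); ring.
rewrite /kap /dim_Omega.
have -> : ('C(r, 2) * a + r * b + r + r * nu = r + (r * b + r * nu + 'C(r, 2) * a))%N by lia.
by rewrite [in RHS](exprD _ r); ring.
Qed.

(** The substitution carries the origin to [(1, ..., 1)], so the reproducing property at 0 gives the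
    Jacobi coefficients of the transported kernel from the values [P k (1, ..., 1)]. The factor
    [c_Omega^-1] appears because [rho_inner] carries [c_Omega] and [jacobi_inner] does not. *)
Theorem theorem24 (R : realType) (r a b nu m : nat)
    (hOmega : characteristic_multiplicities R r a b)
    (hm : (1 <= m)%N)
    (P : multinom r -> mpoly r R)
    (hP : jacobi_polynomials b nu a P)
    (S : ('I_r -> R) -> ('I_r -> R) -> R)
    (hS : reproducing_kernel (@sym_polys R r m) (@rho_inner R r b nu a) S)
    (t : 'I_r -> R) :
  S t (fun=> 0) =
  (c_Omega R r a b)^-1 *
  \sum_(k : bmultinom r m | signature k)
     2 ^+ (dim_Omega r a b + r * nu) * polyfun (P k) (fun=> 1)
     / jacobi_inner b nu a (polyfun (P k)) (polyfun (P k))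
     * polyfun (P k) (fun j => 1 - 2 * t j).
Proof.
have [[s [ss sm sE]] rep] := hS (fun=> 0).
(* The inverse substitution, [t -> (1 - t) / 2]. *)
pose s' := affine_subst 2^-1 (- 2^-1) s.
have s'E : polyfun s = polyfun (affine_subst 1 (-2) s').
  apply/funext => x; rewrite !polyfun_affine_subst; congr meval.
  by apply/funext => i; field.
have s's : s' \is @symmetric r R by exact: affine_subst_symmetric.
have s'm : (msize s' <= m)%N by exact: leq_trans (msize_affine_subst _ _ _) sm.
set D := (dim_Omega r a b + r * nu)%N.
have key p : p \is @symmetric r R -> (msize p <= m)%N ->
    polyfun p (fun=> 1) =
    c_Omega R r a b * 2^-1 ^+ D * jacobi_integral a b nu (p * s').
  move=> ps pm; have := rep (polyfun (affine_subst 1 (-2) p)).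
  rewrite sE s'E rho_inner_affine_subst polyfun_affine_subst => <-.
    by congr meval; apply/funext => i; rewrite mulr0 addr0.
  exists (affine_subst 1 (-2) p); split=> //; first exact: affine_subst_symmetric.
  exact: leq_trans (msize_affine_subst _ _ _) pm.
(* No Gamma value is computed: with [c_Omega = 0], reproducing the constant 1 would give [1 = 0].
   The constant 1 belongs to the space because [1 <= m]. *)
have c0 : c_Omega R r a b != 0.
  apply/eqP => c0; have := key 1; rewrite c0 !mul0r /polyfun meval1 msize1.
  by move=> /(_ (rpred1 _) hm)/eqP; rewrite oner_eq0.
rewrite -[LHS]/((fun x => S x (fun=> 0)) t) sE s'E polyfun_affine_subst.
have -> : (fun i => 1 + -2 * t i) = (fun j => 1 - 2 * t j).
  by apply/funext => i; rewrite mulNr.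
rewrite {1}(jacobi_expansion hP s's s'm) /polyfun raddf_sum mulr_sumr.
apply: eq_bigr => k sk /=; rewrite mevalZ -/(polyfun _ _) mulrA; congr (_ * _).
rewrite jacobi_innerE -/(polyfun (P k) (fun=> 1)).
rewrite (key _ (jacobi_symmetric hP sk) (jacobi_msize hP sk (bmdeg k))).
have J0 : jacobi_integral a b nu (P k * P k) != 0.
  by rewrite gt_eqF// (jacobi_norm_gt0 hP).
have t0 : (2 : R) ^+ D * 2^-1 ^+ D = 1 by rewrite -exprMn mulfV// expr1n.
rewrite [s' * _]mulrC.
move: t0 J0 c0; move: (2 ^+ D) (2^-1 ^+ D) (jacobi_integral _ _ _ (P k * P k))
  (jacobi_integral _ _ _ (P k * s')) (c_Omega R r a b) => u v x y c uv x0 c0.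
have -> : c^-1 * (u * (c * v * y) / x) = (c^-1 * c) * (u * v) * (y / x) by ring.
by rewrite mulVf// uv !mul1r.
Qed.
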